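(* Let $\mathcal{M}=hK_\theta$ be a nearly $S^*$-invariant subspace of $H^2$, where $h$ is its extremal function and $\theta$ is the associated inner function, with $\theta(0)=0$. Let $A_z^{\mathcal{M}}$ be the compressed shift on $\mathcal{M}$. Then $$\sigma(A_z^{\mathcal{M}})=\{\lambda\in\mathbb{D}:\theta(\lambda)=v\}\cup(\sigma(\theta)\cap\mathbb{T}),$$ where $v=\langle\theta,|h|^2\rangle$.
   Context: $H^2=H^2(\mathbb{D})$ is the Hardy space of the unit disc, viewed also as a subspace of $L^2=L^2(\mathbb{T})$; $S$ is the shift $(Sf)(z)=zf(z)$ and $S^*$ is its adjoint. For an inner function $\theta$, $K_\theta=H^2\ominus\theta H^2$. A closed subspace $\mathcal{M}\subseteq H^2$ is nearly $S^*$-invariant if $f\in\mathcal{M}$ and $f(0)=0$ imply $S^*f\in\mathcal{M}$. Saying that $\mathcal{M}=hK_\theta$ is nearly $S^*$-invariant with extremal function $h$ and associated inner function $\theta$, $\theta(0)=0$, means (Hitt's theorem): $h\in\mathcal{M}$, $\|h\|=1$, $h(0)>0$, $h$ is orthogonal to every element of $\mathcal{M}$ vanishing at $0$, and multiplication by $h$ is an isometry of $K_\theta$ onto $\mathcal{M}$. The compressed shift on $\mathcal{M}$ is $A_z^{\mathcal{M}}f=P_{\mathcal{M}}(zf)$, $f\in\mathcal{M}$, where $P_{\mathcal{M}}$ is the orthogonal projection of $L^2$ onto $\mathcal{M}$; $\sigma(\cdot)$ of an operator is its spectrum. Here $\langle\theta,|h|^2\rangle=\int_{\mathbb{T}}\theta|h|^2\,dm$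 with $m$ normalized Lebesgue measure. For a nonconstant inner function $\theta=e^{iy}Bs_\mu$, with $B$ a Blaschke product with zeros $\{a_n\}$ in $\mathbb{D}$ and $s_\mu(z)=\exp\left(-\int_{\mathbb{T}}\frac{\xi+z}{\xi-z}\,d\mu(\xi)\right)$ the singular inner factor with positive singular measure $\mu$, the spectrum of $\theta$ is $\sigma(\theta)=\{a_n\}^-\cup\operatorname{supp}\mu$ (the bar denoting closure); equivalently $\sigma(\theta)=\{\lambda\in\overline{\mathbb{D}}:\liminf_{z\to\lambda,\,z\in\mathbb{D}}|\theta(z)|=0\}$. *)

(* Defs.v *)
From HB Require Import structures.
From mathcomp Require Import all_boot all_order all_algebra.
From mathcomp Require Import complex.
From mathcomp Require Import all_classical all_reals all_analysis.
Set Implicit Arguments.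
Unset Strict Implicit.
Unset Printing Implicit Defensive.
Import Order.TTheory GRing.Theory Num.Theory.
Import numFieldNormedType.Exports.
Import Normc.
Local Open Scope classical_set_scope.
Local Open Scope ring_scope.

Section Hardy.
Context {R : realType}.
(* [R[i]] carries no topology of its own; [R[i]^o] has the one of its norm. *)
Local Notation C := (R[i]^o).
Implicit Types (f g h theta : nat -> C) (z lambda : C).

(** An analytic function on the unit disc is represented by the sequence of its
    Taylor coefficients at 0, so that equality of functions on the disc is
    Leibniz equality.  [ev f z] is its value at [z], for [`|z| < 1]. *)

Definition disc : set C := [set z | normc z < 1].
Definition circle : set C := [set z | normc z = 1].

Definition ev f z : C := limn (series (fun n => f n * z ^+ n)).

(** Cauchy product, i.e. pointwise product on the disc. *)
Definition hmul f g : nat -> C :=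
  fun n => \sum_(i < n.+1) f i * g (n - i)%N.

(** By Parseval, [hdot] is the inner product of [L^2] of the circle. *)

Definition H2 : set (nat -> C) :=
  [set f | cvgn (series (fun n => normc (f n) ^+ 2))].

Definition hdot f g : C := limn (series (fun n => f n * (g n)^*%C)).

Definition hnorm f : R :=
  Num.sqrt (limn (series (fun n => normc (f n) ^+ 2))).

Definition shift f : nat -> C := fun n => if n is m.+1 then f m else 0.

(** [(f - f(0)) / z], see [shift_adjoint]. *)
Definition shift_adj f : nat -> C := fun n => f n.+1.

Lemma shift_adjoint f g : hdot (shift f) g = hdot f (shift_adj g).
Proof.
rewrite /hdot /lim; congr get; apply/funext => l; apply/propext.
suff -> : series (fun n => f n * (shift_adj g n)^*%C) =
  (fun n => series (fun n => shift f n * (g n)^*%C) n.+1) by rewrite cvg_shiftS.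
apply/funext => n; rewrite /series /= big_nat_recl//= mul0r add0r.
by [].
Qed.

Definition closed_subspace (M : set (nat -> C)) : Prop :=
  [/\ M `<=` H2,
      M 0,
      forall (a : C) f g, M f -> M g -> M (a *: f + g) &
      forall f, H2 f ->
        (forall e : R, 0 < e -> exists2 g, M g & hnorm (f - g) < e) -> M f].

(** The circle is parametrized by [t |-> exp(2 i pi t)] on
    [[0, 1]], which carries Lebesgue measure to the normalized measure [m]. *)

Definition cis (t : R) : C := Complex (cos (2 * pi * t)) (sin (2 * pi * t)).

Definition radial f (t : R) : R -> C := fun r => ev f (r%:C%C * cis t).

Definition bdry f (t : R) : C := lim (radial f t r @[r --> 1^'-]).

Definition circle_int (F : R -> C) : C :=
  Complex (\int[lebesgue_measure]_(t in `[0, 1]) complex.Re (F t))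
          (\int[lebesgue_measure]_(t in `[0, 1]) complex.Im (F t)).

Definition inner_function theta : Prop :=
  [/\ H2 theta,
      exists B : R, forall z, disc z -> normc (ev theta z) <= B &
      {ae lebesgue_measure, forall t : R, `[0, 1]%classic t ->
        exists2 l : C, radial theta t r @[r --> 1^'-] --> l & normc l = 1}].

(** For [theta = e^(iy) B s_mu] nonconstant, this is the closure of the zeros of
    [B] together with the support of [mu]. *)
Definition inner_spectrum theta : set C :=
  [set lambda : C | normc lambda <= 1 /\
    limf_einf (fun z : C => (normc (ev theta z))%:E)
              (within disc (nbhs lambda)) = 0%E].

Definition model_space theta : set (nat -> C) :=
  [set f | H2 f /\ forall g, H2 g -> hdot f (hmul theta g) = 0].

Definition nearly_invariant (M : set (nat -> C)) : Prop :=
  closed_subspace M /\ (forall f, M f -> f 0%N = 0 -> M (shift_adj f)).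

(** [M = h K_theta] in the sense of Hitt's theorem.  In [0 < h 0], the order of
    [R[i]] forces [h 0] to be real. *)
Definition hitt_representation (M : set (nat -> C)) h theta : Prop :=
  [/\ [/\ M h, hnorm h = 1, 0 < h 0%N &
          forall f, M f -> f 0%N = 0 -> hdot h f = 0],
      inner_function theta, theta 0%N = 0,
      M = [set hmul h f | f in model_space theta] &
      forall f, model_space theta f -> hnorm (hmul h f) = hnorm f].

(** Such a [p] exists and is unique when [M] is a closed subspace and [g] is in
    [H2]; it is then also the projection of [g] from [L^2] onto [M]. *)
Definition orth_proj (M : set (nat -> C)) (g : nat -> C) : nat -> C :=
  xget 0 [set p | M p /\ forall q, M q -> hdot (g - p) q = 0].

Definition compressed_shift (M : set (nat -> C)) f : nat -> C :=
  orth_proj M (shift f).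

Definition bounded_operator (M : set (nat -> C))
    (T : (nat -> C) -> (nat -> C)) : Prop :=
  [/\ forall f, M f -> M (T f),
      forall (a : C) f g, M f -> M g -> T (a *: f + g) = a *: T f + T g &
      exists B : R, forall f, M f -> hnorm (T f) <= B * hnorm f].

(** Only the values of [T] on [M] matter. *)
Definition op_spectrum (M : set (nat -> C)) (T : (nat -> C) -> (nat -> C)) :
    set C :=
  [set lambda : C | ~ exists2 S, bounded_operator M S &
    forall f, M f ->
      S (T f - lambda *: f) = f /\ T (S f) - lambda *: S f = f].

End Hardy.

(* Main.v *)
(* Multiplication by [h] carries the compressed shift on [M] to
   [V f = z f - <z f, theta> (theta - v)] on [K_theta], because
   [<theta h, h g> = v conj(g(0))] for [g] in [K_theta]; moreover [|v| < 1],
   since [theta h - v h] has norm squared [1 - |v|^2] and value [- v h(0)] at [0].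
   - If [|l| > 1], [V - l] is invertible because [V] is a contraction.
   - If [|l| < 1] and [theta(l) <> v], [V - l] is inverted by dividing
     [g + c (theta - v)] by [z - l], with [c] chosen so that it vanishes at [l];
     if [theta(l) = v], then [(theta - v) / (z - l)] is an eigenvector.
   - If [|l| = 1] and [theta] takes small values near [l], the normalized
     reproducing kernels of [K_theta] are approximate eigenvectors.
   - If [|l| = 1] and [|theta| >= delta] near [l], a maximum principle for the
     averages of [1 / |theta|] over short arcs gives
     [1 - |theta(w)|^2 <= B (1 - |w|^2)] near [l]: averaging is what makes the
     boundary values accessible, as the mean of [1 - |theta|^2] over the circle
     of radius [r] tends to [0].  The reproducing kernels are then bounded near
     [l], so a function of [K_theta] cannot concentrate there and
     [(z - l) f] has norm at least [c |f|].
   The number [v], defined by radial limits, is [<theta h, h>] because [H^2]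
   functions converge radially almost everywhere, with [L^2] norm of the limit
   equal to the norm of the function. *)

Require Import Defs.
From mathcomp Require Import all_boot all_order all_algebra.
From mathcomp Require Import complex.
From mathcomp Require Import all_classical all_reals all_analysis.
From mathcomp Require Import ring lra.
Import Order.TTheory GRing.Theory Num.Theory.
Import numFieldNormedType.Exports.
Import Normc.
Import measurable_realfun.
(* Imported again so that [shift] is not that of [derive]. *)
Import Defs.
Local Open Scope classical_set_scope.
Local Open Scope ring_scope.
Set Implicit Arguments.
Unset Strict Implicit.
Unset Printing Implicit Defensive.

(** * Complex numbers *)

(** Two obstacles shape the proof. Inner functions and [v] are given through radial limits, while
    everything else is algebra on Taylor coefficients. The bridge is a weak type bound for a radial
    maximal function: Cauchy-Schwarz with the kernel [k_w] bounds [|f(w)|^2] by a Poisson mean of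
    [|f|^2], dyadic shells compare this mean with the Hardy-Littlewood maximal function, and density
    of polynomials gives the limits. Only then is multiplication by [theta] known to be an isometry
    of [H^2], from which [|theta| <= 1] and the kernels of [K_theta] follow. Near a regular point of
    the circle the proof uses neither analytic continuation of [theta] nor a theory of subharmonic
    functions. Taylor remainders come from repeated division by [z - w], and subharmonicity of
    [1/|theta|] is replaced by a mean inequality over four points [w + i^k s] with error [O(s^3)],
    which is enough for a maximum principle. Invertibility is treated as bounded below plus onto; on
    the circle, onto follows from a lower bound alone, by perturbation from outside the disc. *)

Section ComplexNumbers.
Context {R : realType}.
Local Notation C := (R[i]^o).
Local Notation Re := complex.Re.
Local Notation Im := complex.Im.
Implicit Types z w : C.

Lemma normc_ge0 z : 0 <= normc z.
Proof. by case: z => a b; exact: sqrtr_ge0. Qed.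

Lemma sqr_normcE z : normc z ^+ 2 = Re z ^+ 2 + Im z ^+ 2.
Proof. by case: z => a b; rewrite sqr_sqrtr// addr_ge0// sqr_ge0. Qed.

Lemma le_normcB z w : normc (z - w) <= normc z + normc w.
Proof. by rewrite (le_trans (le_normcD _ _))// normcN. Qed.

Lemma normcBC z w : normc (z - w) = normc (w - z).
Proof. by rewrite -normcN opprB. Qed.

Lemma le_normc_sub z w : normc z - normc w <= normc (z - w).
Proof. by rewrite lerBlDr (le_trans _ (le_normcD _ _))// subrK. Qed.

Lemma le_dist_normc z w : `|normc z - normc w| <= normc (z - w).
Proof.
rewrite ler_norml le_normc_sub andbT lerNl opprB normcBC.
exact: le_normc_sub.
Qed.

Lemma normc_conj z : normc (z^*%C : C) = normc z.
Proof. by case: z => a b /=; rewrite sqrrN. Qed.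

Lemma normcR (x : R) : normc (x%:C%C : C) = `|x|.
Proof. by rewrite /= expr0n/= addr0 sqrtr_sqr. Qed.

Lemma normc_Re z : `|Re z| <= normc z.
Proof.
by case: z => a b /=; rewrite -sqrtr_sqr ler_sqrt ?addr_ge0 ?sqr_ge0// lerDl sqr_ge0.
Qed.

Lemma normc_Im z : `|Im z| <= normc z.
Proof.
by case: z => a b /=; rewrite -sqrtr_sqr ler_sqrt ?addr_ge0 ?sqr_ge0// lerDr sqr_ge0.
Qed.

Lemma le_normc_ReIm z : normc z <= `|Re z| + `|Im z|.
Proof.
rewrite -(@ler_pXn2r _ 2) ?nnegrE ?addr_ge0 ?normc_ge0//.
rewrite sqr_normcE sqrrD !real_normK ?num_real//.
by rewrite addrAC lerDl mulrn_wge0// mulr_ge0.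
Qed.

Lemma mul_conjc z : z * z^*%C = (normc z ^+ 2)%:C%C.
Proof.
rewrite sqr_normcE; case: z => a b /=.
by apply/eqP; rewrite eq_complex /=; apply/andP; split; apply/eqP; ring.
Qed.

Lemma normcX z n : normc (z ^+ n) = normc z ^+ n.
Proof. by elim: n => [|n IH]; rewrite ?normc1// !exprS normcM IH. Qed.

Lemma normc_sqrD z w :
  normc (z + w) ^+ 2 = normc z ^+ 2 + normc w ^+ 2 + 2 * Re (z * w^*%C).
Proof. by rewrite !sqr_normcE; case: z w => [a b] [c d] /=; ring. Qed.

Lemma normc_eq0 z : (normc z == 0) = (z == 0).
Proof. by apply/eqP/eqP => [/eq0_normc|->]; rewrite ?normc0. Qed.

Lemma normc_gt0 z : (0 < normc z) = (z != 0).
Proof. by rewrite lt_neqAle normc_ge0 andbT eq_sym normc_eq0. Qed.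

Lemma normc_sum (I : Type) (s : seq I) (P : pred I) (F : I -> C) :
  normc (\sum_(i <- s | P i) F i) <= \sum_(i <- s | P i) normc (F i).
Proof.
elim/big_ind2 : _ => [|x1 x2 y1 y2 h1 h2|//]; first by rewrite normc0.
by rewrite (le_trans (le_normcD _ _))// lerD.
Qed.

Lemma ReD z w : Re (z + w) = Re z + Re w. Proof. by case: z w => [? ?] []. Qed.
Lemma ReB z w : Re (z - w) = Re z - Re w. Proof. by case: z w => [? ?] []. Qed.
Lemma ImB z w : Im (z - w) = Im z - Im w. Proof. by case: z w => [? ?] []. Qed.

Section Convergence.
Context {T : Type} {G : set_system T} {FG : Filter G}.
Implicit Types f : T -> C.

(** The norm of [R[i]^o] takes its values in [R[i]], where [0 < e] forces [e] to be real. Limits are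
    moved to the real-valued [normc] through this equivalence. *)
Lemma cvgC_normc f (l : C) :
  f x @[x --> G] --> l <-> normc (f x - l) @[x --> G] --> (0 : R).
Proof.
split => [/cvgrPdist_lt h|/cvgrPdist_lt h].
  apply/cvgrPdist_lt => e e0.
  have := h e%:C%C; rewrite ltcR => /(_ e0); apply: filterS => x.
  change (`|l - f x|) with ((normc (l - f x))%:C%C).
  by rewrite ltcR sub0r normrN ger0_norm ?normc_ge0// normcBC.
apply/cvgrPdist_lt => e; rewrite ltcE /= => /andP[/eqP e0 ee].
have := h _ ee; apply: filterS => x.
change (`|l - f x|) with ((normc (l - f x))%:C%C).
rewrite ltcE /= e0 eqxx /= sub0r normrN ger0_norm ?normc_ge0//.
by rewrite normcBC.
Qed.

Lemma cvgC_squeeze f (l : C) (u : T -> R) :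
  (\forall x \near G, normc (f x - l) <= u x) -> u x @[x --> G] --> (0 : R) ->
  f x @[x --> G] --> l.
Proof.
move=> h hu; apply/cvgC_normc; apply: (squeeze_cvgr _ (cvg_cst (0:R)) hu).
by apply: filterS h => x ->; rewrite normc_ge0.
Qed.

Lemma cvgC_Re f (l : C) : f x @[x --> G] --> l -> Re (f x) @[x --> G] --> Re l.
Proof.
move=> /cvgC_normc h; apply/cvgrPdist_lt => e e0.
move/cvgrPdist_lt : h => /(_ e e0); apply: filterS => x.
rewrite sub0r normrN ger0_norm ?normc_ge0// => /(le_lt_trans _); apply.
by rewrite normcBC -ReB normc_Re.
Qed.

Lemma cvgC_Im f (l : C) : f x @[x --> G] --> l -> Im (f x) @[x --> G] --> Im l.
Proof.
move=> /cvgC_normc h; apply/cvgrPdist_lt => e e0.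
move/cvgrPdist_lt : h => /(_ e e0); apply: filterS => x.
rewrite sub0r normrN ger0_norm ?normc_ge0// => /(le_lt_trans _); apply.
by rewrite normcBC -ImB normc_Im.
Qed.

Lemma cvgC_ReIm f (l : C) : Re (f x) @[x --> G] --> Re l ->
  Im (f x) @[x --> G] --> Im l -> f x @[x --> G] --> l.
Proof.
move=> hr hi.
apply: (@cvgC_squeeze _ _ (fun x => `|Re (f x) - Re l| + `|Im (f x) - Im l|)).
  by apply: nearW => x; rewrite -ReB -ImB le_normc_ReIm.
rewrite -[X in _ --> X]addr0 -[X in _ --> X + _](normr0 R) -[X in _ --> _ + X](normr0 R).
by apply: cvgD; apply: cvg_norm; apply/subr_cvg0.
Qed.

Lemma cvgC_norm f (l : C) :
  f x @[x --> G] --> l -> normc (f x) @[x --> G] --> normc l.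
Proof.
move=> /cvgC_normc h; apply/cvgrPdist_lt => e e0.
move/cvgrPdist_lt : h => /(_ e e0); apply: filterS => x.
rewrite sub0r normrN ger0_norm ?normc_ge0// => /(le_lt_trans _); apply.
by rewrite distrC le_dist_normc.
Qed.

End Convergence.

Lemma limC_eq {T : Type} {G : set_system T} {FG : ProperFilter G}
  (f : T -> C) (l : C) :
  f x @[x --> G] --> l -> lim (f x @[x --> G]) = l.
Proof. by move=> h; apply: cvg_lim => //; exact: norm_hausdorff. Qed.

(** Completeness is taken from [R]: the real and imaginary parts are 1-Lipschitz, so both are
    Cauchy. *)
Lemma cvgC_cauchy {T : Type} {G : set_system T} {FG : ProperFilter G}
  (f : T -> C) :
  (forall e : R, 0 < e -> exists2 A, G A &
     forall x y, A x -> A y -> normc (f x - f y) <= e) ->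
  exists l : C, f x @[x --> G] --> l.
Proof.
move=> h.
have aux (p : C -> R) : (forall x y, `|p x - p y| <= normc (x - y)) ->
    cvg (p (f x) @[x --> G]).
  move=> hp; apply: cauchy_cvg; apply: cauchy_exP => e e0.
  have [A GA hA] := h (e/2) ltac:(by rewrite divr_gt0).
  have [x Ax] := filter_ex GA.
  exists (p (f x)); rewrite /nbhs /=; apply: (@filterS _ _ _ A) => // y Ay.
  rewrite /= -ball_normE /ball_ /=; apply: le_lt_trans (hp _ _) _.
  by rewrite (le_lt_trans (hA _ _ Ax Ay))// gtr_pMr// invf_lt1// ltr1n.
have /cvg_ex[a ha] := aux (@complex.Re R) (fun x y => ltac:(by rewrite -ReB normc_Re)).
have /cvg_ex[b hb] := aux (@complex.Im R) (fun x y => ltac:(by rewrite -ImB normc_Im)).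
by exists (Complex a b); apply: cvgC_ReIm.
Qed.

End ComplexNumbers.

(** * Series *)

Section RealSeries.
Context {R : realType}.
Implicit Types u v : nat -> R.

Lemma series_ge0_nd u : (forall n, 0 <= u n) ->
  {homo series u : n m / (n <= m)%N >-> n <= m}.
Proof.
move=> u0; apply/nondecreasing_seqP => n.
by rewrite /series/= big_nat_recr//= lerDl.
Qed.

Lemma nnseries_cvg u (B : R) : (forall n, 0 <= u n) ->
  (forall n, series u n <= B) -> cvgn (series u).
Proof.
move=> u0 uB; apply: nondecreasing_is_cvgn; first exact: series_ge0_nd.
by exists B => _ [n _ <-].
Qed.

Lemma nnseries_le u n : (forall n, 0 <= u n) -> cvgn (series u) ->
  series u n <= limn (series u).
Proof. by move=> u0 cu; apply: nondecreasing_cvgn_le => //; exact: series_ge0_nd. Qed.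

Lemma nnseries_ge0 u : (forall n, 0 <= u n) -> cvgn (series u) ->
  0 <= limn (series u).
Proof.
by move=> u0 cu; have := nnseries_le 0 u0 cu; rewrite /series/= big_nil.
Qed.

Lemma nnseries_lim_le u (B : R) : cvgn (series u) ->
  (forall n, series u n <= B) -> limn (series u) <= B.
Proof. by move=> cu uB; apply: limr_le => //; apply: nearW. Qed.

Lemma nnseries_term_le u n : (forall n, 0 <= u n) -> cvgn (series u) ->
  u n <= limn (series u).
Proof.
move=> u0 cu; apply: le_trans (nnseries_le n.+1 u0 cu).
rewrite /series/= big_nat_recr//= lerDr; exact: sumr_ge0.
Qed.

Lemma cvgn_le_cst (w : nat -> R) (l B : R) : w @ \oo --> l ->
  (forall n, w n <= B) -> l <= B.
Proof.
by move=> hw wB; rewrite -(cvg_lim _ hw)//; apply: limr_le; [exact: cvgP hw|exact: nearW].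
Qed.

Lemma cvgn_ge_cst (w : nat -> R) (l B : R) : w @ \oo --> l ->
  (forall n, B <= w n) -> B <= l.
Proof.
by move=> hw wB; rewrite -(cvg_lim _ hw)//; apply: limr_ge; [exact: cvgP hw|exact: nearW].
Qed.

Lemma nnseries_tail0 u : cvgn (series u) ->
  (limn (series u) - series u N) @[N --> \oo] --> (0 : R).
Proof.
move=> cu; rewrite -(subrr (limn (series u))).
by apply: cvgB => //; exact: cvg_cst.
Qed.

Lemma series_nat_sub u (N n : nat) : (N <= n)%N ->
  series u n - series u N = \sum_(N <= k < n) u k.
Proof. by move=> Nn; rewrite sub_series Nn. Qed.

End RealSeries.

Section AbsSummable.
Context {R : realType}.
Local Notation C := (R[i]^o).
Implicit Types (u v : nat -> C) (a l : C).

Definition abs_summable u : Prop := cvgn (series (fun n => normc (u n))).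
Definition csum u : C := limn (series u).
Definition l1norm u : R := limn (series (fun n => normc (u n))).

Lemma abs_summableP u : abs_summable u <->
  exists B : R, forall n, series (fun n => normc (u n)) n <= B.
Proof.
split=> [su|[B uB]]; last by apply: (nnseries_cvg (B := B)) => // n; exact: normc_ge0.
by exists (l1norm u) => n; apply: nnseries_le => // k; exact: normc_ge0.
Qed.

Lemma abs_summable_le u (v : nat -> R) : (forall n, normc (u n) <= v n) ->
  cvgn (series v) -> abs_summable u.
Proof.
move=> uv cv; apply: series_le_cvg cv => // n; first exact: normc_ge0.
by rewrite (le_trans _ (uv n))// normc_ge0.
Qed.

Lemma abs_summable_cvg_ex u : abs_summable u -> exists l : C, series u @ \oo --> l.
Proof.
move=> su; apply: cvgC_cauchy => e e0.
have e20 : 0 < e / 2 by rewrite divr_gt0.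
have /cvgrPdist_lt/(_ _ e20)[N _ HN] := nnseries_tail0 su.
exists [set n | (N <= n)%N]; first by exists N.
suff hN n : (N <= n)%N -> normc (series u n - series u N) <= e / 2.
  move=> n m /hN hn /hN hm.
  have -> : series u n - series u m =
    (series u n - series u N) - (series u m - series u N) by rewrite opprB addrA subrK.
  by rewrite (le_trans (le_normcB _ _))// (splitr e) lerD.
move=> Nn; have := HN N (leqnn N); rewrite sub0r normrN => /ltW/(le_trans _); apply.
rewrite ger0_norm ?subr_ge0; last by apply: nnseries_le => // k; exact: normc_ge0.
rewrite sub_series Nn (le_trans (normc_sum _ _ _))//.
rewrite -(series_nat_sub (fun k => normc (u k)))// lerD2r.
by apply: nnseries_le => // k; exact: normc_ge0.
Qed.

Lemma csum_cvg u : abs_summable u -> series u @ \oo --> csum u.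
Proof. by move=> /abs_summable_cvg_ex[l h]; rewrite /csum (limC_eq h). Qed.

Lemma csum_eq u l : series u @ \oo --> l -> csum u = l.
Proof. exact: limC_eq. Qed.

Lemma l1norm_ge0 u : abs_summable u -> 0 <= l1norm u.
Proof. by apply: nnseries_ge0 => n; exact: normc_ge0. Qed.

Lemma normc_csum u : abs_summable u -> normc (csum u) <= l1norm u.
Proof.
move=> su; apply: (cvgn_le_cst (cvgC_norm (csum_cvg su))) => n; rewrite (le_trans (normc_sum _ _ _))//.
by apply: (@nnseries_le _ (fun n => normc (u n))) => // k; exact: normc_ge0.
Qed.

Lemma abs_summableZ a u : abs_summable u -> abs_summable (a *: u).
Proof.
move=> su; apply: (@abs_summable_le _ (normc a *: (fun n => normc (u n)))).
  by move=> n; rewrite normcM.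
exact: is_cvg_seriesZ.
Qed.

Lemma csumD u v : abs_summable u -> abs_summable v ->
  csum (u + v) = csum u + csum v.
Proof.
move=> /csum_cvg hu /csum_cvg hv; apply: csum_eq.
rewrite seriesD; apply: cvgD; [exact: hu|exact: hv].
Qed.

Lemma csumZ a u : abs_summable u -> csum (a *: u) = a * csum u.
Proof.
move=> /csum_cvg hu; apply: csum_eq; rewrite seriesZ.
exact: (@cvgZ _ _ _ _ _ (fun=> a) (series u) a (csum u) (cvg_cst a) hu).
Qed.

Lemma csum_conj u : abs_summable u ->
  abs_summable (fun n => (u n)^*%C) /\ csum (fun n => (u n)^*%C) = ((csum u)^*%C : C).
Proof.
move=> su; split.
  by apply: (@abs_summable_le _ (fun n => normc (u n))) => // n; rewrite normc_conj.
apply: csum_eq; apply: (@cvgC_squeeze _ _ _ _ _ _ (fun n => normc (series u n - csum u))).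
  apply: nearW => n; rewrite -(normc_conj (series u n - csum u)) rmorphB /=.
  by rewrite /series/= rmorph_sum.
by apply/cvgC_normc; exact: csum_cvg.
Qed.

Lemma csum_finite u N : (forall n, (N <= n)%N -> u n = 0) ->
  abs_summable u /\ csum u = \sum_(0 <= k < N) u k.
Proof.
move=> u0; have h n : (N <= n)%N -> series u n = \sum_(0 <= k < N) u k.
  move=> Nn; rewrite /series/= (big_cat_nat (leq0n _) Nn)//= [X in _ + X]big1_seq ?addr0// => k.
  by rewrite mem_index_iota => /andP[_ /andP[Nk _]]; exact: u0.
split.
  apply/abs_summableP; exists (\sum_(0 <= k < N) normc (u k)) => n.
  apply: (@le_trans _ _ (series (fun k => normc (u k)) (maxn n N))).
    by apply: series_ge0_nd; [move=> k; exact: normc_ge0|exact: leq_maxl].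
  rewrite /series/= (big_cat_nat (leq0n _) (leq_maxr n N))//= [X in _ + X]big1_seq ?addr0// => k.
  by rewrite mem_index_iota => /andP[_ /andP[Nk _]]; rewrite u0// normc0.
apply: csum_eq; apply: cvg_near_cst; exists N => //.
Qed.

Lemma csum_recl u : abs_summable u ->
  abs_summable (fun n => u n.+1) /\ csum u = u 0%N + csum (fun n => u n.+1).
Proof.
move=> su.
have E n : series u n.+1 = u 0%N + series (fun n => u n.+1) n.
  by rewrite /series/= big_nat_recl.
have su' : abs_summable (fun n => u n.+1).
  apply/abs_summableP; exists (l1norm u) => n.
  apply: (@le_trans _ _ (series (fun n => normc (u n)) n.+1)).
    by rewrite /series/= big_nat_recl//= lerDr normc_ge0.
  by apply: nnseries_le => // k; exact: normc_ge0.
split=> //; apply: csum_eq; rewrite -cvg_shiftS.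
rewrite (_ : [sequence _]_n = (fun n => u 0%N + series (fun n => u n.+1) n)); last exact/funext.
by apply: cvgD; [exact: cvg_cst|exact: csum_cvg].
Qed.

End AbsSummable.

(** * Cauchy product *)

Lemma triangle_sum (K : pzRingType) (f g : nat -> K) N :
  \sum_(0 <= n < N) \sum_(i < n.+1) f i * g (n - i)%N =
  \sum_(i < N) f i * \sum_(0 <= j < N - i) g j.
Proof.
elim: N => [|N IH]; first by rewrite big_nil big_ord0.
rewrite big_nat_recr//= IH [RHS]big_ord_recr/= subSnn big_nat1.
rewrite [X in _ + X = _]big_ord_recr/= subnn addrA; congr (_ + _).
rewrite -big_split/=; apply: eq_bigr => i _.
by rewrite -mulrDr subSn ?big_nat_recr//= ltnW.
Qed.

Section CauchyProduct.
Context {R : realType}.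
Local Notation C := (R[i]^o).
Implicit Types (a b f g : nat -> C) (c z : C).

Definition seq1 : nat -> C := fun n => (n == 0%N)%:R.

Lemma hmulC f g : hmul f g = hmul g f.
Proof.
apply/funext => n; rewrite /hmul (reindex_inj rev_ord_inj)/=.
by apply: eq_bigr => i _; rewrite subSS mulrC subKn// -ltnS.
Qed.

Lemma hmulDr f g h : hmul f (g + h) = hmul f g + hmul f h.
Proof.
apply/funext => n; rewrite /hmul [RHS]/GRing.add/= -big_split/=.
by apply: eq_bigr => i _; rewrite mulrDr.
Qed.

Lemma hmulZr c f g : hmul f (c *: g) = c *: hmul f g.
Proof.
apply/funext => n; rewrite /hmul [RHS]/GRing.scale/= /GRing.scale/= mulr_sumr.
by apply: eq_bigr => i _; rewrite mulrCA.
Qed.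

Lemma hmulDl f g h : hmul (g + h) f = hmul g f + hmul h f.
Proof. by rewrite hmulC hmulDr !(hmulC f). Qed.

Lemma hmulZl c f g : hmul (c *: g) f = c *: hmul g f.
Proof. by rewrite hmulC hmulZr (hmulC f). Qed.

Lemma hmulBr f g h : hmul f (g - h) = hmul f g - hmul f h.
Proof. by rewrite hmulDr -scaleN1r hmulZr scaleN1r. Qed.

Lemma hmul0r f : hmul f 0 = 0.
Proof. by rewrite -(scale0r (0 : nat -> C)) hmulZr !scale0r. Qed.

Lemma hmul_shiftr f g : hmul f (shift g) = shift (hmul f g).
Proof.
apply/funext => -[|n]; rewrite /hmul.
  by rewrite big_ord_recr big_ord0/= mulr0 addr0.
rewrite big_ord_recr/= subnn/= mulr0 addr0; apply: eq_bigr => i _.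
by rewrite subSn//= -ltnS.
Qed.

Lemma hmul_shiftl f g : hmul (shift f) g = shift (hmul f g).
Proof. by rewrite hmulC hmul_shiftr (hmulC f). Qed.

Lemma hmul1r f : hmul f seq1 = f.
Proof.
apply/funext => n; rewrite /hmul big_ord_recr/= subnn /seq1/= mulr1 big1 ?add0r//.
by move=> i _; rewrite subn_eq0 leqNgt ltn_ord/= mulr0.
Qed.

Lemma shift_shift_adj f : shift (shift_adj f) = f - f 0%N *: seq1.
Proof.
apply/funext => -[|n]; rewrite [RHS]/GRing.add/= /GRing.opp/= /GRing.scale/=.
  by rewrite /GRing.scale/= /seq1 eqxx mulr1 subrr.
by rewrite /GRing.scale/= /seq1/= mulr0 subr0.
Qed.

Lemma hmul_recl a b : hmul a b = a 0%N *: b + shift (hmul (shift_adj a) b).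
Proof.
by rewrite -hmul_shiftl shift_shift_adj hmulDl -scaleNr hmulZl
  (hmulC seq1) hmul1r scaleNr addrC subrK.
Qed.

Lemma shiftD f g : shift (f + g) = shift f + shift g.
Proof. by apply/funext => -[|n]//; rewrite [RHS]/GRing.add/= addr0. Qed.

Lemma shiftZ c f : shift (c *: f) = c *: shift f.
Proof. by apply/funext => -[|n]//; rewrite [RHS]/GRing.scale/= /GRing.scale/= mulr0. Qed.

Lemma series_norm_hmul a b N :
  series (fun n => normc (hmul a b n)) N <=
  \sum_(i < N) normc (a i) * series (fun n => normc (b n)) (N - i)%N.
Proof.
rewrite /series/= -(triangle_sum (fun i => normc (a i)) (fun i => normc (b i))); apply: ler_sum => n _.
by rewrite (le_trans (normc_sum _ _ _))//; apply: ler_sum => i _; rewrite normcM.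
Qed.

Lemma abs_summable_hmul a b : abs_summable a -> abs_summable b ->
  abs_summable (hmul a b) /\ l1norm (hmul a b) <= l1norm a * l1norm b.
Proof.
move=> sa sb.
have h N : series (fun n => normc (hmul a b n)) N <= l1norm a * l1norm b.
  apply: le_trans (series_norm_hmul a b N) _.
  apply: (@le_trans _ _ (\sum_(i < N) normc (a i) * l1norm b)).
    apply: ler_sum => i _; rewrite ler_wpM2l ?normc_ge0//.
    by apply: nnseries_le => // k; exact: normc_ge0.
  rewrite -mulr_suml ler_wpM2r ?l1norm_ge0//.
  rewrite -(big_mkord xpredT (fun i => normc (a i))).
  by apply: (@nnseries_le _ (fun i => normc (a i))) => // k; exact: normc_ge0.
have s : abs_summable (hmul a b) by apply/abs_summableP; exists (l1norm a * l1norm b).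
by split=> //; exact: nnseries_lim_le.
Qed.

Lemma csum_shift a : abs_summable a ->
  abs_summable (shift a) /\ csum (shift a) = csum a.
Proof.
move=> sa.
have s : abs_summable (shift a).
  apply/abs_summableP; exists (l1norm a) => -[|n].
    by rewrite /series/= big_nil l1norm_ge0.
  rewrite /series [X in X <= _]big_nat_recl// (normc0 R : normc (shift a 0%N) = 0) add0r.
  by apply: (@nnseries_le _ (fun i => normc (a i))) => // k; exact: normc_ge0.
by split=> //; have [_ ->] := csum_recl s; rewrite add0r.
Qed.

Lemma l1norm_iter_shift_adj a n : abs_summable a ->
  abs_summable (iter n shift_adj a) /\
  l1norm (iter n shift_adj a) = l1norm a - series (fun k => normc (a k)) n.
Proof.
move=> sa; elim: n => [|n [s e]]; first by rewrite /series/= big_nil subr0.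
have [s' _] := csum_recl s; split; first exact: s'.
have it k : iter n shift_adj a k = a (n + k)%N.
  by elim: n k {s e s'} => [|n IH] k //=; rewrite /shift_adj IH addnS addSn.
rewrite /series/= big_nat_recr//= opprD addrA -[X in _ = X - _]e.
suff -> : l1norm (iter n shift_adj a) =
    normc (a n) + l1norm (shift_adj (iter n shift_adj a)) by rewrite addrAC subrr add0r.
rewrite {1}/l1norm; apply: cvg_lim => //; rewrite -cvg_shiftS.
rewrite (_ : [sequence _]_n = (fun m => normc (a n) +
    series (fun k => normc (shift_adj (iter n shift_adj a) k)) m)).
  by apply: cvgD; [exact: cvg_cst|exact: s'].
by apply/funext => m; rewrite /series/= big_nat_recl//= it addn0.
Qed.

(** The defect [D a] does not change when the first coefficient of [a] is dropped, by [hmul_recl],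
    and it is at most twice [l1norm a * l1norm b]. After [n] steps [a] is replaced by a tail, whose
    l1 norm tends to 0. *)
Lemma csum_hmul a b : abs_summable a -> abs_summable b ->
  csum (hmul a b) = csum a * csum b.
Proof.
move=> sa sb; pose D a := csum (hmul a b) - csum a * csum b.
have Drec x : abs_summable x -> D x = D (shift_adj x).
  move=> sx; have [sx' ex] := csum_recl sx.
  have [sp _] := abs_summable_hmul sx' sb.
  have [ssp es] := csum_shift sp.
  rewrite /D hmul_recl csumD ?csumZ ?es//; last exact: abs_summableZ.
  by rewrite ex mulrDl opprD addrACA subrr add0r.
have Dn n : D a = D (iter n shift_adj a).
  elim: n => // n ->; rewrite Drec//.
  by have [] := l1norm_iter_shift_adj n sa.
have Dle x : abs_summable x -> normc (D x) <= 2 * (l1norm x * l1norm b).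
  move=> sx; have [sp lp] := abs_summable_hmul sx sb.
  rewrite (le_trans (le_normcB _ _))// mulr2n mulrDl mul1r lerD//.
    by rewrite (le_trans (normc_csum sp)).
  by rewrite normcM ler_pM ?normc_ge0 ?normc_csum.
suff /eqP : normc (D a) = 0 by rewrite normc_eq0 subr_eq0 => /eqP.
apply/eqP; rewrite eq_le normc_ge0 andbT.
have h : (fun n => 2 * ((l1norm a - series (fun k => normc (a k)) n) * l1norm b))
    @ \oo --> 2 * (0 * l1norm b).
  by apply: cvgMl_tmp; apply: cvgMr_tmp; exact: nnseries_tail0.
rewrite mul0r mulr0 in h.
apply: (cvgn_ge_cst h) => n; have [s e] := l1norm_iter_shift_adj n sa.
by rewrite -e (Dn n); exact: Dle.
Qed.

(* Dilation by [z]: turns evaluation at [z] into a sum of coefficients. *)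
Definition dil f z : nat -> C := fun n => f n * z ^+ n.

Lemma evE f z : ev f z = csum (dil f z). Proof. by []. Qed.

Lemma dil_hmul f g z : dil (hmul f g) z = hmul (dil f z) (dil g z).
Proof.
apply/funext => n; rewrite /dil /hmul mulr_suml; apply: eq_bigr => i _.
by rewrite mulrACA -exprD subnKC// -ltnS.
Qed.

Lemma dilD f g z : dil (f + g) z = dil f z + dil g z.
Proof. by apply/funext => n; rewrite /dil [RHS]/GRing.add/= -mulrDl. Qed.

Lemma dilZ c f z : dil (c *: f) z = c *: dil f z.
Proof. by apply/funext => n; rewrite /dil/= -[RHS]/(c * _) mulrA. Qed.

Lemma dil_dil f z c : dil (dil f z) c = dil f (z * c).
Proof. by apply/funext => n; rewrite /dil exprMn mulrA. Qed.

Lemma abs_summable_dil f z (B : R) : (forall n, normc (f n) <= B) ->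
  normc z < 1 -> abs_summable (dil f z).
Proof.
move=> fB z1; apply: (@abs_summable_le _ _ (geometric B (normc z))).
  by move=> n; rewrite normcM normcX /geometric/= ler_wpM2r// exprn_ge0 ?normc_ge0.
by apply: is_cvg_geometric_series; rewrite ger0_norm ?normc_ge0.
Qed.

Lemma abs_summable_dil_circle f z : abs_summable f -> normc z = 1 ->
  abs_summable (dil f z).
Proof.
move=> sf z1; apply: (abs_summable_le _ sf) => n.
by rewrite normcM normcX z1 expr1n mulr1.
Qed.

End CauchyProduct.

(** * The Hardy space *)

Section SquareSummable.
Context {R : realType}.
Local Notation C := (R[i]^o).
Local Notation Re := complex.Re.
Implicit Types (f g : nat -> C) (a c : C).

Let sq f : nat -> R := fun n => normc (f n) ^+ 2.

Let sq_ge0 f n : 0 <= sq f n. Proof. exact: sqr_ge0. Qed.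

Lemma H2P f : H2 f <-> exists B : R, forall n, series (fun n => normc (f n) ^+ 2) n <= B.
Proof.
split=> [Hf|[B fB]]; last exact: (nnseries_cvg (B := B) (sq_ge0 f)).
by exists (limn (series (sq f))) => n; exact: (nnseries_le _ (sq_ge0 f)).
Qed.

Lemma hnorm_ge0 f : 0 <= hnorm f. Proof. exact: sqrtr_ge0. Qed.

Lemma hnorm_sqr f : H2 f -> hnorm f ^+ 2 = limn (series (fun n => normc (f n) ^+ 2)).
Proof. by move=> Hf; rewrite sqr_sqrtr//; exact: (nnseries_ge0 (sq_ge0 f)). Qed.

Lemma hnorm_sqr_cvg f : H2 f -> series (fun n => normc (f n) ^+ 2) @ \oo --> hnorm f ^+ 2.
Proof. by move=> Hf; rewrite hnorm_sqr//; exact: Hf. Qed.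

Lemma series_le_hnorm f n : H2 f -> series (fun n => normc (f n) ^+ 2) n <= hnorm f ^+ 2.
Proof. by move=> Hf; rewrite hnorm_sqr//; exact: (nnseries_le _ (sq_ge0 f)). Qed.

Lemma hnorm_le f (B : R) : 0 <= B ->
  (forall n, series (fun n => normc (f n) ^+ 2) n <= B ^+ 2) -> H2 f /\ hnorm f <= B.
Proof.
move=> B0 fB; have Hf : H2 f by apply/H2P; exists (B ^+ 2).
split=> //; rewrite -(@ler_pXn2r _ 2) ?nnegrE ?hnorm_ge0// hnorm_sqr//.
exact: nnseries_lim_le.
Qed.

Lemma le_coef_hnorm f n : H2 f -> normc (f n) <= hnorm f.
Proof.
move=> Hf; rewrite -(@ler_pXn2r _ 2) ?nnegrE ?hnorm_ge0 ?normc_ge0// hnorm_sqr//.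
exact: (nnseries_term_le _ (sq_ge0 f)).
Qed.

Lemma hnorm_eq0 f : H2 f -> hnorm f = 0 -> f = 0.
Proof.
move=> Hf f0; apply/funext => n; apply/eqP; rewrite -normc_eq0 eq_le normc_ge0 andbT.
by rewrite -f0; exact: le_coef_hnorm.
Qed.

Lemma sqrD_le (x y : R) : (x + y) ^+ 2 <= 2 * (x ^+ 2 + y ^+ 2).
Proof. by rewrite -subr_ge0 (_ : _ - _ = (x - y) ^+ 2) ?sqr_ge0//; ring. Qed.

Lemma H2D f g : H2 f -> H2 g -> H2 (f + g).
Proof.
move=> Hf Hg; apply: (@series_le_cvg _ _ (2 *: (sq f + sq g))) => [n|n|n|].
- exact: sqr_ge0.
- by rewrite mulr_ge0// addr_ge0.
- apply: le_trans (sqrD_le _ _).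
  by rewrite ler_pXn2r ?nnegrE ?addr_ge0 ?normc_ge0// le_normcD.
- by apply: is_cvg_seriesZ; apply: is_cvg_seriesD.
Qed.

Lemma H2Z a f : H2 f -> H2 (a *: f).
Proof.
move=> Hf; apply: (@series_le_cvg _ _ (normc a ^+ 2 *: sq f)) => [n|n|n|].
- exact: sqr_ge0.
- by rewrite mulr_ge0// sqr_ge0.
- by rewrite normcM exprMn.
- exact: is_cvg_seriesZ.
Qed.

Lemma H2N f : H2 f -> H2 (- f).
Proof. by rewrite -scaleN1r; exact: H2Z. Qed.

Lemma H2B f g : H2 f -> H2 g -> H2 (f - g).
Proof. by move=> Hf Hg; apply: H2D => //; exact: H2N. Qed.

Lemma H2_0 : H2 (0 : nat -> C).
Proof. by apply/H2P; exists 0 => n; rewrite [leLHS]big1// => k _; rewrite [X in X ^+ 2]normc0 expr0n. Qed.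

Lemma hdot_summable f g : H2 f -> H2 g -> abs_summable (fun n => f n * (g n)^*%C).
Proof.
move=> Hf Hg; apply: (@abs_summable_le _ _ (sq f + sq g)); last exact: is_cvg_seriesD.
move=> n; rewrite normcM normc_conj -[X in _ <= X]/(sq f n + sq g n) /sq.
have := sqr_ge0 (normc (f n) - normc (g n)).
have := normc_ge0 (f n); have := normc_ge0 (g n); nra.
Qed.

Lemma hdotE f g : hdot f g = csum (fun n => f n * (g n)^*%C). Proof. by []. Qed.

Lemma hdotDl f g h : H2 f -> H2 g -> H2 h -> hdot (f + g) h = hdot f h + hdot g h.
Proof.
move=> Hf Hg Hh; rewrite !hdotE -csumD; try exact: hdot_summable.
by congr csum; apply/funext => n; rewrite [RHS]/GRing.add/= -mulrDl.
Qed.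

Lemma hdotZl a f g : H2 f -> H2 g -> hdot (a *: f) g = a * hdot f g.
Proof.
move=> Hf Hg; rewrite !hdotE -csumZ; last exact: hdot_summable.
by congr csum; apply/funext => n; rewrite -[RHS]/(a * _) mulrA.
Qed.

Lemma hdotC f g : H2 f -> H2 g -> hdot f g = (hdot g f)^*%C.
Proof.
move=> Hf Hg; rewrite !hdotE -(csum_conj (hdot_summable Hg Hf)).2.
by congr csum; apply/funext => n; rewrite rmorphM/= conjcK mulrC.
Qed.

Lemma hdotDr f g h : H2 f -> H2 g -> H2 h -> hdot h (f + g) = hdot h f + hdot h g.
Proof.
by move=> Hf Hg Hh; rewrite hdotC ?hdotDl//; [rewrite rmorphD/= -!hdotC|exact: H2D].
Qed.

Lemma hdotZr a f g : H2 f -> H2 g -> hdot g (a *: f) = a^*%C * hdot g f.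
Proof.
by move=> Hf Hg; rewrite hdotC ?hdotZl//; [rewrite rmorphM/= -hdotC|exact: H2Z].
Qed.

Lemma hdotNl f g : H2 f -> H2 g -> hdot (- f) g = - hdot f g.
Proof. by move=> Hf Hg; rewrite -scaleN1r hdotZl// mulN1r. Qed.

Lemma hdotBl f g h : H2 f -> H2 g -> H2 h -> hdot (f - g) h = hdot f h - hdot g h.
Proof. by move=> Hf Hg Hh; rewrite hdotDl ?hdotNl//; exact: H2N. Qed.

Lemma hdotBr f g h : H2 f -> H2 g -> H2 h -> hdot h (f - g) = hdot h f - hdot h g.
Proof.
by move=> Hf Hg Hh; rewrite hdotC ?hdotBl//; [rewrite rmorphB/= -!hdotC|exact: H2B].
Qed.

Lemma hdot0l g : H2 g -> hdot 0 g = 0.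
Proof. by move=> Hg; rewrite -(scale0r (0 : nat -> C)) hdotZl ?mul0r//; exact: H2_0. Qed.

Lemma hdot0r g : H2 g -> hdot g 0 = 0.
Proof. by move=> Hg; rewrite hdotC ?hdot0l ?conjc0//; exact: H2_0. Qed.

Lemma hdotff f : H2 f -> hdot f f = (hnorm f ^+ 2)%:C%C.
Proof.
move=> Hf; rewrite hdotE; apply: csum_eq.
rewrite (_ : series _ = (fun n => (series (sq f) n)%:C%C : C)).
  apply: cvgC_ReIm => /=; [exact: hnorm_sqr_cvg|exact: cvg_cst].
apply/funext => n; rewrite /series/= rmorph_sum/=.
by apply: eq_bigr => k _; rewrite mul_conjc.
Qed.

Lemma hnorm_sqrD f g : H2 f -> H2 g ->
  hnorm (f + g) ^+ 2 = hnorm f ^+ 2 + hnorm g ^+ 2 + 2 * Re (hdot f g).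
Proof.
move=> Hf Hg; apply: (@complexI R).
rewrite -hdotff; last exact: H2D.
rewrite hdotDl ?hdotDr ?hdotff//; try exact: H2D.
rewrite (hdotC Hg Hf) 2!rmorphD/=; case: (hdot f g) => x y.
by apply/eqP; rewrite eq_complex/=; apply/andP; split; apply/eqP; ring.
Qed.

Lemma hnormZ a f : H2 f -> hnorm (a *: f) = normc a * hnorm f.
Proof.
move=> Hf; apply/eqP; rewrite -(@eqrXn2 _ 2) ?hnorm_ge0 ?mulr_ge0 ?normc_ge0 ?hnorm_ge0//.
apply/eqP/(@complexI R); rewrite -hdotff; last exact: H2Z.
rewrite hdotZl ?hdotZr ?hdotff//; last exact: H2Z.
by rewrite mulrA mul_conjc exprMn -rmorphM.
Qed.

Lemma hnormN f : H2 f -> hnorm (- f) = hnorm f.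
Proof. by move=> Hf; rewrite -scaleN1r hnormZ// normcN normc1 mul1r. Qed.

Lemma hnorm0 : hnorm (0 : nat -> C) = 0.
Proof. by rewrite -(scale0r (0 : nat -> C)) hnormZ ?normc0 ?mul0r//; exact: H2_0. Qed.

Lemma hnormBC f g : H2 f -> H2 g -> hnorm (f - g) = hnorm (g - f).
Proof. by move=> Hf Hg; rewrite -opprB hnormN//; exact: H2B. Qed.

Lemma hdot_CauchySchwarz f g : H2 f -> H2 g -> normc (hdot f g) <= hnorm f * hnorm g.
Proof.
move=> Hf Hg; have [g0|g0] := eqVneq (hnorm g) 0.
  by rewrite (hnorm_eq0 Hg g0) hdot0r// normc0 mulr_ge0 ?hnorm_ge0.
rewrite -(@ler_pXn2r _ 2) ?nnegrE ?mulr_ge0 ?hnorm_ge0 ?normc_ge0//.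
pose a := hdot f g; pose N := hnorm g ^+ 2.
have N0 : 0 < N by rewrite exprn_gt0// lt_neqAle eq_sym g0 hnorm_ge0.
(* This vector is [N] times the component of [f] orthogonal to [g]; the factor [N] avoids a
   division. *)
have := sqr_ge0 (hnorm (N%:C%C *: f + (- a) *: g)).
rewrite hnorm_sqrD; [|exact: H2Z|exact: H2Z].
rewrite !hnormZ// hdotZl ?hdotZr//; last exact: H2Z.
rewrite -/a normcN normcR gtr0_norm// !exprMn -/N.
rewrite (_ : Re _ = - (N * normc a ^+ 2)); last first.
  by rewrite sqr_normcE; case: (a) => x y /=; ring.
move=> h; have {h} : 0 <= N * (hnorm f ^+ 2 * N - normc a ^+ 2) by nra.
by rewrite pmulr_rge0// subr_ge0.
Qed.

Lemma le_hnormD f g : H2 f -> H2 g -> hnorm (f + g) <= hnorm f + hnorm g.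
Proof.
move=> Hf Hg; rewrite -(@ler_pXn2r _ 2) ?nnegrE ?addr_ge0 ?hnorm_ge0//.
rewrite hnorm_sqrD// sqrrD -mulr_natl; have := hdot_CauchySchwarz Hf Hg.
have := normc_Re (hdot f g); have := ler_norm (Re (hdot f g)); lra.
Qed.

Lemma le_hnormB f g : H2 f -> H2 g -> hnorm (f - g) <= hnorm f + hnorm g.
Proof. by move=> Hf Hg; rewrite -(hnormN Hg); apply: le_hnormD => //; exact: H2N. Qed.

Lemma le_hnorm_sub f g : H2 f -> H2 g -> hnorm f - hnorm g <= hnorm (f - g).
Proof.
move=> Hf Hg; rewrite lerBlDr -{1}(subrK g f); apply: le_hnormD => //.
exact: H2B.
Qed.

Lemma H2_hnorm_shift f : H2 f -> H2 (shift f) /\ hnorm (shift f) = hnorm f.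
Proof.
move=> Hf.
have E n : series (sq (shift f)) n.+1 = series (sq f) n.
  by rewrite /series [LHS]big_nat_recl// /sq (normc0 R : normc (shift f 0%N) = 0) expr0n/= add0r.
have H : H2 (shift f).
  apply/H2P; exists (hnorm f ^+ 2) => -[|n]; first by rewrite /series/= big_nil sqr_ge0.
  by rewrite E series_le_hnorm.
split=> //; apply/eqP; rewrite -(@eqrXn2 _ 2) ?hnorm_ge0//; apply/eqP.
rewrite hnorm_sqr//; apply: cvg_lim => //; rewrite -cvg_shiftS.
rewrite (_ : [sequence _]_n = series (sq f)); first exact: hnorm_sqr_cvg.
exact/funext.
Qed.

Lemma H2_shift f : H2 f -> H2 (shift f). Proof. by move=> /H2_hnorm_shift[]. Qed.

Lemma hnorm_shift f : H2 f -> hnorm (shift f) = hnorm f.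
Proof. by move=> /H2_hnorm_shift[]. Qed.

Lemma H2_hnorm_shift_adj f : H2 f -> H2 (shift_adj f) /\ hnorm (shift_adj f) <= hnorm f.
Proof.
move=> Hf; apply: hnorm_le; first exact: hnorm_ge0.
move=> n; apply: le_trans (series_le_hnorm n.+1 Hf).
by rewrite /series/= [leRHS]big_nat_recl//= lerDr sqr_ge0.
Qed.

Lemma H2_shift_adj f : H2 f -> H2 (shift_adj f).
Proof. by move=> /H2_hnorm_shift_adj[]. Qed.

Lemma hdot_shift f g : H2 f -> H2 g -> hdot (shift f) (shift g) = hdot f g.
Proof. by move=> Hf Hg; rewrite shift_adjoint. Qed.

Lemma H2_finite f N : (forall n, (N <= n)%N -> f n = 0) -> H2 f.
Proof.
move=> f0; apply/H2P; exists (series (sq f) N) => n.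
apply: (@le_trans _ _ (series (sq f) (maxn n N))).
  by apply: series_ge0_nd; [exact: sq_ge0|exact: leq_maxl].
rewrite /series/= (big_cat_nat (leq0n _) (leq_maxr n N))//= [X in _ + X]big1_seq ?addr0// => k.
by rewrite mem_index_iota /sq => /andP[_ /andP[Nk _]]; rewrite f0// normc0 expr0n.
Qed.

Lemma H2_seq1 : H2 (seq1 : nat -> C).
Proof. by apply: (H2_finite (N := 1)) => -[]. Qed.

Lemma seq10 : seq1 0%N = 1 :> C. Proof. by []. Qed.

Lemma seq1S n : seq1 n.+1 = 0 :> C. Proof. by []. Qed.

Lemma hdot_seq1r f : hdot f seq1 = f 0%N.
Proof.
have [|_ e] := @csum_finite _ (fun n => f n * (seq1 n)^*%C) 1.
  by move=> -[//|n] _; rewrite seq1S conjc0 mulr0.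
by rewrite hdotE e big_nat1 seq10 conjc1 mulr1.
Qed.

Lemma hnorm_seq1 : hnorm (seq1 : nat -> C) = 1.
Proof.
apply/eqP; rewrite -(@eqrXn2 _ 2) ?hnorm_ge0//; apply/eqP/(@complexI R).
by rewrite -hdotff ?hdot_seq1r//; [rewrite expr1n|exact: H2_seq1].
Qed.

(* Fatou's lemma for the counting measure. *)
Lemma hnorm_coef_lim (F : nat -> nat -> C) f (B : R) : 0 <= B ->
  (forall k, H2 (F k) /\ hnorm (F k) <= B) ->
  (forall n, (fun k => F k n) @ \oo --> f n) -> H2 f /\ hnorm f <= B.
Proof.
move=> B0 FB Ff; apply: hnorm_le => // N.
have h : (fun k => series (sq (F k)) N) @ \oo --> series (sq f) N.
  elim: N => [|N IH].
    rewrite (_ : (fun k => _) = (fun=> 0)); last by apply/funext => k; rewrite /series/= big_nil.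
    by rewrite /series/= big_nil; exact: cvg_cst.
  rewrite (_ : (fun k => _) = (fun k => series (sq (F k)) N + sq (F k) N)); last first.
    by apply/funext => k; rewrite /series/= big_nat_recr.
  rewrite {2}/series/= big_nat_recr//=; apply: cvgD; first exact: IH.
  apply: (@continuous_cvg _ _ _ _ _ _ (fun x : R => x ^+ 2)); first exact: exprn_continuous.
  exact: (cvgC_norm (Ff N)).
apply: (cvgn_le_cst h) => k; have [Hk Bk] := FB k.
apply: le_trans (series_le_hnorm N Hk) _.
by rewrite ler_pXn2r// ?nnegrE ?hnorm_ge0.
Qed.

End SquareSummable.

(** * Closed subspaces *)

Section Neumann.
Context {R : realType}.
Local Notation C := (R[i]^o).
Implicit Types (f g : nat -> C) (a c w : C) (M : set (nat -> C)).

Definition linear_on M (T : (nat -> C) -> nat -> C) : Prop :=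
  forall a f g, M f -> M g -> T (a *: f + g) = a *: T f + T g.

Lemma closed_subspaceD M f g : closed_subspace M -> M f -> M g -> M (f + g).
Proof. by move=> [_ _ h _] Mf Mg; rewrite -(scale1r f); exact: h. Qed.

Lemma closed_subspaceZ M a f : closed_subspace M -> M f -> M (a *: f).
Proof. by move=> [_ h0 h _] Mf; rewrite -(addr0 (a *: f)); exact: h. Qed.

Lemma closed_subspaceB M f g : closed_subspace M -> M f -> M g -> M (f - g).
Proof.
move=> cM Mf Mg; rewrite -scaleN1r; apply: closed_subspaceD => //.
exact: closed_subspaceZ.
Qed.

Lemma closed_subspace_H2 M f : closed_subspace M -> M f -> H2 f.
Proof. by move=> [h _ _ _]; exact: h. Qed.

Lemma linear_onB M T f g : linear_on M T -> M f -> M g -> T (f - g) = T f - T g.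
Proof.
by move=> lT Mf Mg; rewrite addrC -scaleN1r lT// scaleN1r addrC.
Qed.

Lemma H2_closed_subspace : closed_subspace (@H2 R).
Proof.
split=> //; first exact: H2_0.
by move=> a f g Hf Hg; apply: H2D => //; exact: H2Z.
Qed.

Section FixedPoint.
Variables (M : set (nat -> C)) (T : (nat -> C) -> nat -> C) (q : R) (g : nat -> C).
Hypotheses (cM : closed_subspace M) (q0 : 0 <= q) (q1 : q < 1).
Hypotheses (MT : forall f, M f -> M (T f)) (lT : linear_on M T).
Hypotheses (Tq : forall f, M f -> hnorm (T f) <= q * hnorm f) (Mg : M g).

Let s n := iter n (fun f => g + T f) 0.
Let B := hnorm g / (1 - q).
Let sub_q : 0 < 1 - q. Proof. by rewrite subr_gt0. Qed.
Let B0 : 0 <= B. Proof. by rewrite divr_ge0 ?hnorm_ge0 ?ltW. Qed.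
Let MH f : M f -> H2 f. Proof. exact: closed_subspace_H2. Qed.

Let Ms n : M (s n).
Proof.
elim: n => [|n IH]; first by case: cM.
by apply: closed_subspaceD => //; exact: MT.
Qed.

Let norm_s n : hnorm (s n) <= B.
Proof.
elim: n => [|n IH]; first by rewrite [hnorm _]hnorm0.
apply: le_trans (le_hnormD (MH Mg) (MH (MT (Ms n)))) _.
apply: (@le_trans _ _ (hnorm g + q * B)).
  by rewrite lerD2l (le_trans (Tq (Ms n)))// ler_wpM2l.
by rewrite le_eqVlt; apply/orP; left; apply/eqP; rewrite /B; field; rewrite gt_eqF.
Qed.

Let Mss n m : M (s (n + m) - s n).
Proof. by apply: closed_subspaceB. Qed.

Let norm_ss n m : hnorm (s (n + m) - s n) <= q ^+ n * B.
Proof.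
elim: n => [|n IH]; first by rewrite add0n mul1r subr0; exact: norm_s.
have -> : s (n.+1 + m) - s n.+1 = T (s (n + m) - s n).
  rewrite (linear_onB lT)// /s addSn [iter _.+1 _ _]/= [iter n.+1 _ _]/=.
  by rewrite opprD addrACA subrr add0r.
by rewrite (le_trans (Tq (Mss n m)))// exprS -mulrA ler_wpM2l.
Qed.

Let qn_cvg : (fun n => q ^+ n * B) @ \oo --> (0 : R).
Proof.
rewrite -(mul0r B); apply: cvgMr_tmp; apply: cvg_expr.
by rewrite ger0_norm.
Qed.

Let s_cvg k : exists l : C, (fun n => s n k) @ \oo --> l.
Proof.
apply: cvgC_cauchy => e e0.
have e20 : 0 < e / 2 by rewrite divr_gt0.
have /cvgrPdist_lt/(_ _ e20)[N _ HN] := qn_cvg.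
exists [set n | (N <= n)%N]; first by exists N.
suff hN n : (N <= n)%N -> normc (s n k - s N k) <= e / 2.
  move=> n m /hN hn /hN hm.
  have -> : s n k - s m k = (s n k - s N k) - (s m k - s N k) by rewrite opprB addrA subrK.
  by rewrite (le_trans (le_normcB _ _))// (splitr e) lerD.
move=> /subnKC <-; have := HN N (leqnn N); rewrite sub0r normrN => /ltW/(le_trans _); apply.
rewrite ger0_norm; last by apply: mulr_ge0 => //; exact: exprn_ge0.
apply: le_trans (norm_ss N (n - N)).
by apply: (@le_coef_hnorm _ (s (N + (n - N)) - s N)); exact: MH.
Qed.

(** [s n] is a partial sum of the series of the [T^k g]. Its coefficients are Cauchy, and
    [hnorm_coef_lim] turns the coefficientwise limit into [hnorm (f - s n) <= q^n B]; closedness of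
    [M] then applies without a separate completeness statement for [H2]. *)
Lemma neumann : exists2 f, M f & f = g + T f.
Proof.
have /choice[f Hf] := s_cvg.
have fs n : H2 (f - s n) /\ hnorm (f - s n) <= q ^+ n * B.
  apply: (@hnorm_coef_lim _ (fun m => s (n + m) - s n)).
  - by rewrite mulr_ge0// exprn_ge0.
  - by move=> k; split; [exact: MH|exact: norm_ss].
  move=> k.
  apply: cvgB; last exact: cvg_cst.
  have := Hf k; rewrite -(cvg_shiftn n).
  by rewrite (_ : (fun m => s (n + m) k) = (fun m => s (m + n) k))//;
     apply/funext => m; rewrite addnC.
have small (x : R) : (forall n, x <= q ^+ n * B) -> x <= 0.
  by move=> hx; apply: (cvgn_ge_cst qn_cvg).
have Hf2 : H2 f by rewrite -(subr0 f); exact: (fs 0%N).1.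
have Mf : M f.
  case: (cM) => _ _ _; apply => // e e0.
  have /cvgrPdist_lt/(_ _ e0)[N _ HN] := qn_cvg.
  exists (s N) => //; apply: le_lt_trans (fs N).2 _.
  by apply: le_lt_trans (HN N (leqnn N)); rewrite sub0r normrN ler_norm.
exists f => //; apply/eqP; rewrite -subr_eq0; apply/eqP; apply: hnorm_eq0.
  by apply: H2B => //; apply: H2D; apply: MH => //; exact: MT.
(* The residual is the difference of [f - s n.+1] and [T (f - s n)], both at most [q^n B], so half
   of it is at most [q^n B] for every [n]. *)
apply/eqP; rewrite eq_le hnorm_ge0 andbT -(@ler_pM2r _ 2^-1) ?invr_gt0// mul0r.
apply: small => n.
have -> : f - (g + T f) = (f - s n.+1) - T (f - s n).
  rewrite (linear_onB lT)// (_ : s n.+1 = g + T (s n))// -addrA opprB; congr (_ + _).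
  by rewrite !opprD addrA subrK.
rewrite ler_pdivrMr//; apply: le_trans (le_hnormB (fs n.+1).1 _) _.
  by apply: MH; apply: MT; exact: closed_subspaceB.
rewrite mulr_natr mulr2n lerD//.
  apply: le_trans (fs n.+1).2 _; rewrite exprS -mulrA.
  by apply: ler_piMl; [rewrite mulr_ge0// exprn_ge0|exact: ltW].
apply: le_trans (Tq _) _; first exact: closed_subspaceB.
apply: (@le_trans _ _ (1 * hnorm (f - s n))).
  by rewrite ler_wpM2r ?hnorm_ge0// ltW.
by rewrite mul1r; exact: (fs n).2.
Qed.

End FixedPoint.
End Neumann.

(** * Evaluation and reproducing kernels *)

Section Evaluation.
Context {R : realType}.
Local Notation C := (R[i]^o).
Implicit Types (f g : nat -> C) (a c w z : C) (M : set (nat -> C)).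

Lemma dil_summable f w : H2 f -> normc w < 1 -> abs_summable (dil f w).
Proof. by move=> Hf; apply: abs_summable_dil => n; exact: le_coef_hnorm. Qed.

Lemma evD f g w : H2 f -> H2 g -> normc w < 1 -> ev (f + g) w = ev f w + ev g w.
Proof. by move=> Hf Hg w1; rewrite !evE dilD csumD//; exact: dil_summable. Qed.

Lemma evZ a f w : H2 f -> normc w < 1 -> ev (a *: f) w = a * ev f w.
Proof. by move=> Hf w1; rewrite !evE dilZ csumZ//; exact: dil_summable. Qed.

Lemma evN f w : H2 f -> normc w < 1 -> ev (- f) w = - ev f w.
Proof. by move=> Hf w1; rewrite -scaleN1r evZ// mulN1r. Qed.

Lemma evB f g w : H2 f -> H2 g -> normc w < 1 -> ev (f - g) w = ev f w - ev g w.
Proof. by move=> Hf Hg w1; rewrite evD ?evN//; exact: H2N. Qed.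

Lemma ev_seq1 w : ev seq1 w = 1.
Proof.
have [|_ e] := @csum_finite _ (dil seq1 w) 1.
  by move=> -[//|n] _; rewrite /dil seq1S mul0r.
by rewrite evE e big_nat1 /dil seq10 mul1r.
Qed.

Lemma ev_shift f w : H2 f -> normc w < 1 -> ev (shift f) w = w * ev f w.
Proof.
move=> Hf w1; have [_] := csum_recl (dil_summable (H2_shift Hf) w1).
rewrite evE => ->; rewrite {1}/dil mul0r add0r evE -csumZ; last exact: dil_summable.
by congr csum; apply/funext => n; rewrite -[RHS]/(w * _) /dil/= exprS mulrCA.
Qed.

Lemma ev_hmul f g w : H2 f -> H2 g -> normc w < 1 -> ev (hmul f g) w = ev f w * ev g w.
Proof. by move=> Hf Hg w1; rewrite !evE dil_hmul csum_hmul//; exact: dil_summable. Qed.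

Lemma shift_sub f g : shift (f - g) = shift f - shift g.
Proof. by rewrite shiftD -scaleN1r shiftZ scaleN1r. Qed.

(** Taylor coefficients of the Szego kernel [1 / (1 - conj(w) z)], which represents evaluation at
    [w] ([hdot_kern]). *)
Definition kern w : nat -> C := fun n => (w^*%C : C) ^+ n.

Lemma normc_sqr_lt1 w : normc w < 1 -> normc w ^+ 2 < 1.
Proof. by move=> w1; rewrite expr_lt1// normc_ge0. Qed.

Lemma H2_kern w : normc w < 1 -> H2 (kern w).
Proof.
move=> w1.
apply: (@series_le_cvg _ _ (geometric 1 (normc w ^+ 2))) => [n|n|n|].
- exact: sqr_ge0.
- by rewrite /geometric/= mul1r exprn_ge0 ?sqr_ge0.
- by rewrite /geometric/= mul1r /kern normcX normc_conj exprAC.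
- apply: is_cvg_geometric_series; rewrite ger0_norm ?sqr_ge0//.
  exact: normc_sqr_lt1.
Qed.

Lemma hdot_kern f w : hdot f (kern w) = ev f w.
Proof.
rewrite hdotE evE; congr csum; apply/funext => n.
by rewrite /kern /dil rmorphXn/= conjcK.
Qed.

Lemma hnorm_kern w : normc w < 1 -> hnorm (kern w) ^+ 2 = (1 - normc w ^+ 2)^-1.
Proof.
move=> w1; rewrite hnorm_sqr; last exact: H2_kern.
apply: cvg_lim => //.
rewrite (_ : (fun n => _) = geometric 1 (normc w ^+ 2)); last first.
  by apply/funext => n; rewrite /geometric/= mul1r /kern normcX normc_conj exprAC.
rewrite -[_^-1]mul1r; apply: cvg_geometric_series.
by rewrite ger0_norm ?sqr_ge0//; exact: normc_sqr_lt1.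
Qed.

Lemma hnorm_kern_gt0 w : normc w < 1 -> 0 < hnorm (kern w) ^+ 2.
Proof. by move=> w1; rewrite hnorm_kern// invr_gt0 subr_gt0; exact: normc_sqr_lt1. Qed.

Lemma normc_ev_le f w : H2 f -> normc w < 1 -> normc (ev f w) <= hnorm f * hnorm (kern w).
Proof.
by move=> Hf w1; rewrite -hdot_kern hdot_CauchySchwarz//; exact: H2_kern.
Qed.

Lemma ev_shift_subZ f w z : H2 f -> normc z < 1 ->
  ev (shift f - w *: f) z = (z - w) * ev f z.
Proof.
move=> Hf z1.
by rewrite (evB (H2_shift Hf) (H2Z (a := w) Hf) z1) (ev_shift Hf z1) (evZ w Hf z1) mulrBl.
Qed.

Lemma ev_sub_seq1 f a z : H2 f -> normc z < 1 -> ev (f - a *: seq1) z = ev f z - a.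
Proof.
move=> Hf z1; have H1 := @H2_seq1 R.
by rewrite (evB Hf (H2Z (a := a) H1) z1) (evZ a H1 z1) ev_seq1 mulr1.
Qed.

(* [f1 = (f - f(w)) / (z - w)] is the sum of [w^n S^*(n+1) f], hence lies in any
   closed [S^*]-invariant subspace containing [S^* f]. *)
Lemma divide_at M f w : closed_subspace M -> (forall g, M g -> M (shift_adj g)) ->
  H2 f -> M (shift_adj f) -> normc w < 1 ->
  exists2 f1, M f1 &
    shift f1 - w *: f1 = f - ev f w *: seq1 /\ hnorm f1 <= hnorm f / (1 - normc w).
Proof.
move=> cM sM Hf MSf w1; have MH g : M g -> H2 g by exact: closed_subspace_H2.
have [f1 Mf1 e] : exists2 f1, M f1 & f1 = shift_adj f + w *: shift_adj f1.
  apply: (@neumann _ M (fun g => w *: shift_adj g) (normc w)) => //.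
  - exact: normc_ge0.
  - by move=> g Mg; apply: closed_subspaceZ => //; exact: sM.
  - move=> a x y _ _; rewrite (_ : shift_adj (a *: x + y) = a *: shift_adj x + shift_adj y)//.
    by rewrite scalerDr !scalerA (mulrC w).
  - move=> g Mg; rewrite hnormZ; last exact/H2_shift_adj/MH.
    rewrite ler_wpM2l ?normc_ge0//.
    exact: (H2_hnorm_shift_adj (MH _ Mg)).2.
exists f1 => //.
have Hf1 := MH _ Mf1.
have e2 : shift f1 - w *: f1 = f - (f 0%N + w * f1 0%N) *: seq1.
  rewrite {1}e shiftD shiftZ !shift_shift_adj scalerBr scalerDl -scalerA.
  by rewrite opprD [RHS]addrA -[LHS]addrA; congr (_ + _); rewrite addrAC subrr sub0r.
split.
  (* The constant is identified by evaluating at [w], where [(z - w) f1] vanishes. *)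
  rewrite e2; congr (f - _ *: _).
  have := congr1 (fun g => ev g w) e2.
  rewrite (ev_shift_subZ _ Hf1 w1) (ev_sub_seq1 _ Hf w1) subrr mul0r.
  by move=> /esym/eqP; rewrite subr_eq0 => /eqP.
rewrite ler_pdivlMr ?subr_gt0// mulrBr mulr1 lerBlDr {1}e.
apply: le_trans (le_hnormD (MH _ MSf) _) _; first by apply/H2Z/H2_shift_adj.
rewrite hnormZ; last exact: H2_shift_adj.
by rewrite lerD ?(H2_hnorm_shift_adj _).2// mulrC ler_wpM2r ?normc_ge0//
   (H2_hnorm_shift_adj _).2.
Qed.

Lemma ev_divide f f1 w z : H2 f -> H2 f1 -> normc w < 1 -> normc z < 1 ->
  shift f1 - w *: f1 = f - ev f w *: seq1 ->
  ev f z = ev f w + (z - w) * ev f1 z.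
Proof.
move=> Hf Hf1 w1 z1 /(congr1 (fun g => ev g z)).
rewrite (ev_shift_subZ _ Hf1 z1) (ev_sub_seq1 _ Hf z1) => ->.
by rewrite addrC subrK.
Qed.

End Evaluation.

(** * Parseval's identity on the circle *)

Section CircleParseval.
Context {R : realType}.
Local Notation C := (R[i]^o).
Local Notation Re := complex.Re.
Local Notation Im := complex.Im.
Local Notation mu := (@lebesgue_measure R).
Implicit Types (a b : nat -> C) (c w z : C) (t : R).

Lemma integrable_continuous (f : R -> R) x y :
  continuous f -> mu.-integrable `[x, y] (EFin \o f).
Proof.
move=> cf; apply: continuous_compact_integrable; first exact: segment_compact.
exact: continuous_subspaceT.
Qed.

Lemma Rintegral01_cst (r : R) : \int[mu]_(t in `[0, 1]) r = r.
Proof.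
rewrite Rintegral_cst//= lebesgue_measure_itv/= lte_fin ltr01.
by rewrite -EFinB subr0/= mulr1.
Qed.

Lemma le_dist_Rintegral01 (f g : R -> R) (e : R) : continuous f -> continuous g ->
  (forall t, 0 <= t <= 1 -> `|f t - g t| <= e) ->
  `|\int[mu]_(t in `[0, 1]) f t - \int[mu]_(t in `[0, 1]) g t| <= e.
Proof.
move=> cf cg h.
have cfg : continuous (fun t => f t - g t).
  by move=> t; apply: cvgB; [exact: cf|exact: cg].
rewrite -RintegralB//; try exact: integrable_continuous.
apply: le_trans (le_normr_Rintegral _ _) _ => //.
  exact: integrable_continuous.
rewrite -[leRHS]Rintegral01_cst; apply: le_Rintegral => //.
- apply: integrable_continuous => t.
  by apply: cvg_norm; exact: cfg.
- by apply: integrable_continuous => t; exact: cvg_cst.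
Qed.

Lemma cisX t n : cis t ^+ n = Complex (cos (n%:R * (2 * pi * t))) (sin (n%:R * (2 * pi * t))).
Proof.
elim: n => [|n IH]; first by rewrite mul0r cos0 sin0.
have E : n.+1%:R * (2 * pi * t) = n%:R * (2 * pi * t) + 2 * pi * t.
  by rewrite -natr1 mulrDl mul1r.
rewrite exprS IH E cosD sinD.
by apply/eqP; rewrite eq_complex/=; apply/andP; split; apply/eqP; ring.
Qed.

Lemma normc_cis t : normc (cis t) = 1.
Proof. by rewrite /cis/= cos2Dsin2 sqrtr1. Qed.

Lemma continuous_mul_cst (r : R) : continuous (fun t : R => r * t).
Proof. by move=> t; apply: cvgMl_tmp; exact: cvg_id. Qed.

Lemma continuous_cos_mul (r : R) : continuous (fun t : R => cos (r * t)).
Proof.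
move=> t; apply: (@continuous_comp _ _ _ (fun t : R => r * t) cos).
  exact: continuous_mul_cst.
exact: continuous_cos.
Qed.

Lemma continuous_sin_mul (r : R) : continuous (fun t : R => sin (r * t)).
Proof.
move=> t; apply: (@continuous_comp _ _ _ (fun t : R => r * t) sin).
  exact: continuous_mul_cst.
exact: continuous_sin.
Qed.

Lemma continuous_cisX n : continuous (fun t => cis t ^+ n : C).
Proof.
have eR t : Re (cis t ^+ n) = cos (n%:R * (2 * pi) * t) by rewrite cisX/= mulrA.
have eI t : Im (cis t ^+ n) = sin (n%:R * (2 * pi) * t) by rewrite cisX/= mulrA.
move=> t; apply: cvgC_ReIm.
  rewrite (_ : (fun x => _) = (fun x : R => cos ((n%:R * (2 * pi)) * x))); last exact/funext.
  by rewrite eR; exact: continuous_cos_mul.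
rewrite (_ : (fun x => _) = (fun x : R => sin ((n%:R * (2 * pi)) * x))); last exact/funext.
by rewrite eI; exact: continuous_sin_mul.
Qed.

Lemma Rintegral01_primitive (f F : R -> R) : continuous f ->
  (forall t, is_derive t 1 F (f t)) -> \int[mu]_(t in `[0, 1]) f t = F 1 - F 0.
Proof.
move=> cf dF; have cF : continuous F.
  move=> t; apply: differentiable_continuous; apply/derivable1_diffP.
  by have := dF t; move=> -[].
rewrite /Rintegral (@continuous_FTC2 R f F) //.
- exact: continuous_subspaceT.
- split.
  + by move=> x _; have := dF x => -[].
  + by apply: cvg_at_right_filter; exact: cF.
  + by apply: cvg_at_left_filter; exact: cF.
- by move=> x _; rewrite derive1E; have := dF x => -[].
Qed.

Lemma sin_nat2pi n : sin (n%:R * (2 * pi)) = 0 :> R.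
Proof.
have := cisX 1 n; rewrite mulr1.
have -> : cis 1 = 1 :> C.
  by rewrite /cis mulr1 mulr_natl sin2pi cos2pi.
by rewrite expr1n => /(congr1 (@complex.Im R))/= <-.
Qed.

Lemma cos_nat2pi n : cos (n%:R * (2 * pi)) = 1 :> R.
Proof.
have := cisX 1 n; rewrite mulr1.
have -> : cis 1 = 1 :> C.
  by rewrite /cis mulr1 mulr_natl sin2pi cos2pi.
by rewrite expr1n => /(congr1 (@complex.Re R))/= <-.
Qed.

Lemma nat2pi_neq0 n : n.+1%:R * (2 * pi) != 0 :> R.
Proof. by rewrite !mulf_neq0// ?pnatr_eq0// gt_eqF// pi_gt0. Qed.

Lemma Rintegral01_cos n : \int[mu]_(t in `[0, 1]) cos (n.+1%:R * (2 * pi) * t) = 0.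
Proof.
set r := _ * (2 * pi).
have d t : is_derive t 1 (fun t => r^-1 * sin (r * t)) (cos (r * t)).
  apply: is_derive_eq; rewrite /GRing.scale/=.
  by field; exact: nat2pi_neq0.
rewrite (Rintegral01_primitive (@continuous_cos_mul r) d).
by rewrite mulr0 sin0 mulr1 /r sin_nat2pi !mulr0 subrr.
Qed.

Lemma Rintegral01_sin n : \int[mu]_(t in `[0, 1]) sin (n.+1%:R * (2 * pi) * t) = 0.
Proof.
set r := _ * (2 * pi).
have d t : is_derive t 1 (fun t => - (r^-1 * cos (r * t))) (sin (r * t)).
  apply: is_derive_eq; rewrite /GRing.scale/=.
  by field; exact: nat2pi_neq0.
rewrite (Rintegral01_primitive (@continuous_sin_mul r) d).
by rewrite mulr0 cos0 mulr1 /r cos_nat2pi subrr.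
Qed.

Lemma continuous_trig a N : continuous (fun t => series (dil a (cis t)) N : C).
Proof.
elim: N => [|N IH].
  rewrite (_ : (fun t : R => _) = (fun=> 0)); first by move=> t; exact: cvg_cst.
  by apply/funext => x; rewrite /series/= big_nil.
rewrite (_ : (fun t : R => _) = (fun t => series (dil a (cis t)) N + a N * cis t ^+ N)).
  move=> t; apply: cvgD; first exact: IH.
  by apply: cvgMl_tmp; exact: continuous_cisX.
by apply/funext => x; rewrite /series/= big_nat_recr.
Qed.

Lemma continuous_normc_sqr (f : R -> C) : continuous f ->
  continuous (fun t => normc (f t) ^+ 2).
Proof.
move=> cf t; apply: (@continuous_cvg _ _ _ _ _ _ (fun x : R => x ^+ 2)).
  exact: exprn_continuous.
exact: cvgC_norm (cf t).
Qed.

Lemma continuous_Re (f : R -> C) : continuous f -> continuous (fun t => Re (f t)).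
Proof. by move=> cf t; exact: cvgC_Re (cf t). Qed.

(** [|p + q|^2] involves only the real part of the cross term. The [k]-th term times the conjugate
    of the top one has frequency [N - k], written [(N - k.+1).+1] to display that it is positive, so
    its mean over a period is 0. *)
Lemma Rintegral01_cross a c N :
  \int[mu]_(t in `[0, 1]) Re (series (dil a (cis t)) N * (c * cis t ^+ N)^*%C) = 0.
Proof.
pose f n t := Re (series (dil a (cis t)) n * (c * cis t ^+ N)^*%C).
have step k t : (k < N)%N -> f k.+1 t = f k t +
    (Re (a k * c^*%C) * cos ((N - k.+1)%N.+1%:R * (2 * pi) * t) +
     Im (a k * c^*%C) * sin ((N - k.+1)%N.+1%:R * (2 * pi) * t)).
  move=> kN; rewrite /f /series/= big_nat_recr//= mulrDl ReD; congr (_ + _).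
  rewrite {1}(_ : N = k + (N - k.+1).+1)%N; last by rewrite subnSK// subnKC// ltnW.
  rewrite /dil exprD !rmorphM/= -2!mulrA.
  have -> : a k * (cis t ^+ k * (c^*%C * ((cis t ^+ k)^*%C * (cis t ^+ (N - k.+1).+1)^*%C)))
    = (a k * c^*%C) * (cis t ^+ k * (cis t ^+ k)^*%C) * (cis t ^+ (N - k.+1).+1)^*%C by ring.
  rewrite mul_conjc normcX normc_cis !expr1n mulr1 cisX.
  by case: (a k * _) => x y /=; rewrite mulrA; ring.
suff : forall k, (k <= N)%N -> continuous (f k) /\ \int[mu]_(t in `[0, 1]) f k t = 0.
  by move=> /(_ N (leqnn N))[].
elim=> [_|k IH kN].
  have -> : f 0%N = fun=> 0 by apply/funext => t; rewrite /f /series/= big_nil mul0r.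
  by split; [move=> t; exact: cvg_cst|rewrite Rintegral01_cst].
have [cf If] := IH (ltnW kN).
have cc (x : R) m : continuous (fun t => x * cos (m.+1%:R * (2 * pi) * t)).
  by move=> t; apply: cvgMl_tmp; exact: continuous_cos_mul.
have cs (x : R) m : continuous (fun t => x * sin (m.+1%:R * (2 * pi) * t)).
  by move=> t; apply: cvgMl_tmp; exact: continuous_sin_mul.
have ccs (x y : R) m : continuous (fun t => x * cos (m.+1%:R * (2 * pi) * t) +
    y * sin (m.+1%:R * (2 * pi) * t)).
  by move=> t; apply: cvgD; [exact: cc|exact: cs].
have -> : f k.+1 = (fun t => f k t +
    (Re (a k * c^*%C) * cos ((N - k.+1)%N.+1%:R * (2 * pi) * t) +
     Im (a k * c^*%C) * sin ((N - k.+1)%N.+1%:R * (2 * pi) * t))).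
  by apply/funext => t; exact: step.
split; first by move=> t; apply: cvgD; [exact: cf|exact: ccs].
rewrite RintegralD ?If ?add0r//; try exact: integrable_continuous.
rewrite RintegralD//; try exact: integrable_continuous.
rewrite !RintegralZl//; try by apply: integrable_continuous; first [exact: continuous_cos_mul|exact: continuous_sin_mul].
by rewrite Rintegral01_cos Rintegral01_sin !mulr0 addr0.
Qed.

Lemma parseval_trig a N :
  \int[mu]_(t in `[0, 1]) (normc (series (dil a (cis t)) N) ^+ 2) =
  series (fun n => normc (a n) ^+ 2) N.
Proof.
elim: N => [|N IH].
  rewrite [RHS]/series/= big_nil -[RHS]Rintegral01_cst.
  by apply: eq_Rintegral => t _; rewrite /series/= big_nil normc0 expr0n.
pose g t := series (dil a (cis t)) N * (a N * cis t ^+ N)^*%C.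
have cg : continuous g.
  move=> t; apply: cvgM; first exact: continuous_trig.
  have h := @continuous_cisX N t.
  have : a N * cis x ^+ N @[x --> t] --> a N * cis t ^+ N by apply: cvgMl_tmp.
  move=> {}h; apply: (@cvgC_squeeze _ _ _ _ _ _
    (fun x => normc (a N * cis x ^+ N - a N * cis t ^+ N))).
    by apply: nearW => x; rewrite -rmorphB/= normc_conj.
  exact/cvgC_normc.
have cn : continuous (fun t => normc (series (dil a (cis t)) N) ^+ 2).
  by apply: continuous_normc_sqr; exact: continuous_trig.
have cRe : continuous (fun t => 2 * Re (g t)).
  by move=> t; apply: cvgMl_tmp; exact: continuous_Re.
rewrite (_ : \int[mu]_(t in `[0, 1]) _ = \int[mu]_(t in `[0, 1])
    (normc (series (dil a (cis t)) N) ^+ 2 + (normc (a N) ^+ 2 + 2 * Re (g t)))); last first.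
  apply: eq_Rintegral => t _.
  rewrite {1}/series/= big_nat_recr//= normc_sqrD addrA -/(series _ N); congr (_ + _ + _).
  by rewrite /dil normcM normcX normc_cis expr1n mulr1.
have cc : continuous (fun _ : R => normc (a N) ^+ 2) by move=> t; exact: cvg_cst.
rewrite RintegralD//; try exact: integrable_continuous.
  rewrite RintegralD//; try exact: integrable_continuous.
  rewrite Rintegral01_cst RintegralZl//; last by apply: integrable_continuous; exact: (continuous_Re cg).
  rewrite Rintegral01_cross mulr0 addr0 IH.
  by rewrite /series/= big_nat_recr.
by apply: integrable_continuous => t; apply: cvgD; [exact: cc|exact: cRe].
Qed.

Lemma csum_tail a N : abs_summable a ->
  normc (csum a - series a N) <= l1norm a - series (fun n => normc (a n)) N.
Proof.
move=> sa.
have h : (fun n => normc (series a (n + N)%N - series a N)) @ \oo -->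
    normc (csum a - series a N).
  apply: cvgC_norm; apply: cvgB; last exact: cvg_cst.
  by rewrite cvg_shiftn; exact: csum_cvg.
apply: (cvgn_le_cst h) => n; rewrite sub_series leq_addl.
apply: le_trans (normc_sum _ _ _) _; rewrite -series_nat_sub ?leq_addl// lerD2r.
by apply: nnseries_le => // k; exact: normc_ge0.
Qed.

Lemma l1norm_dil a t : l1norm (dil a (cis t)) = l1norm a.
Proof.
congr (limn (series _)); apply/funext => n.
by rewrite /dil normcM normcX normc_cis expr1n mulr1.
Qed.

Lemma csum_dil_tail a t N : abs_summable a ->
  normc (csum (dil a (cis t)) - series (dil a (cis t)) N) <=
  l1norm a - series (fun n => normc (a n)) N.
Proof.
move=> sa; apply: le_trans (csum_tail _ (abs_summable_dil_circle sa (normc_cis t))) _.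
rewrite l1norm_dil lerD2l lerN2 le_eqVlt; apply/orP; left; apply/eqP.
by congr (series _ _); apply/funext => n; rewrite normcM normcX normc_cis expr1n mulr1.
Qed.

Lemma normc_sub_via (x y p q : C) :
  normc (x - y) <= normc (x - p) + normc (p - q) + normc (y - q).
Proof.
rewrite (_ : x - y = (x - p) + (p - q) - (y - q)); last by ring.
by rewrite (le_trans (le_normcB _ _))// lerD2r le_normcD.
Qed.

Lemma continuous_csum_dil a : abs_summable a ->
  continuous (fun t => csum (dil a (cis t)) : C).
Proof.
move=> sa t; apply/cvgC_normc/cvgrPdist_lt => e e0.
have e30 : 0 < e / 3 by rewrite divr_gt0.
have /cvgrPdist_lt/(_ _ e30)[N _ HN] := nnseries_tail0 sa.
have {}HN : l1norm a - series (fun n => normc (a n)) N < e / 3.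
  by apply: le_lt_trans (HN N (leqnn N)); rewrite sub0r normrN ler_norm.
have /cvgC_normc/cvgrPdist_lt/(_ _ e30) := @continuous_trig a N t.
apply: filterS => x; rewrite !sub0r !normrN !ger0_norm ?normc_ge0// => hx.
apply: le_lt_trans (normc_sub_via _ _ (series (dil a (cis x)) N) (series (dil a (cis t)) N)) _.
have -> : e = e / 3 + e / 3 + e / 3 by field.
have hN y := le_lt_trans (csum_dil_tail y N sa) HN.
exact: (ltrD (ltrD (hN x) hx) (hN t)).
Qed.

Lemma abs_summable_H2 a : abs_summable a -> H2 a.
Proof.
move=> sa; apply/H2P; exists (l1norm a ^+ 2) => n.
apply: (@le_trans _ _ (series (fun k => l1norm a *: normc (a k)) n)).
  rewrite /series/=; apply: ler_sum => k _; rewrite expr2 ler_wpM2r ?normc_ge0//.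
  by apply: (@nnseries_term_le _ (fun k => normc (a k))) => // m; exact: normc_ge0.
rewrite /series/= -mulr_sumr expr2 ler_wpM2l ?l1norm_ge0//.
by apply: (@nnseries_le _ (fun k => normc (a k))) => // m; exact: normc_ge0.
Qed.

(** Partial sums converge uniformly on the circle with the l1 tail [tl N] as error, so their mean
    squares converge too. Absolute summability is enough at this stage: the sequences concerned are
    kernels, polynomials, dilations by numbers of modulus less than 1, and products of these. *)
Lemma parseval a : abs_summable a ->
  \int[mu]_(t in `[0, 1]) (normc (csum (dil a (cis t))) ^+ 2) = hnorm a ^+ 2.
Proof.
move=> sa; have Ha := abs_summable_H2 sa; set I := \int[_]_(_ in _) _.
have L0 := l1norm_ge0 sa.
pose tl N := l1norm a - series (fun n => normc (a n)) N.
have h N : `|I - series (fun n => normc (a n) ^+ 2) N| <= tl N * (2 * l1norm a).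
  rewrite -parseval_trig; apply: le_dist_Rintegral01.
  - by apply: continuous_normc_sqr; exact: continuous_csum_dil.
  - by apply: continuous_normc_sqr; exact: continuous_trig.
  - move=> t _; set p := series _ N; set f := csum _.
    have hf : normc f <= l1norm a.
      rewrite -(l1norm_dil a t); apply: normc_csum.
      by apply: abs_summable_dil_circle => //; exact: normc_cis.
    have hp : normc p <= l1norm a.
      apply: le_trans (normc_sum _ _ _) _; rewrite -(l1norm_dil a t).
      apply: (@nnseries_le _ (fun k => normc (dil a (cis t) k))) => [k|]; first exact: normc_ge0.
      by apply: abs_summable_dil_circle => //; exact: normc_cis.
    have ht : `|normc f - normc p| <= tl N.
      by apply: le_trans (le_dist_normc _ _) _; exact: csum_dil_tail.
    rewrite subr_sqr normrM ler_pM// ger0_norm ?addr_ge0 ?normc_ge0//.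
    by rewrite mulr2n mulrDl mul1r lerD.
apply: (@cvg_unique _ (@Rhausdorff R) (series (fun n => normc (a n) ^+ 2) @ \oo)).
  apply/cvgrPdist_le => e e0.
  have h0 : (fun N => tl N * (2 * l1norm a)) @ \oo --> (0 : R).
    by rewrite -(mul0r (2 * l1norm a)); apply: cvgMr_tmp; exact: nnseries_tail0.
  move/cvgrPdist_le : h0 => /(_ e e0); apply: filterS => N.
  rewrite sub0r normrN => /(le_trans (ler_norm _)); exact: le_trans.
exact: hnorm_sqr_cvg.
Qed.

End CircleParseval.

(** * Poisson kernel *)

Section PoissonKernel.
Context {R : realType}.
Local Notation C := (R[i]^o).
Local Notation Re := complex.Re.
Local Notation mu := (@lebesgue_measure R).
Implicit Types (a g : nat -> C) (w z : C) (t x q : R).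

Lemma cos_ge_half (y : R) : 0 <= y <= pi / 4 -> 2^-1 <= cos y.
Proof.
move=> /andP[y0 y1]; have p0 := pi_gt0 R.
have c0 : 0 <= cos y by apply: cos_ge0_pihalf; lra.
have : 0 <= cos (y *+ 2) by apply: cos_ge0_pihalf; rewrite [y *+ 2]mulr2n; lra.
rewrite cos_mulr2n; nra.
Qed.

(** With [u = y / 2], [sin y = 2 sin u cos u] and [sin u = u cos c], where both cosines are at least
    1/2 because the angles stay below [pi / 4]. *)
Lemma sin_ge_quarter (y : R) : 0 <= y <= pi / 2 -> y / 4 <= sin y.
Proof.
move=> /andP[y0 y1]; pose u := y / 2.
have u0 : 0 <= u by rewrite /u; lra.
have u1 : u <= pi / 4 by rewrite /u; lra.
have [c] := @MVT_segment R sin cos 0 u u0 (fun x _ => is_derive_sin x)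
  (continuous_subspaceT (@continuous_sin R)).
rewrite in_itv/= sin0 !subr0 => /andP[c0 cu] sE.
have cc : 2^-1 <= cos c by apply: cos_ge_half; rewrite c0 (le_trans cu u1).
have cu2 : 2^-1 <= cos u by apply: cos_ge_half; rewrite u0 u1.
have -> : y = u *+ 2 by rewrite [RHS]mulr2n /u; lra.
have P : 2^-1 * 2^-1 <= cos u * cos c by rewrite ler_pM.
rewrite sin_mulr2n sE mulrA; move: (cos u * cos c) P u0 => m P u0.
have : 0 <= (m - 2^-1 * 2^-1) * u by rewrite mulr_ge0 ?subr_ge0.
by move: (u) => v; rewrite mulrBl -(mulr_natl v) -(mulr_natl (m * v)); lra.
Qed.

(** [sin (pi x)] vanishes at 1 as well as at 0, since [[0, 1]] is a circle cut open; the margin [e]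
    keeps away from this second zero. Beyond 1/2 the reflection [x -> 1 - x] is used. *)
Lemma sin_pi_sqr_ge (e x : R) : 0 < e -> `|x| <= 1 - e ->
  (e / 2) ^+ 2 * x ^+ 2 <= sin (pi * x) ^+ 2.
Proof.
move=> e0; wlog x0 : x / 0 <= x => [hw|].
  have [x0|/ltW x0] := leP 0 x; first exact: hw.
  have := hw (- x); rewrite oppr_ge0 normrN sqrrN mulrN sinN sqrrN; exact.
rewrite ger0_norm// => x1; have p2 := pi_ge2 R; have p0 := pi_gt0 R.
rewrite -exprMn ler_pXn2r ?nnegrE ?mulr_ge0 ?divr_ge0 ?(ltW e0)//; last first.
  by apply: sin_ge0_pi; nra.
have [xh|/ltW xh] := leP x 2^-1.
  have := @sin_ge_quarter (pi * x).
  have -> : 0 <= pi * x <= pi / 2 by nra.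
  move=> /(_ erefl); nra.
have -> : pi * x = - (pi * (1 - x) - pi) by ring.
rewrite sinN sinB sinpi cospi mulr0 subr0 mulrN1 opprK.
have := @sin_ge_quarter (pi * (1 - x)).
have -> : 0 <= pi * (1 - x) <= pi / 2 by nra.
move=> /(_ erefl); nra.
Qed.

Lemma poisson_denominator q t x : normc (1 - (q%:C%C * cis t)^*%C * cis x) ^+ 2 =
  (1 - q) ^+ 2 + 4 * q * sin (pi * (x - t)) ^+ 2.
Proof.
have c2 : cos (2 * pi * (x - t)) = 1 - 2 * sin (pi * (x - t)) ^+ 2.
  rewrite (_ : 2 * pi * (x - t) = (pi * (x - t)) *+ 2); last by ring.
  by rewrite cos_mulr2n cos2sin2 -[_ *+ 2]mulr_natl; ring.
rewrite (_ : 4 * q * _ = 2 * q * (1 - cos (2 * pi * (x - t)))); last by rewrite c2; ring.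
rewrite (mulrBr (2 * pi)) cosB sqr_normcE /=.
have := cos2Dsin2 (2 * pi * x); have := cos2Dsin2 (2 * pi * t).
move: (cos (2 * pi * x)) (sin (2 * pi * x)) (cos (2 * pi * t)) (sin (2 * pi * t)).
move=> a b c d h1 h2.
rewrite !(mul0r, subr0, addr0, oppr0, add0r, sub0r).
transitivity (1 - 2 * q * (a * c + b * d) + q ^+ 2 * ((c ^+ 2 + d ^+ 2) * (a ^+ 2 + b ^+ 2))); first by ring.
by rewrite h1 h2; ring.
Qed.

(** With [d = 1 - q] and [k = e / 2], the numerator is at most [2 d] and the denominator at least
    [d^2 + k^2 (x - t)^2], by [sin_pi_sqr_ge] and [4 q >= 1]. The Poisson kernel is thus dominated
    by a Cauchy kernel of width [d / k]. *)
Lemma poisson_kernel_le (e q t x : R) : 0 < e -> 2^-1 <= q < 1 -> `|x - t| <= 1 - e ->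
  (1 - q ^+ 2) * (normc (1 - (q%:C%C * cis t)^*%C * cis x) ^+ 2)^-1 <=
  4 / e * (((1 - q) / (e / 2)) / (((1 - q) / (e / 2)) ^+ 2 + (x - t) ^+ 2)).
Proof.
move=> e0 /andP[q0 q1] xt; rewrite poisson_denominator.
have := sin_pi_sqr_ge e0 xt; move: (x - t) => y; move: (sin (pi * y) ^+ 2) => s hs.
set d := 1 - q; have d0 : 0 < d by rewrite /d; lra.
pose k := e / 2; have k0 : 0 < k by rewrite /k; lra.
rewrite -/k in hs *.
have y0 := sqr_ge0 y; have ky0 : 0 <= k ^+ 2 * y ^+ 2 by rewrite mulr_ge0 ?sqr_ge0.
pose E := d ^+ 2 + k ^+ 2 * y ^+ 2.
have E0 : 0 < E by rewrite ltr_wpDr// exprn_gt0.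
have -> : (d / k) ^+ 2 + y ^+ 2 = E / k ^+ 2 by rewrite /E; field; rewrite gt_eqF.
have -> : 4 / e * (d / k / (E / k ^+ 2)) = 2 * d * E^-1.
  rewrite (_ : e = 2 * k); last by rewrite /k; field.
  by field; rewrite !gt_eqF.
have s0 : 0 <= s by apply: le_trans hs.
have ED : E <= d ^+ 2 + 4 * q * s by rewrite /E; nra.
apply: ler_pM => //; rewrite ?invr_ge0 ?lef_pV2 ?posrE ?(lt_le_trans E0)//.
- by nra.
- by rewrite (le_trans _ ED)// ltW.
- by rewrite /d; nra.
Qed.

(* The dyadic shells [2^(k-1) e <= |x| < 2^k e] give the [k]-th term. *)
Lemma poisson_dyadic (e x : R) K : 0 < e -> `|x| < 2 ^+ K * e ->
  e / (e ^+ 2 + x ^+ 2) <=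
  \sum_(k < K.+1) (4 / (4 ^+ k * e)) * (`|x| < 2 ^+ k * e)%R%:R.
Proof.
move=> e0 xK; have exK : exists k, `|x| < 2 ^+ k * e by exists K.
have ee : 0 < e ^+ 2 by rewrite exprn_gt0.
have ex2 : 0 < e ^+ 2 + x ^+ 2 by rewrite ltr_wpDr ?sqr_ge0.
case: (ex_minnP exK) => k xk kmin.
have kK : (k < K.+1)%N by rewrite ltnS; exact: kmin.
rewrite (bigD1 (Ordinal kK))//= xk mulr1; apply: ler_wpDr.
  by apply: sumr_ge0 => i _; rewrite mulr_ge0// divr_ge0// mulr_ge0// ?exprn_ge0// ltW.
case: k xk kmin kK => [|k] xk kmin _.
  rewrite expr0 mul1r ler_pdivrMr//; have x2 := sqr_ge0 x.
  have : 0 <= x ^+ 2 / e by rewrite divr_ge0// ltW.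
  move=> h; have -> : 4 / e * (e ^+ 2 + x ^+ 2) = 4 * e + 4 * (x ^+ 2 / e).
    by field; rewrite gt_eqF.
  by lra.
have : 2 ^+ k * e <= `|x|.
  by rewrite leNgt; apply/negP => /kmin; rewrite ltnn.
move=> h; have {h} : (2 ^+ k * e) ^+ 2 <= x ^+ 2.
  have t0 : 0 <= 2 ^+ k * e by rewrite mulr_ge0 ?exprn_ge0// ltW.
  by rewrite -(real_normK (num_real x)) ler_pXn2r ?nnegrE.
rewrite exprMn exprAC (_ : 2 ^+ 2 = 4 :> R); last by rewrite -natrX.
rewrite (exprS 4); have : 0 < 4 ^+ k :> R by rewrite exprn_gt0.
move: (4 ^+ k : R) => m m0 h.
rewrite ler_pdivrMr// (_ : 4 / (4 * m * e) * _ = (e ^+ 2 + x ^+ 2) / (m * e)); last first.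
  by field; rewrite !gt_eqF.
by rewrite ler_pdivlMr ?mulr_gt0//; nra.
Qed.

Lemma csum_kern w z : normc w < 1 -> normc z = 1 ->
  abs_summable (kern w) /\ csum (dil (kern w) z) * (1 - w^*%C * z) = 1.
Proof.
move=> w1 z1.
have E : kern w = dil (fun=> 1) (w^*%C) by apply/funext => n; rewrite /dil mul1r.
have s : abs_summable (kern w).
  by rewrite E; apply: (abs_summable_dil (B := 1)) => [n|]; rewrite ?normc1 ?normc_conj.
split=> //; have sd := abs_summable_dil_circle s z1.
have [_ e] := csum_recl sd.
have e2 : csum (fun n => dil (kern w) z n.+1) = (w^*%C * z) * csum (dil (kern w) z).
  rewrite -csumZ//; congr csum; apply/funext => n.
  by rewrite -[RHS]/(_ * _) /dil /kern !exprS mulrACA.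
rewrite mulrBr mulr1 {1}e e2 [_ * csum _]mulrC addrK.
by rewrite /dil /kern !expr0 mulr1.
Qed.

(** Cauchy-Schwarz for [a k_w] against [k_w] gives [K |a(w)|^2 <= hnorm (a k_w)^2] with
    [K = hnorm (kern w)^2]. By Parseval the right side is an integral over the circle, where the
    squared modulus of [k_w] divided by [K] is the Poisson kernel. *)
Lemma poisson_ineq a w : abs_summable a -> normc w < 1 ->
  normc (csum (dil a w)) ^+ 2 <= \int[mu]_(x in `[0, 1])
    ((1 - normc w ^+ 2) * (normc (1 - w^*%C * cis x) ^+ 2)^-1
      * normc (csum (dil a (cis x))) ^+ 2).
Proof.
move=> sa w1; have [sk _] := csum_kern w1 (normc_cis 0).
have [sp _] := abs_summable_hmul sa sk.
have Hp := abs_summable_H2 sp; have Ha := abs_summable_H2 sa; have Hk := abs_summable_H2 sk.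
have K0 := hnorm_kern_gt0 w1; set K := hnorm (kern w) ^+ 2 in K0.
have KE : (1 - normc w ^+ 2) = K^-1 by rewrite /K hnorm_kern// invrK.
have le1 : normc (csum (dil a w)) ^+ 2 <= K^-1 * hnorm (hmul a (kern w)) ^+ 2.
  have := hdot_CauchySchwarz Hp Hk.
  rewrite hdot_kern ev_hmul// -(hdot_kern (kern w)) hdotff// normcM normcR.
  rewrite ger0_norm ?sqr_ge0// -/K -evE => h.
  have : (normc (ev a w) * K) ^+ 2 <= (hnorm (hmul a (kern w)) * hnorm (kern w)) ^+ 2.
    by rewrite ler_pXn2r ?nnegrE ?mulr_ge0 ?normc_ge0 ?hnorm_ge0 ?(ltW K0)//.
  rewrite !exprMn -/K expr2 mulrA ler_pM2r// => {}h.
  by rewrite ler_pdivlMl// mulrC.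
apply: le_trans le1 _; rewrite -parseval// KE -RintegralZl//; last first.
  by apply: integrable_continuous; apply: continuous_normc_sqr; exact: continuous_csum_dil.
rewrite le_eqVlt; apply/orP; left; apply/eqP; apply: eq_Rintegral => x _.
have c1 := normc_cis x.
rewrite dil_hmul csum_hmul; try exact: abs_summable_dil_circle.
have h : normc (csum (dil (kern w) (cis x))) ^+ 2 * normc (1 - w^*%C * cis x) ^+ 2 = 1.
  by rewrite -exprMn -normcM (csum_kern w1 c1).2 normc1 expr1n.
have -> : (normc (1 - w^*%C * cis x) ^+ 2)^-1 = normc (csum (dil (kern w) (cis x))) ^+ 2.
  have n0 : normc (1 - w^*%C * cis x) ^+ 2 != 0.
    by apply/eqP => h0; move: h; rewrite h0 mulr0 => /esym/eqP; rewrite oner_eq0.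
  by apply: (mulIf n0); rewrite mulVf.
by rewrite normcM exprMn [X in _ * X]mulrC mulrA.
Qed.

End PoissonKernel.

(** * Radial maximal function *)

#[global] Opaque csum ev hdot hnorm l1norm.

Section RadialMaximalFunction.
Context {R : realType}.
Local Notation C := (R[i]^o).
Local Notation mu := (@lebesgue_measure R).
Implicit Types (a g : nat -> C) (w z : C) (t x q : R).

Lemma Rintegral_le_ereal (D : set R) (f : R -> R) (B : R) : (forall x, D x -> 0 <= f x) ->
  (\int[mu]_(x in D) (f x)%:E <= B%:E)%E -> \int[mu]_(x in D) f x <= B.
Proof.
move=> f0 fB; have i0 : (0 <= \int[mu]_(x in D) (f x)%:E)%E.
  by apply: integral_ge0 => x Dx; rewrite lee_fin f0.
rewrite /Rintegral -lee_fin fineK// ge0_fin_numE// (le_lt_trans fB)//.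
exact: ltry.
Qed.

(** Shell [k] has weight [4 / (4^k e)] and mass at most [2 c 2^k e], so it contributes [8 c / 2^k];
    the geometric series gives [16 c]. *)
Lemma poisson_dyadic_integral (phi : R -> R) t e c : continuous phi ->
  (forall x, 0 <= phi x) -> 0 < e -> 0 <= c -> 0 <= t <= 1 ->
  (forall r, 0 < r ->
    (\int[mu]_(x in `[0%R, 1%R] `&` ball t r) (phi x)%:E <= (c * (r *+ 2))%:E)%E) ->
  \int[mu]_(x in `[0, 1]) (e / (e ^+ 2 + (x - t) ^+ 2) * phi x) <= 16 * c.
Proof.
move=> cphi phi0 e0 c0 /andP[t0 t1] hc.
have mphi : measurable_fun setT phi by exact: continuous_measurable_fun.
(* Once [2^K e > 1], the shells up to [K] cover [[0, 1]] from any centre [t] in it. *)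
have [K hK] : exists K, 1 < 2 ^+ K * e.
  have [K hK] := ltr_add_invr (y := 0) (x := e) ltac:(by []).
  exists K; have K2 : K.+1%:R <= 2 ^+ K :> R by rewrite -natrX ler_nat ltn_expl.
  move: hK; rewrite add0r => hK.
  apply: lt_le_trans (_ : K.+1%:R * e <= _); last by rewrite ler_wpM2r// ltW.
  by rewrite -ltr_pdivrMl ?ltr0n// mulr1.
pose co k : R := 4 / (4 ^+ k * e).
have co0 k : 0 <= co k by rewrite divr_ge0// mulr_ge0 ?exprn_ge0// ltW.
pose h k (x : R) := (co k * (phi \_ (ball t (2 ^+ k * e))) x).
have rk k : 0 < 2 ^+ k * e by rewrite mulr_gt0// exprn_gt0.
have h0 k x : 0 <= h k x.
  by rewrite /h mulr_ge0// patchE; case: ifP.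
have mpatch k : measurable_fun (`[0%R, 1%R]%classic : set R) (phi \_ (ball t (2 ^+ k * e))).
  apply: measurable_funTS.
  have mb : measurable (ball t (2 ^+ k * e)) by exact: measurable_ball.
  by apply: (measurable_restrictT phi mb).1; exact: measurable_funTS.
have mpatchE k : measurable_fun (`[0%R, 1%R]%classic : set R)
    (EFin \o (phi \_ (ball t (2 ^+ k * e)))) by apply/measurable_EFinP.
have mh k : measurable_fun (`[0%R, 1%R]%classic : set R) (EFin \o h k).
  by apply/measurable_EFinP; apply: measurable_funM.
apply: Rintegral_le_ereal => [x _|].
  rewrite mulr_ge0// divr_ge0 ?(ltW e0)// addr_ge0 ?sqr_ge0//.
have kpos x : e ^+ 2 + (x - t) ^+ 2 != 0.
  by rewrite gt_eqF// ltr_wpDr ?sqr_ge0// exprn_gt0.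
have ck : continuous (fun x => e / (e ^+ 2 + (x - t) ^+ 2) * phi x).
  move=> x; apply: cvgM; last exact: cphi.
  apply: cvgM; first exact: cvg_cst.
  apply: cvgV => //; apply: cvgD; first exact: cvg_cst.
  apply: (@continuous_cvg _ _ _ _ _ _ (fun x : R => x ^+ 2)).
    exact: exprn_continuous.
  by apply: cvgB; [exact: cvg_id|exact: cvg_cst].
apply: (@le_trans _ _ (\int[mu]_(x in `[0%R, 1%R]) \sum_(0 <= k < K.+1) (h k x)%:E)%E).
  apply: ge0_le_integral => //.
  - by move=> x _; rewrite lee_fin mulr_ge0// divr_ge0 ?(ltW e0)// addr_ge0 ?sqr_ge0.
  - apply/measurable_EFinP; apply: measurable_funTS.
    exact: continuous_measurable_fun.
  - by apply: emeasurable_sum => k; exact: mh.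
  move=> x; rewrite /= in_itv/= => /andP[x0 x1].
  rewrite sumEFin lee_fin big_mkord.
  have xK : `|x - t| < 2 ^+ K * e.
    apply: le_lt_trans hK; rewrite ler_norml; apply/andP; split; lra.
  apply: le_trans (ler_wpM2r (phi0 x) (poisson_dyadic e0 xK)) _.
  rewrite mulr_suml; apply: ler_sum => k _; rewrite -[leLHS]mulrA; apply: (@ler_wpM2l _ (co k)); first exact: co0.
  rewrite patchE -ball_normE /ball_ distrC; case: ifPn => [|].
    by rewrite inE/= => ->; rewrite mul1r.
  by rewrite notin_setE/= => /negP/negbTE ->; rewrite mul0r.
rewrite ge0_integral_sum//; last first.
  by move=> k x _; rewrite lee_fin.
apply: (@le_trans _ _ (\sum_(0 <= k < K.+1) (8 * c * 2^-1 ^+ k)%:E)%E).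
  apply: lee_sum => k _.
  rewrite (_ : (fun x => _) = (fun x => (co k)%:E * ((phi \_ (ball t (2 ^+ k * e))) x)%:E)%E); last first.
    by apply/funext => x; rewrite /h EFinM.
  rewrite ge0_integralZl ?lee_fin//; [|exact: mpatchE|];
    last by move=> x _; rewrite lee_fin patchE; case: ifP.
  have := hc _ (rk k); rewrite integral_mkcondr => hk.
  apply: (@le_trans _ _ ((co k)%:E * (c * ((2 ^+ k * e) *+ 2))%:E)%E).
    rewrite lee_pmul2l// ?lte_fin; last first.
      by rewrite /co divr_gt0// mulr_gt0// exprn_gt0.
    by move: hk; rewrite restrict_EFin.
  rewrite -EFinM lee_fin le_eqVlt; apply/orP; left; apply/eqP.
  rewrite /co (_ : 4 ^+ k = 2 ^+ k * 2 ^+ k :> R); last by rewrite -exprMn -natrM.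
  rewrite -[(2 ^+ k * e) *+ 2]mulr_natl exprVn.
  have : 2 ^+ k != 0 :> R by rewrite expf_neq0.
  by move: (2 ^+ k : R) => m m0; field; rewrite m0 gt_eqF.
rewrite sumEFin lee_fin -mulr_sumr (_ : 16 * c = 8 * c * 2); last by ring.
rewrite ler_wpM2l ?mulr_ge0//.
have := @geometric_seriesE R 1 2^-1 ltac:(by rewrite lt_eqF// invf_lt1// ltr1n).
move=> /(congr1 (fun u => u K.+1)); rewrite /geometric/= /series/=.
under eq_bigr do rewrite mul1r.
move=> ->; rewrite mul1r.
have -> : 1 - 2^-1 = 2^-1 :> R by field.
by rewrite invrK ler_piMl// gerBl exprn_ge0.
Qed.

Lemma continuous_affine_cis (a b : C) : continuous (fun x => a - b * cis x).
Proof.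
move=> y; apply: cvgB; first exact: cvg_cst.
by apply: cvgMl_tmp; exact: (@continuous_cisX R 1 y).
Qed.

Lemma poisson_average (phi : R -> R) t q e c : continuous phi ->
  (forall x, 0 <= phi x) -> 0 < e -> 0 <= c -> e <= t <= 1 - e -> 2^-1 <= q < 1 ->
  (forall r, 0 < r ->
    (\int[mu]_(x in `[0%R, 1%R] `&` ball t r) (phi x)%:E <= (c * (r *+ 2))%:E)%E) ->
  \int[mu]_(x in `[0, 1])
    ((1 - q ^+ 2) * (normc (1 - (q%:C%C * cis t)^*%C * cis x) ^+ 2)^-1 * phi x) <=
  4 / e * (16 * c).
Proof.
move=> cphi phi0 e0 c0 /andP[te1 te2] /andP[q0 q1] hc.
have den x : normc (1 - (q%:C%C * cis t)^*%C * cis x) ^+ 2 != 0.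
  rewrite poisson_denominator gt_eqF// ltr_wpDr//.
    by rewrite mulr_ge0 ?sqr_ge0//; lra.
  by rewrite exprn_gt0//; lra.
have cden : continuous (fun x => normc (1 - (q%:C%C * cis t)^*%C * cis x) ^+ 2).
  exact: (continuous_normc_sqr (@continuous_affine_cis 1 ((q%:C%C * cis t)^*%C))).
pose d := (1 - q) / (e / 2).
have d0 : 0 < d by rewrite /d divr_gt0//; lra.
have dx x : d ^+ 2 + (x - t) ^+ 2 != 0.
  by rewrite gt_eqF// ltr_wpDr ?sqr_ge0// exprn_gt0.
have cK : continuous (fun x => d / (d ^+ 2 + (x - t) ^+ 2) * phi x).
  move=> x; apply: cvgM; last exact: cphi.
  apply: cvgM; first exact: cvg_cst.
  apply: cvgV => //; apply: cvgD; first exact: cvg_cst.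
  apply: (@continuous_cvg _ _ _ _ _ _ (fun x : R => x ^+ 2)).
    exact: exprn_continuous.
  by apply: cvgB; [exact: cvg_id|exact: cvg_cst].
apply: (@le_trans _ _ (\int[mu]_(x in `[0, 1]) (4 / e * (d / (d ^+ 2 + (x - t) ^+ 2) * phi x)))).
  apply: le_Rintegral => //.
  - apply: integrable_continuous => x; apply: cvgM; last exact: cphi.
    apply: cvgMl_tmp; apply: cvgV; [exact: den|exact: cden].
  - apply: integrable_continuous => x; apply: cvgMl_tmp; exact: cK.
  move=> x; rewrite /= in_itv/= => /andP[x0 x1]; rewrite mulrA; apply: ler_wpM2r => //.
  apply: poisson_kernel_le => //; first by rewrite q0.
  by rewrite ler_norml; apply/andP; split; lra.
rewrite RintegralZl//; last exact: integrable_continuous.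
rewrite ler_wpM2l ?divr_ge0 ?(ltW e0)//.
by apply: poisson_dyadic_integral => //; apply/andP; split; lra.
Qed.

Lemma radialE g t x : ev g (x%:C%C * cis t) = csum (dil (dil g x%:C%C) (cis t)).
Proof. by rewrite dil_dil. Qed.

Lemma normc_rcis x t : 0 <= x -> normc (x%:C%C * cis t) = x.
Proof. by move=> x0; rewrite normcM normcR normc_cis mulr1 ger0_norm. Qed.

Lemma dil_real_summable g x : H2 g -> 0 <= x < 1 -> abs_summable (dil g x%:C%C).
Proof.
by move=> Hg /andP[x0 x1]; apply: dil_summable => //; rewrite normcR ger0_norm.
Qed.

Lemma hnorm_dil g x : H2 g -> 0 <= x <= 1 -> H2 (dil g x%:C%C) /\ hnorm (dil g x%:C%C) <= hnorm g.
Proof.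
move=> Hg /andP[x0 x1]; apply: hnorm_le; first exact: hnorm_ge0.
move=> n; apply: le_trans (series_le_hnorm n Hg).
apply: ler_sum => k _; rewrite /dil normcM exprMn ler_piMr ?sqr_ge0//.
by rewrite normcX normcR ger0_norm// -exprM exprn_ile1.
Qed.

Lemma continuous_radial g x : H2 g -> 0 <= x < 1 ->
  continuous (fun t => ev g (x%:C%C * cis t) : C).
Proof.
move=> Hg x01; rewrite (_ : (fun t => _) = (fun t => csum (dil (dil g x%:C%C) (cis t)))).
  by apply: continuous_csum_dil; exact: dil_real_summable.
by apply/funext => t; rewrite radialE.
Qed.

(** A superlevel set of the radial maximal function. The margin [e] keeps [t] away from the point
    where the circle is cut open, and the radii start at 1/2 as in [poisson_kernel_le]. When
    [rho < 1], [g] can be replaced by a dilation that is continuous up to the circle. *)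
Definition maximal_set g (e c rho : R) : set R :=
  [set t | e < t < 1 - e /\
    exists2 r, 2^-1 <= r < rho & c < normc (ev g (r%:C%C * cis t)) ^+ 2].

Lemma open_maximal_set g (e c rho : R) : H2 g -> rho <= 1 -> open (maximal_set g e c rho).
Proof.
move=> Hg rho1.
rewrite (_ : maximal_set g e c rho = `]e, (1 - e)[ `&`
    \bigcup_(r in [set r | 2^-1 <= r < rho])
      ((fun t => normc (ev g (r%:C%C * cis t)) ^+ 2) @^-1` [set y | c < y])).
  apply: openI; first exact: interval_open.
  apply: bigcup_open => r /andP[r0 r1]; apply: open_comp; last exact: open_gt.
  move=> t _; apply: continuous_normc_sqr; apply: continuous_radial => //.
  by rewrite (le_trans _ r0) ?invr_ge0//= (lt_le_trans r1).
apply/seteqP; split => t /=; rewrite in_itv/=.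
  by move=> [te [r rr cr]]; split=> //; exists r.
by move=> [te [r rr cr]]; split=> //; exists r.
Qed.

(** Let [G] be the dilation of [g] by [rho], and [q = r / rho]. If the Hardy-Littlewood maximal
    function of [|G|^2] is at most [c1] at [t], then [poisson_ineq] and [poisson_average] bound
    [|g(r cis t)|^2] by [64 c1 / e], which is [c] for [c1 = c e / 64]. The constant 3 of the maximal
    inequality yields [192 = 3 * 64]. *)
Lemma maximal_set_measure_lt1 g (e c rho : R) : H2 g -> 0 < e -> 0 < c -> rho < 1 ->
  (mu (maximal_set g e c rho) <= (192 / (c * e) * hnorm g ^+ 2)%:E)%E.
Proof.
move=> Hg e0 c0 rho1.
have [rho0|rho0] := leP rho 2^-1.
  rewrite (_ : maximal_set _ _ _ _ = set0) ?measure0 ?lee_fin.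
    exact: (mulr_ge0 (divr_ge0 (ler0n _ _) (mulr_ge0 (ltW c0) (ltW e0))) (sqr_ge0 _)).
  by apply/seteqP; split => t //= [_ [r /andP[r0 r1]]]; lra.
have rhop : 0 < rho by lra.
pose G := dil g rho%:C%C; have sG : abs_summable G.
  by apply: dil_real_summable => //; rewrite (ltW rhop).
pose phi x := normc (csum (dil G (cis x))) ^+ 2.
have cphi : continuous phi.
  by apply: continuous_normc_sqr; exact: continuous_csum_dil.
have phi0 x : 0 <= phi x by exact: sqr_ge0.
have iphi : mu.-integrable `[0, 1] (EFin \o phi) by exact: integrable_continuous.
pose f := phi \_ `[0, 1].
have lf : locally_integrable setT f by exact: integrable_locally_restrict.
pose c1 := c * e / 64; have c10 : 0 < c1 by rewrite divr_gt0// mulr_gt0.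
have := maximal_inequality lf c10.
have -> : (\int[mu]_y `|(f y)%:E| = (hnorm G ^+ 2)%:E)%E.
  rewrite -parseval// (_ : (fun y => _) = (EFin \o phi) \_ `[0, 1]).
    rewrite -integral_mkcond /Rintegral fineK//.
    by apply: integrable_fin_num.
  apply/funext => y; rewrite restrict_EFin /= /f patchE; case: ifP => _ //=.
    by rewrite ger0_norm.
  by rewrite normr0.
move=> hmax.
apply: (@le_trans _ _ (mu [set x | (c1%:E < HL_maximal f x)%E])).
  apply: le_measure; rewrite ?inE.
  - by apply: open_measurable; apply: open_maximal_set => //; exact: ltW.
  - rewrite -[X in measurable X]setTI; apply: emeasurable_fun_o_infty => //.
    exact: measurable_HL_maximal.
  move=> t [/andP[te1 te2] [r /andP[r0 r1] cr]] /=.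
  rewrite ltNge; apply/negP => HLc.
  pose q := r / rho.
  have q0 : 2^-1 <= q by rewrite (le_trans r0)// /q ler_peMr ?(le_trans _ r0)//
    ?invr_ge0// invf_ge1// ltW.
  have q1 : q < 1 by rewrite /q ltr_pdivrMr// mul1r.
  have rq : rho%:C%C * q%:C%C = r%:C%C :> C.
    by rewrite -rmorphM/= /q mulrCA mulfV ?mulr1// gt_eqF.
  have wE : ev g (r%:C%C * cis t) = csum (dil G (q%:C%C * cis t)).
    by rewrite /G dil_dil [in RHS]mulrA rq.
  have qq : 0 <= q by apply: le_trans q0; rewrite invr_ge0.
  have nw := normc_rcis t qq; have w1 := q1; rewrite -nw in w1.
  rewrite wE in cr; have := lt_le_trans cr (poisson_ineq sG w1).
  apply/negP; rewrite -leNgt.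
  rewrite nw; have -> : c = 4 / e * (16 * c1).
    by rewrite /c1; field; rewrite gt_eqF.
  have t01 : e <= t <= 1 - e by rewrite !ltW.
  apply: (poisson_average cphi phi0 e0 (ltW c10) t01); first by rewrite q0.
  clear cr wE nw w1 rq => s s0; have : (iavg f (ball t s) <= c1%:E)%E.
    apply: le_trans HLc; apply: ereal_sup_ubound; exists s => //=.
    by rewrite in_itv/= s0.
  rewrite /f iavg_restrict//; last exact: measurable_ball.
  rewrite lebesgue_measure_ball ?(ltW s0)//.
  have s2 : 0 < s *+ 2 by rewrite pmulrn_lgt0.
  rewrite inver gt_eqF// lee_pdivrMl// muleC -EFinM.
  by under eq_integral do rewrite ger0_norm//.
apply: le_trans hmax _; rewrite -EFinM lee_fin /c1.
have -> : 3 / (c * e / 64) = 192 / (c * e) by field; rewrite !gt_eqF.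
rewrite ler_wpM2l ?divr_ge0 ?mulr_ge0 ?(ltW e0) ?(ltW c0)//.
rewrite ler_pXn2r ?nnegrE ?hnorm_ge0//.
by apply: (hnorm_dil Hg _).2; rewrite (ltW rhop) ltW.
Qed.

(** The bound is uniform in [rho < 1] and passes to the increasing union. *)
Lemma maximal_set_measure g (e c : R) : H2 g -> 0 < e -> 0 < c ->
  (mu (maximal_set g e c 1) <= (192 / (c * e) * hnorm g ^+ 2)%:E)%E.
Proof.
move=> Hg e0 c0; pose F n := maximal_set g e c (1 - n.+1%:R^-1).
have n1 n : 1 - n.+1%:R^-1 < 1 :> R by rewrite ltrBlDr ltrDl invr_gt0.
have mF n : measurable (F n).
  by apply: open_measurable; apply: open_maximal_set => //; exact: ltW.
have FE : maximal_set g e c 1 = \bigcup_n F n.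
  apply/seteqP; split => t.
    move=> [te [r /andP[r0 r1] cr]].
    have [n hn] := ltr_add_invr (y := r) (x := 1) r1.
    exists n => //; split=> //; exists r => //; rewrite r0/=.
    by rewrite ltrBrDr.
  move=> [n _ [te [r /andP[r0 r1] cr]]]; split=> //; exists r => //.
  by rewrite r0 (lt_trans r1).
have ndF : {homo F : n m / (n <= m)%N >-> (n <= m)%O}.
  move=> n m nm; apply/subsetPset => t [te [r /andP[r0 r1] cr]]; split=> //.
  exists r => //; rewrite r0 (lt_le_trans r1)// lerD2l lerN2 lef_pV2 ?posrE//.
  by rewrite ler_nat.
rewrite FE; have h := nondecreasing_cvg_mu (mu := mu) mF (bigcup_measurable (fun k _ => mF k)) ndF.
rewrite -(cvg_lim _ h)//; apply: lime_le; first exact: cvgP h.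
by apply: nearW => n; exact: maximal_set_measure_lt1.
Qed.

End RadialMaximalFunction.

(** * Radial limits *)

Section RadialLimits.
Context {R : realType}.
Local Notation C := (R[i]^o).
Local Notation Re := complex.Re.
Local Notation Im := complex.Im.
Local Notation mu := (@lebesgue_measure R).
Implicit Types (f g p : nat -> C) (w z l : C) (t x q r s : R).

Definition trunc g N : nat -> C := fun n => if (n < N)%N then g n else 0.

Lemma trunc_finite g N n : (N <= n)%N -> trunc g N n = 0.
Proof. by rewrite /trunc leqNgt => /negbTE ->. Qed.

Lemma H2_trunc g N : H2 (trunc g N).
Proof. by apply: (H2_finite (N := N)) => n; exact: trunc_finite. Qed.

Arguments H2_trunc : clear implicits.

Lemma series_trunc_sub g N n : series (fun k => normc ((g - trunc g N) k) ^+ 2) n <=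
  series (fun k => normc (g k) ^+ 2) (N + n)%N - series (fun k => normc (g k) ^+ 2) N.
Proof.
pose h k := normc ((g - trunc g N) k) ^+ 2.
have hS : {homo series h : n m / (n <= m)%N >-> n <= m}.
  by apply: series_ge0_nd => k; exact: sqr_ge0.
apply: le_trans (hS _ _ (leq_addl N n)) _.
rewrite series_nat_sub ?leq_addr// /series/= (big_cat_nat (leq0n N) (leq_addr n N))/=.
rewrite [X in X + _]big1_seq ?add0r => [|k].
  rewrite le_eqVlt; apply/orP; left; apply/eqP; apply: eq_big_seq => k.
  rewrite mem_index_iota => /andP[Nk _].
  by rewrite /h -[(g - _) k]/(g k - trunc g N k) trunc_finite// subr0.
rewrite mem_index_iota => /andP[_ /andP[_ kN]].
by rewrite /h -[(g - _) k]/(g k - trunc g N k) /trunc kN subrr normc0 expr0n.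
Qed.

Lemma hnorm_sub_trunc g N : H2 g ->
  hnorm (g - trunc g N) ^+ 2 <= hnorm g ^+ 2 - series (fun k => normc (g k) ^+ 2) N.
Proof.
move=> Hg; have Hd := H2B Hg (H2_trunc g N).
rewrite (hnorm_sqr Hd); apply: nnseries_lim_le => // n.
apply: le_trans (series_trunc_sub g N n) _.
by rewrite lerD2r; exact: series_le_hnorm.
Qed.

Lemma hnorm_sub_trunc_cvg g : H2 g ->
  (fun N => hnorm (g - trunc g N) ^+ 2) @ \oo --> (0 : R).
Proof.
move=> Hg.
have h : (fun N => hnorm g ^+ 2 - series (fun k => normc (g k) ^+ 2) N) @ \oo --> (0 : R).
  rewrite -(subrr (hnorm g ^+ 2)); apply: cvgB; [exact: cvg_cst|exact: hnorm_sqr_cvg].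
apply: (squeeze_cvgr _ (cvg_cst (0 : R)) h).
by apply: nearW => N; rewrite sqr_ge0 hnorm_sub_trunc.
Qed.

Definition conv_set g : set R :=
  [set t | exists l : C, radial g t r @[r --> 1^'-] --> l].

(** Failure of the Cauchy criterion at radius 1, with integer parameters so that the divergence set
    is measurable. [m.+2] instead of [m.+1] keeps the radii at or above 1/2, the range used in
    [maximal_set]. *)
Definition osc_set g n m : set R :=
  [set t | exists r s, [/\ 1 - m.+2%:R^-1 <= r < 1, 1 - m.+2%:R^-1 <= s < 1 &
    n.+1%:R^-1 < normc (radial g t r - radial g t s)]].

Lemma near_left1 (P : R -> Prop) : (\forall r \near 1^'-, P r) ->
  exists m, forall r, 1 - m.+2%:R^-1 <= r < 1 -> P r.
Proof.
rewrite near_withinE => /nbhs_ballP[d d0 hd].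
have [m hm] := ltr_add_invr (y := 0) (x := d) d0; rewrite add0r in hm.
exists m => r /andP[r0 r1]; apply: hd => //.
rewrite -ball_normE /ball_/= ger0_norm ?subr_ge0 ?ltW//.
apply: le_lt_trans hm; rewrite lerBlDl -lerBlDr (le_trans _ r0)// lerD2l lerN2.
by rewrite lef_pV2 ?posrE// ler_nat.
Qed.

Lemma invS2_le_half m : 2^-1 <= 1 - m.+2%:R^-1 :> R.
Proof.
rewrite lerBrDr -lerBrDl (_ : 1 - 2^-1 = 2^-1); last by field.
by rewrite lef_pV2 ?posrE// ler_nat.
Qed.

Lemma near_left1_itv m : \forall r \near (1 : R)^'-, 1 - m.+2%:R^-1 <= r < 1.
Proof.
near=> r; apply/andP; split; near: r; first by apply: nbhs_left_ge; rewrite gtrBl invr_gt0.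
exact: nbhs_left_lt.
Unshelve. all: by end_near. Qed.

Lemma dist0_normc z (e : R) : `|0 - normc z| < e -> normc z <= e.
Proof. by rewrite sub0r normrN ger0_norm ?normc_ge0// => /ltW. Qed.

Lemma conv_setE g : conv_set g = ~` \bigcup_n \bigcap_m osc_set g n m.
Proof.
apply/seteqP; split => t.
  move=> [l /cvgC_normc hl] [n _ hn].
  have n2 : 0 < n.+1%:R^-1 / 2 :> R by rewrite divr_gt0// invr_gt0.
  move/cvgrPdist_lt : hl => /(_ _ n2) /near_left1[m hm].
  have [r [s [/hm/dist0_normc hr /hm/dist0_normc hs]]] := hn m I.
  apply/negP; rewrite -leNgt.
  apply: le_trans (normc_sub_via _ _ l l) _; rewrite subrr normc0 addr0.
  by rewrite [leRHS]splitr; exact: lerD hr hs.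
move=> hn; apply: cvgC_cauchy => e e0.
have [n nE] := ltr_add_invr (y := 0) (x := e) e0; rewrite add0r in nE.
have : exists m, ~ osc_set g n m t.
  apply/not_existsP => h; apply: hn; exists n => // m _.
  by have := h m; move=> /contrapT.
move=> [m hm]; exists [set r | 1 - m.+2%:R^-1 <= r < 1]; first exact: near_left1_itv.
move=> r s hr hs; rewrite leNgt; apply/negP => hrs; apply: hm; exists r, s.
by split=> //; exact: lt_trans hrs.
Qed.

Lemma radial_itv m r : 1 - m.+2%:R^-1 <= r < 1 -> 0 <= r < 1.
Proof.
move=> /andP[r0 ->]; rewrite andbT (le_trans _ r0)// (le_trans _ (invS2_le_half m))//.
Qed.

Lemma normc_radial t r : 0 <= r < 1 -> normc (r%:C%C * cis t) < 1.
Proof. by move=> /andP[r0 r1]; rewrite normc_rcis. Qed.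

Lemma open_osc_set g n m : H2 g -> open (osc_set g n m).
Proof.
move=> Hg; pose D : set R := [set r | 1 - m.+2%:R^-1 <= r < 1].
rewrite (_ : osc_set g n m = \bigcup_(r in D) \bigcup_(s in D)
   ((fun t => normc (radial g t r - radial g t s)) @^-1` [set y | n.+1%:R^-1 < y])).
  apply: bigcup_open => r Dr; apply: bigcup_open => s Ds.
  apply: open_comp; last exact: open_gt.
  move=> t _; apply: cvgC_norm; apply: cvgB.
    exact: (continuous_radial Hg (radial_itv Dr)).
  exact: (continuous_radial Hg (radial_itv Ds)).
apply/seteqP; split => t.
  by move=> [r [s [Dr Ds h]]]; exists r => //; exists s.
by move=> [r Dr [s Ds h]]; exists r, s.
Qed.

Lemma measurable_osc g n : H2 g -> measurable (\bigcap_m osc_set g n m).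
Proof.
move=> Hg; apply: bigcap_measurable => [|m _]; first by exists 0%N.
by apply: open_measurable; exact: open_osc_set.
Qed.

Lemma measurable_conv_set g : H2 g -> measurable (conv_set g).
Proof.
move=> Hg; rewrite conv_setE; apply: measurableC.
by apply: bigcup_measurable => n _; exact: measurable_osc.
Qed.

Lemma finite_radial_cvg p N t : (forall n, (N <= n)%N -> p n = 0) ->
  radial p t r @[r --> 1^'-] --> (series (dil p (cis t)) N : C).
Proof.
move=> p0.
have E r : radial p t r = \sum_(0 <= k < N) p k * (r%:C%C * cis t) ^+ k.
  have [|_ e] := @csum_finite _ (dil p (r%:C%C * cis t)) N.
    by move=> n Nn; rewrite /dil p0// mul0r.
  by rewrite /radial evE e.
pose F n (r : R) : C := \sum_(0 <= k < n) p k * (r%:C%C * cis t) ^+ k.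
have -> : radial p t = F N by exact/funext.
have FS n : F n.+1 = (fun r => F n r + p n * (r%:C%C * cis t) ^+ n).
  by apply/funext => r; rewrite /F big_nat_recr.
have SS n : series (dil p (cis t)) n.+1 = series (dil p (cis t)) n + p n * cis t ^+ n.
  by rewrite /series/= big_nat_recr.
elim: (N) => [|n IH].
  have -> : F 0%N = fun=> 0 by apply/funext => r; rewrite /F big_nil.
  by rewrite /series/= big_nil; exact: cvg_cst.
rewrite FS SS; apply: cvgD; first exact: IH.
apply: cvgMl_tmp.
rewrite (_ : (fun r : R => _) = fun r => (r ^+ n)%:C%C * cis t ^+ n); last first.
  by apply/funext => r; rewrite exprMn -rmorphXn.
rewrite -[X in _ --> X]mul1r; apply: cvgMr_tmp.
apply: cvgC_ReIm; last exact: cvg_cst.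
have h : (fun r : R => r ^+ n) @ (1 : R)^'- --> (1 : R) ^+ n.
  by apply: cvg_at_left_filter; exact: exprn_continuous.
by rewrite expr1n in h.
Qed.

(** Polynomials converge radially. If [g] oscillates by more than [4 d] while [p = trunc g N] is
    within [d] of its limit at both radii, then [|g - p|] exceeds [d] at one of them; hence the
    quarter of [n.+1%:R^-1]. *)
Lemma osc_sub_maximal g N n e : H2 g -> 0 < e ->
  `]e, (1 - e)[ `&` (\bigcap_m osc_set g n m) `<=`
  maximal_set (g - trunc g N) e ((n.+1%:R^-1 / 4) ^+ 2) 1.
Proof.
move=> Hg e0 t []; rewrite /= in_itv/= => te hn; split=> //.
set p := trunc g N; have Hp : H2 p := H2_trunc g N.
pose d : R := n.+1%:R^-1 / 4; have d0 : 0 < d by rewrite divr_gt0// invr_gt0.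
have /cvgC_normc/cvgrPdist_lt/(_ _ d0)/near_left1[m hm] :=
  @finite_radial_cvg p N t (@trunc_finite g N).
have [r [s [rm sm hrs]]] := hn m I.
have nE : n.+1%:R^-1 = 4 * d :> R by rewrite /d; field.
rewrite nE in hrs.
have /dist0_normc hr := hm _ rm; have /dist0_normc hs := hm _ sm.
have evd x : 1 - m.+2%:R^-1 <= x < 1 ->
    ev (g - p) (x%:C%C * cis t) = radial g t x - radial p t x.
  by move=> xm; exact: (evB Hg Hp (normc_radial t (radial_itv xm))).
have tri : normc (radial g t r - radial g t s) <=
    normc (ev (g - p) (r%:C%C * cis t)) + 2 * d + normc (ev (g - p) (s%:C%C * cis t)).
  rewrite (evd _ rm) (evd _ sm).
  apply: le_trans (normc_sub_via _ _ (radial p t r) (radial p t s)) _.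
  rewrite lerD2r lerD2l.
  apply: le_trans (normc_sub_via _ _ (series (dil p (cis t)) N) (series (dil p (cis t)) N)) _.
  by rewrite subrr normc0 addr0 mulr2n mulrDl mul1r; exact: lerD hr hs.
have hlf x : 1 - m.+2%:R^-1 <= x < 1 -> 2^-1 <= x < 1.
  by move=> /andP[x0 ->]; rewrite andbT (le_trans (invS2_le_half m)).
have fin x : 1 - m.+2%:R^-1 <= x < 1 -> d < normc (ev (g - p) (x%:C%C * cis t)) ->
    exists2 r0, 2^-1 <= r0 < 1 & (n.+1%:R^-1 / 4) ^+ 2 < normc (ev (g - p) (r0%:C%C * cis t)) ^+ 2.
  move=> xm hx; exists x; first exact: hlf.
  by rewrite ltr_pXn2r ?nnegrE ?normc_ge0// ltW.
have [h|h] := ltP d (normc (ev (g - p) (r%:C%C * cis t))); first exact: (fin r rm h).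
have [h'|h'] := ltP d (normc (ev (g - p) (s%:C%C * cis t))); first exact: (fin s sm h').
exfalso; move: (lt_le_trans hrs tri); apply/negP; rewrite -leNgt.
have -> : 4 * d = d + 2 * d + d by ring.
by apply: lerD h'; rewrite lerD2r.
Qed.

(** The set does not depend on the truncation order [N], whereas the weak type bound for
    [g - trunc g N] tends to 0. *)
Lemma osc_null g n e : H2 g -> 0 < e ->
  mu (`]e, (1 - e)[ `&` (\bigcap_m osc_set g n m)) = 0%E.
Proof.
move=> Hg e0; apply/eqP; rewrite eq_le measure_ge0 andbT.
set A := _ `&` _; have mA : measurable A.
  by apply: measurableI => //; exact: measurable_osc.
pose d : R := (n.+1%:R^-1 / 4) ^+ 2.
have d0 : 0 < d by rewrite exprn_gt0// divr_gt0// invr_gt0.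
have h N : (mu A <= (192 / (d * e) * hnorm (g - trunc g N) ^+ 2)%:E)%E.
  have Hd := H2B Hg (H2_trunc g N).
  apply: le_trans (maximal_set_measure Hd e0 d0).
  apply: le_measure; rewrite ?inE//; last exact: osc_sub_maximal.
  by apply: open_measurable; exact: open_maximal_set.
have c0 : (fun N => 192 / (d * e) * hnorm (g - trunc g N) ^+ 2) @ \oo --> (0 : R).
  rewrite -(mulr0 (192 / (d * e))); apply: cvgMl_tmp.
  exact: hnorm_sub_trunc_cvg.
have fA : mu A \is a fin_num.
  by rewrite ge0_fin_numE ?measure_ge0// (le_lt_trans (h 0%N))// ltry.
rewrite -(fineK fA) lee_fin; apply: (cvgn_ge_cst c0) => N.
by rewrite -lee_fin fineK.
Qed.

Lemma conv_set_negligible g : H2 g ->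
  exists2 N, measurable N /\ mu N = 0%E & `[0, 1] `\` conv_set g `<=` N.
Proof.
move=> Hg.
pose F k n := `](k.+2%:R^-1 : R), (1 - k.+2%:R^-1)[ `&` (\bigcap_m osc_set g n m).
have mF k n : measurable (F k n) by apply: measurableI => //; exact: measurable_osc.
have nF : mu.-negligible ((\bigcup_k \bigcup_n F k n) `|` ([set 0] `|` [set 1])).
  apply: negligibleU.
    apply: negligible_bigcup => k; apply: negligible_bigcup => n.
    have k0 : 0 < k.+2%:R^-1 :> R by rewrite invr_gt0.
    by apply/negligibleP; [exact: mF|exact: (osc_null n Hg k0)].
  by apply: negligibleU; (apply/negligibleP; [exact: measurable_set1|exact: lebesgue_measure_set1]).
have [N [mN N0 hN]] := nF; exists N => // t [].
rewrite /= in_itv/= conv_setE => /andP[t0 t1] /contrapT[n _ hn]; apply: hN.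
(* The endpoints 0 and 1 lie in no interval with a margin, so they were put into the null set by
   hand. *)
move: t0; rewrite le_eqVlt => /predU1P[<-|t0]; first by right; left.
move: t1; rewrite le_eqVlt => /predU1P[->|t1]; first by right; right.
left; have m0 : 0 < Num.min t (1 - t) by rewrite lt_min t0 subr_gt0.
have [k hk] := ltr_add_invr (y := 0) m0; rewrite add0r lt_min in hk.
have hk2 : k.+2%:R^-1 <= k.+1%:R^-1 :> R by rewrite lef_pV2 ?posrE// ler_nat.
exists k => //; exists n => //; split=> //; rewrite /= in_itv/=.
move/andP : hk => [h1 h2]; rewrite (le_lt_trans hk2 h1)/= ltrBrDl -ltrBrDr.
exact: le_lt_trans hk2 h2.
Qed.

(** A sequence of radii, because measurability of limits and Fatou's lemma are applied to
    sequences. *)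
Definition radius n : R := 1 - n.+2%:R^-1.

Lemma radius_itv n : 0 <= radius n < 1.
Proof.
by rewrite /radius gtrBl invr_gt0 ltr0n andbT (le_trans _ (invS2_le_half n)).
Qed.

Lemma radius_cvg : radius @ \oo --> (1 : R)^'-.
Proof.
move=> P hP; have [m hm] := @near_left1 P hP.
exists m => // n /= mn; apply: hm; have /andP[_ ->] := radius_itv n.
by rewrite andbT lerD2l lerN2 lef_pV2 ?posrE// ler_nat.
Qed.

Lemma bdry_cvg g t : conv_set g t -> radial g t r @[r --> 1^'-] --> bdry g t.
Proof. by move=> [l hl]; rewrite /bdry (limC_eq hl). Qed.

Lemma bdry_radius_cvg g t : conv_set g t ->
  (fun n => ev g ((radius n)%:C%C * cis t)) @ \oo --> bdry g t.
Proof.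
move=> /bdry_cvg h; apply: (cvg_comp radius (radial g t)); last exact: h.
exact: radius_cvg.
Qed.

Lemma bdry_nconv g t : ~ conv_set g t -> bdry g t = point.
Proof. by move=> h; rewrite /bdry /lim /lim_in getPN// => l hl; apply: h; exists l. Qed.

(** Off [conv_set g] the [lim] in [bdry] takes the default value [point], so the function is
    constant there; on [conv_set g] it is a limit of continuous functions along [radius]. *)
Lemma measurable_bdry (F : C -> R) g : H2 g ->
  (forall (u : nat -> C) l, u @ \oo --> l -> F (u n) @[n --> \oo] --> F l) ->
  (forall u : R -> C, continuous u -> continuous (F \o u)) ->
  measurable_fun setT (fun t => F (bdry g t)).
Proof.
move=> Hg cF cF2; have mc := measurable_conv_set Hg.
rewrite -(setvU (conv_set g)) setUC; apply/measurable_funU => //; first exact: measurableC.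
split.
  apply: (@measurable_fun_cvg _ _ _ _ (fun n t => F (ev g ((radius n)%:C%C * cis t)))).
    move=> n; apply: measurable_funTS; apply: continuous_measurable_fun.
    exact: (cF2 _ (continuous_radial Hg (radius_itv n))).
  by move=> t ct; apply: cF; exact: bdry_radius_cvg.
apply: (@eq_measurable_fun _ _ _ _ _ (fun=> F point)); last exact: measurable_cst.
by move=> t; rewrite inE => ht; rewrite bdry_nconv.
Qed.

Lemma measurable_bdry_sqr g : H2 g -> measurable_fun setT (fun t => normc (bdry g t) ^+ 2).
Proof.
move=> Hg; apply: (measurable_bdry (F := fun z => normc z ^+ 2)) => //.
  move=> u l ul; apply: (@continuous_cvg _ _ _ _ _ _ (fun x : R => x ^+ 2)).
    exact: exprn_continuous.
  exact: cvgC_norm.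
by move=> u cu; exact: continuous_normc_sqr.
Qed.

Lemma Re_bdry_measurable g : H2 g -> measurable_fun setT (fun t => Re (bdry g t)).
Proof.
move=> Hg; apply: (measurable_bdry (F := @complex.Re R)) => //.
  by move=> u l ul; exact: cvgC_Re.
by move=> u cu; exact: continuous_Re.
Qed.

Lemma Im_bdry_measurable g : H2 g -> measurable_fun setT (fun t => Im (bdry g t)).
Proof.
move=> Hg; apply: (measurable_bdry (F := @complex.Im R)) => //.
  by move=> u l ul; exact: cvgC_Im.
by move=> u cu t; exact: cvgC_Im (cu t).
Qed.

End RadialLimits.

Arguments H2_trunc {R} g N.

#[global] Opaque radial.

(** * Parseval's identity for the radial limits of functions in H^2 *)

Section BoundaryNorm.
Context {R : realType}.
Local Notation C := (R[i]^o).
Local Notation mu := (@lebesgue_measure R).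
Implicit Types (f g p : nat -> C) (w z l : C) (t x q r s : R).

Lemma radialev f t r : radial f t r = ev f (r%:C%C * cis t).
Proof. by []. Qed.

Lemma near_radial (P : R -> Prop) : (forall r, 0 <= r < 1 -> P r) ->
  \forall r \near 1^'-, P r.
Proof.
move=> h; apply: filterS (near_left1_itv 0) => r hr; apply: h.
exact: radial_itv hr.
Qed.

Lemma radial_cvgD f g t (a b : C) : H2 f -> H2 g ->
  radial f t r @[r --> 1^'-] --> a -> radial g t r @[r --> 1^'-] --> b ->
  radial (f + g) t r @[r --> 1^'-] --> a + b.
Proof.
move=> Hf Hg ha hb; apply: cvg_trans (cvgD ha hb); apply: near_eq_cvg.
apply: near_radial => r r01; rewrite !radialev.
by rewrite (evD Hf Hg (normc_radial t r01)).
Qed.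

Lemma radial_cvgN f t (a : C) : H2 f ->
  radial f t r @[r --> 1^'-] --> a -> radial (- f) t r @[r --> 1^'-] --> - a.
Proof.
move=> Hf ha; apply: cvg_trans (cvgN ha); apply: near_eq_cvg.
apply: near_radial => r r01; rewrite !radialev.
by rewrite (evN Hf (normc_radial t r01)).
Qed.

Lemma radial_cvgM f g t (a b : C) : H2 f -> H2 g ->
  radial f t r @[r --> 1^'-] --> a -> radial g t r @[r --> 1^'-] --> b ->
  radial (hmul f g) t r @[r --> 1^'-] --> a * b.
Proof.
move=> Hf Hg ha hb; apply: cvg_trans (cvgM ha hb); apply: near_eq_cvg.
apply: near_radial => r r01; rewrite !radialev.
by rewrite (ev_hmul Hf Hg (normc_radial t r01)).
Qed.

Lemma bdry_eq f t (a : C) : radial f t r @[r --> 1^'-] --> a -> bdry f t = a.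
Proof. exact: limC_eq. Qed.

Lemma measurable_bdry_sqrE g (D : set R) : H2 g -> measurable D ->
  measurable_fun D (fun t => (normc (bdry g t) ^+ 2)%:E).
Proof.
move=> Hg mD; apply/measurable_EFinP; apply: measurable_funTS.
exact: measurable_bdry_sqr.
Qed.

Lemma ae_conv_set g : H2 g -> {ae mu, forall t : R, `[0, 1]%classic t -> conv_set g t}.
Proof.
move=> Hg; have [N [mN N0] hN] := conv_set_negligible Hg.
exists N; split=> // t /= h; apply: hN.
by split; [apply: contrapT => ht; apply: h => /ht|move=> ct; apply: h].
Qed.

Lemma parseval_ereal (a : nat -> C) : abs_summable a ->
  (\int[mu]_(t in `[0%R, 1%R]) (normc (csum (dil a (cis t))) ^+ 2)%:E = (hnorm a ^+ 2)%:E)%E.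
Proof.
move=> sa; rewrite -parseval// /Rintegral fineK//; apply: integrable_fin_num => //.
by apply: integrable_continuous; apply: continuous_normc_sqr; exact: continuous_csum_dil.
Qed.

(** Fatou's lemma along [radius n]: the mean square over each circle is the squared norm of a
    dilation, at most that of [g]. *)
Lemma bdry_norm_le g : H2 g ->
  (\int[mu]_(t in `[0%R, 1%R]) (normc (bdry g t) ^+ 2)%:E <= (hnorm g ^+ 2)%:E)%E.
Proof.
move=> Hg; have [N [mN N0] hN] := conv_set_negligible Hg.
rewrite (ge0_negligible_integral mN _ (measurable_bdry_sqrE Hg _) _ N0)//; last first.
  by move=> t _; rewrite lee_fin sqr_ge0.
set D := _ `\` N; have mD : measurable D by exact: measurableD.
have cD t : D t -> conv_set g t.
  by move=> [t01 Nt]; apply: contrapT => ht; apply: Nt; apply: hN.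
pose u n t := (normc (ev g ((radius n)%:C%C * cis t)) ^+ 2)%:E.
have mu01 n (A : set R) : measurable A -> measurable_fun A (u n).
  move=> mA; apply/measurable_EFinP; apply: measurable_funTS; apply: continuous_measurable_fun.
  exact: (continuous_normc_sqr (continuous_radial Hg (radius_itv n))).
have u0 n t : (0 <= u n t)%E by rewrite lee_fin sqr_ge0.
have uB n : (\int[mu]_(t in D) u n t <= (hnorm g ^+ 2)%:E)%E.
  apply: (@le_trans _ _ (\int[mu]_(t in `[0%R, 1%R]) u n t)%E).
    by apply: ge0_subset_integral => //; [exact: mu01|exact: subDsetl].
  have r01 := @radius_itv R n.
  under eq_integral do rewrite /u radialE.
  rewrite (parseval_ereal (dil_real_summable Hg r01)) lee_fin.
  rewrite ler_pXn2r ?nnegrE ?hnorm_ge0//.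
  by apply: (hnorm_dil Hg _).2; case/andP: r01 => -> /ltW.
have hfatou := fatou mu mD (fun n => mu01 n D mD) (fun n t _ => u0 n t).
apply: (@le_trans _ _ (\int[mu]_(t in D) limn_einf (u^~ t))%E).
  rewrite le_eqVlt; apply/orP; left; apply/eqP; apply: eq_integral => t.
  rewrite inE => /cD ct; apply/esym; apply: (cvg_limn_einf_sup _).1.
  apply: cvg_EFin; first exact: nearW.
  apply: (@continuous_cvg _ _ _ _ _ _ (fun x : R => x ^+ 2)).
    exact: exprn_continuous.
  exact: (cvgC_norm (bdry_radius_cvg ct)).
apply: le_trans hfatou _; rewrite limn_einf_lim; apply: lime_le; first exact: is_cvg_einfs.
apply: nearW => n; apply: le_trans (uB n); rewrite /einfs/=.
by apply: ereal_inf_lbound; exists n => /=.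
Qed.

Lemma bdry_trunc g N t :
  radial (trunc g N) t r @[r --> 1^'-] --> bdry (trunc g N) t /\
  bdry (trunc g N) t = csum (dil (trunc g N) (cis t)).
Proof.
have h := @finite_radial_cvg R (trunc g N) N t (@trunc_finite _ g N).
rewrite (bdry_eq h); split=> //.
have [|_ ->] := @csum_finite _ (dil (trunc g N) (cis t)) N.
  by move=> n Nn; rewrite /dil trunc_finite// mul0r.
by [].
Qed.

Lemma abs_summable_trunc g N : abs_summable (trunc g N).
Proof.
by have [|s _] := @csum_finite _ (trunc g N) N; first by move=> n; exact: trunc_finite.
Qed.

Arguments abs_summable_trunc : clear implicits.

Lemma bdry_norm_trunc g N :
  (\int[mu]_(t in `[0%R, 1%R]) (normc (bdry (trunc g N) t) ^+ 2)%:E =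
  (hnorm (trunc g N) ^+ 2)%:E)%E.
Proof.
rewrite -(parseval_ereal (abs_summable_trunc g N)); apply: eq_integral => t _.
by rewrite (bdry_trunc g N t).2.
Qed.

Lemma sqrD_le_weighted (e x y : R) : 0 < e ->
  (x + y) ^+ 2 <= (1 + e) * x ^+ 2 + (1 + e^-1) * y ^+ 2.
Proof.
move=> e0; rewrite -subr_ge0.
rewrite (_ : _ - _ = e^-1 * (e * x - y) ^+ 2); last by field; rewrite gt_eqF.
by rewrite mulr_ge0 ?sqr_ge0// invr_ge0 ltW.
Qed.

(** For the remaining inequality, [p = trunc g N] satisfies Parseval exactly and equals
    [g - (g - p)] on the boundary. The weighted inequality bounds [hnorm p^2] by [1 + e] times the
    integral for [g] plus [(1 + 1/e) hnorm (g - p)^2]; first [N] tends to infinity, then [e] to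
    0. *)
Lemma bdry_norm g : H2 g ->
  (\int[mu]_(t in `[0%R, 1%R]) (normc (bdry g t) ^+ 2)%:E = (hnorm g ^+ 2)%:E)%E.
Proof.
move=> Hg; apply/eqP; rewrite eq_le bdry_norm_le//=.
set X := (X in (_ <= X)%E).
have X0 : (0 <= X)%E by apply: integral_ge0 => t _; rewrite lee_fin sqr_ge0.
have Xf : X \is a fin_num.
  by rewrite ge0_fin_numE// (le_lt_trans (bdry_norm_le Hg))// ltry.
pose x := fine X; have XE : X = x%:E by rewrite fineK.
have x0 : 0 <= x by exact: fine_ge0.
rewrite XE lee_fin.
have key N e : 0 < e -> hnorm (trunc g N) ^+ 2 <=
    (1 + e) * x + (1 + e^-1) * hnorm (g - trunc g N) ^+ 2.
  move=> e0; have Hp := H2_trunc g N; have Hd := H2B Hg Hp.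
  set p := trunc g N in Hp Hd *.
  have ei : 0 < e^-1 by rewrite invr_gt0.
  rewrite -lee_fin -(bdry_norm_trunc g N) -/p EFinD !EFinM -XE.
  apply: (@le_trans _ _ (((1 + e)%:E * X + (1 + e^-1)%:E *
    \int[mu]_(t in `[0%R, 1%R]) (normc (bdry (g - p) t) ^+ 2)%:E)%E)); last first.
    apply: leeD2l; apply: lee_wpmul2l; first by rewrite lee_fin addr_ge0// ltW.
    exact: bdry_norm_le.
  have mg := measurable_bdry_sqrE Hg (measurable_itv `[0%R : R, 1%R]).
  have md := measurable_bdry_sqrE Hd (measurable_itv `[0%R : R, 1%R]).
  have e1 : (0 <= (1 + e)%:E)%E by rewrite lee_fin addr_ge0// ltW.
  have e2 : (0 <= (1 + e^-1)%:E)%E by rewrite lee_fin addr_ge0// ltW.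
  rewrite /X -!ge0_integralZl//; try by move=> t _; rewrite lee_fin sqr_ge0.
  rewrite -ge0_integralD//; first last.
  - exact: measurable_funeM.
  - by move=> t _; rewrite mule_ge0// lee_fin sqr_ge0.
  - exact: measurable_funeM.
  - by move=> t _; rewrite mule_ge0// lee_fin sqr_ge0.
  apply: ae_ge0_le_integral => //.
  - by move=> t _; rewrite lee_fin sqr_ge0.
  - exact: measurable_bdry_sqrE.
  - by move=> t _; rewrite adde_ge0// mule_ge0// lee_fin sqr_ge0.
  - by apply: emeasurable_funD; exact: measurable_funeM.
  apply: negligibleS (ae_conv_set Hg) => t /= h ct; apply: h => /ct /bdry_cvg hg.
  have hp := (bdry_trunc g N t).1.
  have := bdry_eq (radial_cvgD Hg (H2N Hp) hg (radial_cvgN Hp hp)).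
  rewrite -/p => bE.
  have -> : bdry p t = bdry g t - bdry (g - p) t by rewrite bE opprB addrC subrK.
  rewrite -!EFinM -EFinD lee_fin; apply: le_trans (sqrD_le_weighted _ _ e0).
  by rewrite ler_pXn2r ?nnegrE ?addr_ge0 ?normc_ge0// le_normcB.
have keyE N e : 0 < e -> series (fun k => normc (g k) ^+ 2) N <=
    (1 + e) * x + (1 + e^-1) * hnorm (g - trunc g N) ^+ 2.
  move=> e0; apply: le_trans (key N e e0).
  apply: le_trans (series_le_hnorm N (H2_trunc g N)).
  rewrite le_eqVlt; apply/orP; left; apply/eqP; apply: eq_big_seq => k.
  by rewrite mem_index_iota => /andP[_ kN]; rewrite /trunc kN.
have lime e : 0 < e -> hnorm g ^+ 2 <= (1 + e) * x.
  move=> e0; rewrite -[leRHS]addr0 -(mulr0 (1 + e^-1)).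
  have h : (fun N => (1 + e) * x + (1 + e^-1) * hnorm (g - trunc g N) ^+ 2) @ \oo -->
      (1 + e) * x + (1 + e^-1) * 0.
    by apply: cvgD; [exact: cvg_cst|apply: cvgMl_tmp; exact: hnorm_sub_trunc_cvg].
  exact: (ler_cvg_to (hnorm_sqr_cvg Hg) h (nearW _ (fun N => keyE N e e0))).
apply/ler_addgt0Pr => e e0.
have x1 : 0 < x + 1 by rewrite ltr_wpDl.
apply: (le_trans (lime (e / (x + 1)) _)); first by rewrite divr_gt0.
rewrite mulrDl mul1r lerD2l mulrAC ler_pdivrMr// ler_wpM2l ?(ltW e0)//.
by rewrite lerDl.
Qed.

End BoundaryNorm.

Arguments abs_summable_trunc {R} g N.

(** * Inner functions *)

Section InnerFunctions.
Context {R : realType}.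
Local Notation C := (R[i]^o).
Local Notation Re := complex.Re.
Local Notation Im := complex.Im.
Local Notation mu := (@lebesgue_measure R).
Implicit Types (f g h p a b theta : nat -> C) (w z l c : C) (t r : R).

Lemma H2_hmul_finite f p N : H2 f -> (forall n, (N <= n)%N -> p n = 0) -> H2 (hmul p f).
Proof.
move=> Hf; elim: N p => [|N IH] p p0.
  rewrite (_ : p = 0); last by apply/funext => n; exact: p0.
  by rewrite hmulC hmul0r; exact: H2_0.
rewrite hmul_recl; apply: H2D; first exact: H2Z.
by apply: H2_shift; apply: IH => n Nn; exact: p0.
Qed.

Lemma hmul_trunc f g n N : (n < N)%N -> hmul f (trunc g N) n = hmul f g n.
Proof.
move=> nN; apply: eq_bigr => i _; congr (_ * _).
by rewrite /trunc (leq_ltn_trans (leq_subr _ _) nN).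
Qed.

Lemma hnorm_trunc_le g N : H2 g -> hnorm (trunc g N) <= hnorm g.
Proof.
move=> Hg; have [//|_ ->//] := @hnorm_le _ (trunc g N) (hnorm g) (hnorm_ge0 g).
move=> n; apply: le_trans (series_le_hnorm n Hg); apply: ler_sum => k _.
by rewrite /trunc; case: ifP => // _; rewrite normc0 expr0n sqr_ge0.
Qed.

Lemma bdry_hmul f g t : H2 f -> H2 g -> conv_set f t -> conv_set g t ->
  bdry (hmul f g) t = bdry f t * bdry g t.
Proof.
by move=> Hf Hg /bdry_cvg hf /bdry_cvg hg; apply: bdry_eq; exact: radial_cvgM.
Qed.

Lemma inner_unimodular theta : inner_function theta ->
  {ae mu, forall t : R, `[0, 1]%classic t -> normc (bdry theta t) = 1}.
Proof.
move=> [_ _]; apply: negligibleS => t /= h ht; apply: h => /ht[l hl nl].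
by rewrite (bdry_eq hl).
Qed.

(** [|theta f| = |f|] almost everywhere on the boundary, so [bdry_norm] compares the norms. It
    applies to [theta f] only once this is known to be in [H2], which is settled afterwards by
    [H2_inner_hmul]. *)
Lemma hnorm_inner_hmul theta f : inner_function theta -> H2 f -> H2 (hmul theta f) ->
  hnorm (hmul theta f) = hnorm f.
Proof.
move=> it Hf Htf; have Ht : H2 theta by case: it.
apply/eqP; rewrite -(@eqrXn2 _ 2) ?hnorm_ge0// -eqe; apply/eqP.
rewrite -(bdry_norm Htf) -(bdry_norm Hf).
apply: ge0_ae_eq_integral => //.
- exact: measurable_bdry_sqrE.
- exact: measurable_bdry_sqrE.
- by move=> t _; rewrite lee_fin sqr_ge0.
- by move=> t _; rewrite lee_fin sqr_ge0.
have := negligibleU (ae_conv_set Ht) (negligibleU (ae_conv_set Hf) (inner_unimodular it)).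
apply: negligibleS => t /= ne; apply: contrapT => h; apply: ne => t01; congr (_%:E).
have ct : conv_set theta t by apply: contrapT => ct; apply: h; left => /(_ t01).
have cf : conv_set f t by apply: contrapT => cf; apply: h; right; left => /(_ t01).
have n1 : normc (bdry theta t) = 1.
  by apply: contrapT => n1; apply: h; right; right => /(_ t01).
by rewrite (bdry_hmul Ht Hf ct cf) normcM n1 mul1r.
Qed.

(** The first [N] coefficients of [theta f] depend only on [trunc f N], and a polynomial multiple of
    [theta] is clearly in [H2]. The isometry on polynomials therefore bounds all partial sums. *)
Lemma H2_inner_hmul theta f : inner_function theta -> H2 f -> H2 (hmul theta f).
Proof.
move=> it Hf; have Ht : H2 theta by case: it.
apply/H2P; exists (hnorm f ^+ 2) => N.
have Hp : H2 (hmul theta (trunc f N)).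
  by rewrite hmulC; apply: (H2_hmul_finite Ht) => n; exact: trunc_finite.
rewrite (_ : series _ N = series (fun n => normc (hmul theta (trunc f N) n) ^+ 2) N).
  apply: le_trans (series_le_hnorm N Hp) _.
  rewrite (hnorm_inner_hmul it (H2_trunc f N) Hp).
  by rewrite ler_pXn2r ?nnegrE ?hnorm_ge0//; exact: hnorm_trunc_le.
apply: eq_big_seq => n; rewrite mem_index_iota => /andP[_ nN].
by rewrite (hmul_trunc _ _ nN).
Qed.

Lemma hnorm_inner theta f : inner_function theta -> H2 f ->
  hnorm (hmul theta f) = hnorm f.
Proof. by move=> it Hf; apply: hnorm_inner_hmul => //; exact: H2_inner_hmul. Qed.

Lemma hdot_polarization f g a b : H2 f -> H2 g -> H2 a -> H2 b ->
  hnorm f = hnorm a -> hnorm g = hnorm b -> hnorm (f + g) = hnorm (a + b) ->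
  hnorm ('i%C *: f + g) = hnorm ('i%C *: a + b) -> hdot f g = hdot a b.
Proof.
move=> Hf Hg Ha Hb nf ng n1 n2.
have := hnorm_sqrD Hf Hg; rewrite n1 (hnorm_sqrD Ha Hb) nf ng => /addrI.
move=> /(mulfI _) e1.
have Hif : H2 ('i%C *: f) by exact: H2Z.
have Hia : H2 ('i%C *: a) by exact: H2Z.
have := hnorm_sqrD Hif Hg; rewrite n2 (hnorm_sqrD Hia Hb).
rewrite (hnormZ _ Hf) (hnormZ _ Ha) (hdotZl _ Hf Hg) (hdotZl _ Ha Hb) nf ng => /addrI.
move=> /(mulfI _); move: e1; case: (hdot f g) => x y; case: (hdot a b) => u v /=.
move=> /(_ ltac:(by rewrite pnatr_eq0)) -> /(_ ltac:(by rewrite pnatr_eq0)).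
by rewrite !mul0r !mul1r !sub0r => /oppr_inj ->.
Qed.

Lemma hdot_inner theta f g : inner_function theta -> H2 f -> H2 g ->
  hdot (hmul theta f) (hmul theta g) = hdot f g.
Proof.
move=> it Hf Hg; apply: hdot_polarization; rewrite ?hnorm_inner//; try exact: H2_inner_hmul.
  by rewrite -hmulDr hnorm_inner//; exact: H2D.
by rewrite -hmulZr -hmulDr hnorm_inner//; apply: H2D => //; exact: H2Z.
Qed.

(** The isometry is tested on [kern w]: [theta(w)] times the squared norm of the kernel is
    [<theta k_w, k_w>], which Cauchy-Schwarz bounds by that squared norm. *)
Lemma ev_inner_le1 theta w : inner_function theta -> normc w < 1 -> normc (ev theta w) <= 1.
Proof.
move=> it w1; have Hk := H2_kern w1; have Hp := H2_inner_hmul it Hk.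
have Ht : H2 theta by case: it.
have K0 := hnorm_kern_gt0 w1.
have := hdot_CauchySchwarz Hp Hk; rewrite hnorm_inner//.
rewrite hdot_kern (ev_hmul Ht Hk w1) -(hdot_kern (kern w)) (hdotff Hk) normcM normcR.
by rewrite ger0_norm ?(ltW K0)// -expr2 -[leRHS]mul1r ler_pM2r.
Qed.

Lemma integrable_bdry_sqr g : H2 g ->
  mu.-integrable `[0, 1] (EFin \o (fun t => normc (bdry g t) ^+ 2)).
Proof.
move=> Hg; apply/integrableP; split; first exact: measurable_bdry_sqrE.
have -> : (\int[mu]_(t in `[0%R, 1%R]) `|(normc (bdry g t) ^+ 2)%:E| =
    \int[mu]_(t in `[0%R, 1%R]) (normc (bdry g t) ^+ 2)%:E)%E.
  by apply: eq_integral => t _ /=; rewrite ger0_norm ?sqr_ge0.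
by rewrite bdry_norm// ltry.
Qed.

Lemma Rintegral_bdry_sqr g : H2 g ->
  \int[mu]_(t in `[0, 1]) (normc (bdry g t) ^+ 2) = hnorm g ^+ 2.
Proof. by move=> Hg; rewrite /Rintegral bdry_norm. Qed.

Lemma integrable_subr (F G : R -> R) : mu.-integrable `[0, 1] (EFin \o F) ->
  mu.-integrable `[0, 1] (EFin \o G) ->
  mu.-integrable `[0, 1] (EFin \o (fun t => F t - G t)).
Proof.
move=> iF iG; apply: (@eq_integrable _ _ _ mu _ _ ((EFin \o F) \- (EFin \o G))%E) => //.
exact: integrableB.
Qed.

(** Polarization: [Re (a conj(b)) = (|a + b|^2 - |a|^2 - |b|^2) / 2] almost everywhere on the
    boundary, which reduces the integral to [bdry_norm]. *)
Lemma Rintegral_Re_hdot (F : R -> R) a b : H2 a -> H2 b -> measurable_fun setT F ->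
  {ae mu, forall t : R, `[0, 1]%classic t -> F t = Re (bdry a t * (bdry b t)^*%C)} ->
  \int[mu]_(t in `[0, 1]) F t = Re (hdot a b).
Proof.
move=> Ha Hb mF hF; have Hab := H2D Ha Hb.
pose G t := 2^-1 * (normc (bdry (a + b) t) ^+ 2 - normc (bdry a t) ^+ 2 - normc (bdry b t) ^+ 2).
have mG : measurable_fun setT G.
  by apply: measurable_funM => //; apply: measurable_funB; [apply: measurable_funB|];
     exact: measurable_bdry_sqr.
have -> : \int[mu]_(t in `[0, 1]) F t = \int[mu]_(t in `[0, 1]) G t.
  congr fine; apply: ae_eq_integral => //.
  - by apply/measurable_EFinP; exact: measurable_funTS.
  - by apply/measurable_EFinP; exact: measurable_funTS.
  have := negligibleU (ae_conv_set Ha) (negligibleU (ae_conv_set Hb) hF).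
  apply: negligibleS => t /= ne; apply: contrapT => h; apply: ne => t01; congr (_%:E).
  have ca : conv_set a t by apply: contrapT => ca; apply: h; left => /(_ t01).
  have cb : conv_set b t by apply: contrapT => cb; apply: h; right; left => /(_ t01).
  have -> : F t = Re (bdry a t * (bdry b t)^*%C).
    by apply: contrapT => n1; apply: h; right; right => /(_ t01).
  rewrite /G (bdry_eq (radial_cvgD Ha Hb (bdry_cvg ca) (bdry_cvg cb))) normc_sqrD.
  move: (normc _ ^+ 2) (normc _ ^+ 2) (Re _) => x y z.
  by field.
have ia := integrable_bdry_sqr Ha; have ib := integrable_bdry_sqr Hb.
have iab := integrable_bdry_sqr Hab.
have i1 : mu.-integrable `[0, 1]
    (EFin \o (fun t => normc (bdry (a + b) t) ^+ 2 - normc (bdry a t) ^+ 2)).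
  exact: integrable_subr.
rewrite /G RintegralZl//; last exact: integrable_subr i1 ib.
rewrite (RintegralB _ i1 ib)// (RintegralB _ iab ia)// !Rintegral_bdry_sqr// hnorm_sqrD//.
move: (hnorm _ ^+ 2) (hnorm _ ^+ 2) (Re _) => x y z.
by field.
Qed.

Lemma Re_mulR z (x : R) : Re (z * x%:C%C) = Re z * x.
Proof. by case: z => a b /=; rewrite mulr0 subr0. Qed.

Lemma Im_mulR z (x : R) : Im (z * x%:C%C) = Im z * x.
Proof. by case: z => a b /=; rewrite mulr0 add0r. Qed.

Lemma circle_int_hdot theta h : inner_function theta -> H2 h ->
  circle_int (fun t => bdry theta t * `|bdry h t| ^+ 2) = hdot (hmul theta h) h.
Proof.
move=> it Hh; have Ht : H2 theta by case: it.
have Hth := H2_inner_hmul it Hh.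
have nE t : `|bdry h t| ^+ 2 = (normc (bdry h t) ^+ 2)%:C%C :> C.
  by rewrite rmorphXn.
have ab t : conv_set theta t -> conv_set h t ->
    bdry theta t * `|bdry h t| ^+ 2 = bdry (hmul theta h) t * (bdry h t)^*%C.
  by move=> ct ch; rewrite (bdry_hmul Ht Hh ct ch) nE -mulrA mul_conjc.
rewrite /circle_int.
rewrite (@Rintegral_Re_hdot _ (hmul theta h) h)//; first last.
- have := negligibleU (ae_conv_set Ht) (ae_conv_set Hh).
  apply: negligibleS => t /= ne; apply: contrapT => k; apply: ne => t01; rewrite ab//.
    by apply: contrapT => ca; apply: k; left => /(_ t01).
  by apply: contrapT => ca; apply: k; right => /(_ t01).
- rewrite (_ : (fun t => _) = (fun t => Re (bdry theta t) * normc (bdry h t) ^+ 2)).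
    by apply: measurable_funM; [exact: Re_bdry_measurable|exact: measurable_bdry_sqr].
  by apply/funext => t; rewrite nE Re_mulR.
(* As [Im z = Re (- i z)], the imaginary part is the same computation with [- i theta h] in place of
   [theta h]. *)
have Hi : H2 ((- 'i%C) *: hmul theta h) by exact: H2Z.
rewrite (@Rintegral_Re_hdot _ ((- 'i%C) *: hmul theta h) h)//; first last.
- have := negligibleU (ae_conv_set Ht) (ae_conv_set Hh).
  apply: negligibleS => t /= ne; apply: contrapT => k; apply: ne => t01.
  have ct : conv_set theta t by apply: contrapT => ca; apply: k; left => /(_ t01).
  have ch : conv_set h t by apply: contrapT => ca; apply: k; right => /(_ t01).
  rewrite ab//.
  have -> : bdry ((- 'i%C) *: hmul theta h) t = (- 'i%C) * bdry (hmul theta h) t.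
    apply: bdry_eq; rewrite (bdry_hmul Ht Hh ct ch).
    have hc := radial_cvgM Ht Hh (bdry_cvg ct) (bdry_cvg ch).
    have : (fun r => (- 'i%C) * radial (hmul theta h) t r : C) @ (1 : R)^'- -->
      ((- 'i%C) * (bdry theta t * bdry h t) : C) by apply: cvgMl_tmp.
    move=> hi; apply: cvg_trans hi; apply: near_eq_cvg; apply: near_radial => r r01.
    by rewrite !radialev (evZ _ Hth (normc_radial t r01)).
  rewrite -mulrA; case: (bdry (hmul theta h) t * (bdry h t)^*%C) => x y /=.
  by rewrite oppr0 mul0r sub0r mulNr mul1r opprK.
- rewrite (_ : (fun t => _) = (fun t => Im (bdry theta t) * normc (bdry h t) ^+ 2)).
    by apply: measurable_funM; [exact: Im_bdry_measurable|exact: measurable_bdry_sqr].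
  by apply/funext => t; rewrite nE Im_mulR.
rewrite hdotZl//; case: (hdot (hmul theta h) h) => x y /=.
by rewrite oppr0 mul0r sub0r mulNr mul1r opprK.
Qed.

End InnerFunctions.

(** * Spectrum of contractions *)

Section Resolvent.
Context {R : realType}.
Local Notation C := (R[i]^o).
Implicit Types (f g : nat -> C) (w z l c : C).

(** For a linear self-map of a closed subspace this is equivalent to a bounded inverse
    ([op_spectrumP]): the lower bound gives both injectivity and the norm of the inverse. In this
    form it transports along isometries without building operators. *)
Definition bijective_below (M : set (nat -> C)) (T : (nat -> C) -> nat -> C) l : Prop :=
  (exists2 e : R, 0 < e & forall f, M f -> e * hnorm f <= hnorm (T f - l *: f)) /\
  (forall g, M g -> exists2 f, M f & T f - l *: f = g).

Variables (M : set (nat -> C)) (T : (nat -> C) -> nat -> C).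
Hypotheses (cM : closed_subspace M) (MT : forall f, M f -> M (T f)) (lT : linear_on M T).

Let MH f : M f -> H2 f. Proof. exact: closed_subspace_H2. Qed.

Let Ml l f : M f -> M (T f - l *: f).
Proof.
by move=> Mf; apply: closed_subspaceB => //; [exact: MT|exact: closed_subspaceZ].
Qed.

Let linl l a f g : M f -> M g ->
  T (a *: f + g) - l *: (a *: f + g) = a *: (T f - l *: f) + (T g - l *: g).
Proof.
move=> Mf Mg; rewrite lT// scalerDr opprD addrACA scalerBr; congr (_ - _ + _).
by rewrite !scalerA mulrC.
Qed.

Let linlB l f g : M f -> M g ->
  T (f - g) - l *: (f - g) = (T f - l *: f) - (T g - l *: g).
Proof.
by move=> Mf Mg; rewrite (linear_onB lT)// scalerBr !opprD !opprK addrACA.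
Qed.

Lemma bijective_below_inverse l : bijective_below M T l ->
  exists2 S, bounded_operator M S &
    forall f, M f -> S (T f - l *: f) = f /\ T (S f) - l *: S f = f.
Proof.
move=> [[e e0 lb] sur].
pose S g := xget 0 [set f | M f /\ T f - l *: f = g].
have SP g : M g -> M (S g) /\ T (S g) - l *: S g = g.
  move=> Mg; have [f Mf fE] := sur g Mg.
  by have := @xgetPex _ 0 [set f | M f /\ T f - l *: f = g] (ex_intro _ f (conj Mf fE)).
have inj f g : M f -> M g -> T f - l *: f = T g - l *: g -> f = g.
  move=> Mf Mg fg; apply/eqP; rewrite -subr_eq0; apply/eqP; apply: hnorm_eq0.
    by apply: H2B; exact: MH.
  have Mfg : M (f - g) by exact: closed_subspaceB.
  have := lb _ Mfg; rewrite linlB// fg subrr hnorm0.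
  by rewrite pmulr_rle0// => h; apply/eqP; rewrite eq_le h hnorm_ge0.
exists S; last first.
  move=> f Mf; split; last exact: (SP _ Mf).2.
  have [MS SE] := SP _ (Ml l Mf); exact: inj.
split.
- by move=> f Mf; exact: (SP _ Mf).1.
- move=> a f g Mf Mg; have [MSf Sf] := SP _ Mf; have [MSg Sg] := SP _ Mg.
  have Mfg : M (a *: f + g) by case: cM => _ _ h _; exact: h.
  have [MS SE] := SP _ Mfg; apply: inj => //.
    by case: cM => _ _ h _; exact: h.
  by rewrite linl// Sf Sg.
- exists e^-1 => f Mf; have [MSf Sf] := SP _ Mf.
  by rewrite ler_pdivlMl// -{2}Sf; exact: lb.
Qed.

Lemma op_spectrumP l : op_spectrum M T l <-> ~ bijective_below M T l.
Proof.
split=> h => [/bijective_below_inverse//|[S [MS lS [B SB]] SP]]; apply: h; split.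
  (* The bound [B] of a bounded operator may be 0 or negative, so [|B| + 1] is inverted instead. *)
  exists (`|B| + 1)^-1; first by rewrite invr_gt0 ltr_wpDl.
  move=> f Mf; have [SE _] := SP f Mf; have Mg := Ml l Mf.
  rewrite ler_pdivrMl ?ltr_wpDl// -{1}SE; apply: le_trans (SB _ Mg) _.
  rewrite ler_wpM2r ?hnorm_ge0// (le_trans (ler_norm _))// lerDl//.
by move=> g Mg; exists (S g); [exact: MS|exact: (SP g Mg).2].
Qed.

Lemma bijective_below_outside l : (forall f, M f -> hnorm (T f) <= hnorm f) ->
  1 < normc l -> bijective_below M T l.
Proof.
move=> T1 l1; have l0 : 0 < normc l by exact: lt_trans l1.
have ln0 : l != 0 by rewrite -normc_gt0.
split.
  exists (normc l - 1); first by rewrite subr_gt0.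
  move=> f Mf; have Hf := MH Mf; have HT := MH (MT Mf).
  rewrite hnormBC//; last exact: H2Z.
  apply: le_trans (le_hnorm_sub (H2Z (a := l) Hf) HT).
  by rewrite hnormZ// mulrBl mul1r lerD2l lerN2 T1.
move=> g Mg.
have [f Mf fE] : exists2 f, M f & f = (- l^-1) *: g + l^-1 *: T f.
  apply: (@neumann _ M (fun f => l^-1 *: T f) (normc l)^-1) => //.
  - by rewrite invr_ge0 ltW.
  - by rewrite invf_lt1.
  - by move=> f Mf; apply: closed_subspaceZ => //; exact: MT.
  - by move=> a x y Mx My; rewrite lT// scalerDr !scalerA (mulrC a).
  - move=> f Mf; rewrite hnormZ; last exact/MH/MT.
    by rewrite normcV ler_wpM2l ?invr_ge0 ?(ltW l0)//; exact: T1.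
  - exact: closed_subspaceZ.
exists f => //; have : l *: f = - g + T f.
  by rewrite {1}fE scalerDr !scalerA mulrN mulfV// scaleN1r scale1r.
by move=> ->; rewrite opprD opprK addrCA subrr addr0.
Qed.

(** Perturbation from outside: at [w = (1 + e/4) l] the operator [T - w] is invertible, and the
    lower bound at [l] makes its inverse [S] of norm at most [2 / e]. As [|w - l| = e / 4], the
    factor in [T - l = (T - w) (1 - (l - w) S)] is inverted by a Neumann series of ratio 1/2. *)
Lemma bijective_below_circle l : (forall f, M f -> hnorm (T f) <= hnorm f) -> normc l = 1 ->
  (exists2 e : R, 0 < e & forall f, M f -> e * hnorm f <= hnorm (T f - l *: f)) ->
  bijective_below M T l.
Proof.
move=> T1 l1 [e e0 lb]; split; first by exists e.
have e4 : 0 < e / 4 by rewrite divr_gt0.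
pose w : C := l + (e / 4)%:C%C * l.
have wl : normc (w - l) = e / 4.
  by rewrite /w addrC addKr normcM normcR l1 mulr1 ger0_norm// ltW.
have w1 : 1 < normc w.
  rewrite /w -{1}(mul1r l) -mulrDl normcM l1 mulr1 -(rmorph1 (real_complex R)) -rmorphD normcR.
  by rewrite ger0_norm ?ltrDl// addr_ge0// ltW.
have lbw f : M f -> e / 2 * hnorm f <= hnorm (T f - w *: f).
  move=> Mf; have Hf := MH Mf; have HTf := MH (Ml l Mf).
  have -> : T f - w *: f = (T f - l *: f) - (w - l) *: f.
    by rewrite scalerBl opprB addrA subrK.
  apply: le_trans (le_hnorm_sub HTf (H2Z (a := w - l) Hf)).
  rewrite hnormZ// wl; have := lb f Mf.
  have : 0 <= e * hnorm f by rewrite mulr_ge0 ?hnorm_ge0 ?ltW.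
  move: (hnorm (T f - _)) (hnorm f) => y x x0 xy.
  rewrite (_ : e / 2 * x = (e * x) / 2); last by ring.
  rewrite (_ : e / 4 * x = (e * x) / 4); last by ring.
  by move: (e * x) x0 xy => ex; lra.
have [S [MS lS _] SP] := bijective_below_inverse (bijective_below_outside T1 w1).
have Sn f : M f -> hnorm (S f) <= 2 / e * hnorm f.
  move=> Mf; have := lbw _ (MS _ Mf); rewrite (SP f Mf).2 => h.
  rewrite -(@ler_pM2l _ (e / 2)) ?divr_gt0//; apply: le_trans h _.
  by rewrite mulrA (_ : e / 2 * (2 / e) = 1) ?mul1r//; field; rewrite gt_eqF.
move=> g Mg.
have [f Mf fE] : exists2 f, M f & f = S g + (l - w) *: S f.
  apply: (@neumann _ M (fun f => (l - w) *: S f) 2^-1) => //.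
  - by rewrite invf_lt1// ltr1n.
  - by move=> f Mf; apply: closed_subspaceZ => //; exact: MS.
  - by move=> a x y Mx My; rewrite lS// scalerDr !scalerA (mulrC a).
  - move=> f Mf; rewrite hnormZ; last exact/MH/MS.
    rewrite normcBC wl.
    apply: le_trans (ler_wpM2l (ltW e4) (Sn _ Mf)) _.
    by rewrite mulrA (_ : e / 4 * (2 / e) = 2^-1)//; field; rewrite gt_eqF.
  - exact: MS.
exists f => //.
have Mgf : M (g + (l - w) *: f).
  by apply: closed_subspaceD => //; exact: closed_subspaceZ.
have fE2 : f = S (g + (l - w) *: f).
  by rewrite addrC lS// addrC.
have -> : T f - l *: f = (T f - w *: f) - (l - w) *: f.
  by rewrite scalerBl opprB addrA subrK.
by have := (SP _ Mgf).2; rewrite -fE2 => ->; rewrite addrK.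
Qed.

End Resolvent.

(** * Model space and model operator *)

Section ModelOperator.
Context {R : realType}.
Local Notation C := (R[i]^o).
Local Notation Re := complex.Re.
Implicit Types (f g k : nat -> C) (w z l c : C).

Variables (theta : nat -> C) (v : C).
Hypotheses (it : inner_function theta) (theta0 : theta 0%N = 0).

Local Notation K := (model_space theta).

Let Ht : H2 theta. Proof. by case: it. Qed.
Let H1 : H2 (seq1 : nat -> C). Proof. exact: H2_seq1. Qed.
Let HKf f : K f -> H2 f. Proof. by case. Qed.
Let Htm f : H2 f -> H2 (hmul theta f). Proof. exact: H2_inner_hmul. Qed.

Lemma model_space_closed : closed_subspace K.
Proof.
split.
- by move=> f /HKf.
- by split; [exact: H2_0|move=> g Hg; rewrite hdot0l//; exact: Htm].
- move=> a f g [Hf fo] [Hg go]; split; first by apply: H2D => //; exact: H2Z.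
  move=> x Hx; have Htx := Htm Hx.
  by rewrite (hdotDl (H2Z (a := a) Hf) Hg Htx) (hdotZl _ Hf Htx) fo// go// mulr0 addr0.
move=> f Hf fa; split=> // g Hg; have Htg := Htm Hg.
apply/eqP; rewrite -normc_eq0 eq_le normc_ge0 andbT; apply/ler_addgt0Pr => e e0.
rewrite add0r; have n1 : 0 < hnorm (hmul theta g) + 1 by rewrite ltr_wpDl ?hnorm_ge0.
have [x [Hx xo] fx] := fa (e / (hnorm (hmul theta g) + 1)) (divr_gt0 e0 n1).
have Hfx := H2B Hf Hx.
have -> : hdot f (hmul theta g) = hdot (f - x) (hmul theta g).
  by rewrite hdotBl// xo// subr0.
apply: le_trans (hdot_CauchySchwarz Hfx Htg) _.
apply: le_trans (ler_wpM2r (hnorm_ge0 _) (ltW fx)) _.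
by rewrite mulrAC ler_pdivrMr// ler_wpM2l ?(ltW e0)// lerDl.
Qed.

Lemma hdot_shift_adjl f g : H2 f -> H2 g -> hdot (shift_adj f) g = hdot f (shift g).
Proof.
move=> Hf Hg; rewrite (hdotC (H2_shift_adj Hf) Hg) (hdotC Hf (H2_shift Hg)).
by rewrite shift_adjoint.
Qed.

Lemma model_space_shift_adj f : K f -> K (shift_adj f).
Proof.
move=> [Hf fo]; split; first exact: H2_shift_adj.
move=> g Hg; rewrite hdot_shift_adjl//; last exact: Htm.
by rewrite -hmul_shiftr fo//; exact: H2_shift.
Qed.

Lemma hdot_seq1l f : H2 f -> hdot seq1 f = ((f 0%N)^*%C : C).
Proof. by move=> Hf; rewrite hdotC// hdot_seq1r. Qed.

(** [theta(0) = 0] makes constants orthogonal to [theta H^2]; this keeps the constant [v] of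
    [model_shift] inside the model space. *)
Lemma model_space_seq1 : K seq1.
Proof.
split=> // g Hg; rewrite hdot_seq1l; last exact: Htm.
by rewrite /hmul big_ord_recl big_ord0 theta0 mul0r addr0 conjc0.
Qed.

Lemma hnorm_theta : hnorm theta = 1.
Proof. by rewrite -{1}(hmul1r theta) hnorm_inner// hnorm_seq1. Qed.

Lemma hdot_model_theta f : K f -> hdot f theta = 0.
Proof. by move=> [_ fo]; rewrite -{1}(hmul1r theta) fo. Qed.

Lemma hdot_theta_model f : K f -> hdot theta f = 0.
Proof. by move=> Kf; rewrite (hdotC Ht (HKf Kf)) hdot_model_theta// conjc0. Qed.

Lemma shift_shift_adj_theta : shift (shift_adj theta) = theta.
Proof. by rewrite shift_shift_adj theta0 scale0r subr0. Qed.

Lemma model_space_shift_adj_theta : K (shift_adj theta).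
Proof.
split; first exact: H2_shift_adj.
move=> g Hg; rewrite hdot_shift_adjl//; last exact: Htm.
rewrite -hmul_shiftr -{1}(hmul1r theta) hdot_inner//; last exact: H2_shift.
by rewrite hdot_seq1l ?conjc0//; exact: H2_shift.
Qed.

(* Compressed shift on [hK], transported to [K] through multiplication by [h]:
   it is the shift on the orthogonal complement of [theta/z] and maps
   [theta/z] to the constant [v]. *)
Definition model_shift f : nat -> C :=
  shift f - hdot (shift f) theta *: (theta - v *: seq1).

Let Htv : H2 (theta - v *: seq1).
Proof. by apply: H2B => //; exact: H2Z. Qed.

(** As [f] is orthogonal to [theta H^2], [z f] is orthogonal to [z theta H^2], so only its component
    along [theta] has to be removed. The rest of [model_shift f] is a constant. *)
Lemma model_space_model_shift f : K f -> K (model_shift f).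
Proof.
move=> Kf; have Hf := HKf Kf; have Hsf := H2_shift Hf.
have cK := model_space_closed.
have -> : model_shift f = (shift f - hdot (shift f) theta *: theta) +
    (hdot (shift f) theta * v) *: seq1.
  by rewrite /model_shift scalerBr opprB scalerA addrCA addrA [RHS]addrC addrA.
apply: closed_subspaceD => //; last by apply: closed_subspaceZ => //; exact: model_space_seq1.
have Hct : H2 (hdot (shift f) theta *: theta) by exact: H2Z.
split; first exact: H2B.
move=> g Hg; have -> : g = g 0%N *: seq1 + shift (shift_adj g).
  by rewrite shift_shift_adj addrC subrK.
have Hg1 := H2_shift_adj Hg; have Hsg := H2_shift Hg1.
have H0 : H2 (g 0%N *: seq1 : nat -> C) by exact: H2Z.
rewrite hmulDr hmulZr hmul1r.
have Hgt : H2 (g 0%N *: theta) by exact: H2Z.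
have Htsg := Htm Hsg.
rewrite hdotBl//; last exact: H2D.
rewrite (hdotZl _ Ht (H2D Hgt Htsg)) !hdotDr// !hdotZr// (hdotff Ht) hnorm_theta expr1n.
have -> : hdot theta (hmul theta (shift (shift_adj g))) = 0.
  by rewrite -{1}(hmul1r theta) hdot_inner// hdot_seq1l// conjc0.
have -> : hdot (shift f) (hmul theta (shift (shift_adj g))) = 0.
  rewrite hmul_shiftr hdot_shift//; last exact: Htm.
  by case: Kf => _ ->.
by rewrite !addr0 mulr1 mulrC subrr.
Qed.

Lemma linear_model_shift : linear_on K model_shift.
Proof.
move=> a f g /HKf Hf /HKf Hg; have Hsf := H2_shift Hf; have Hsg := H2_shift Hg.
rewrite /model_shift shiftD shiftZ (hdotDl (H2Z (a := a) Hsf) Hsg Ht) (hdotZl _ Hsf Ht).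
by move: (theta - _) => X; rewrite scalerDl opprD addrACA scalerBr scalerA.
Qed.

(** [z f - c theta] vanishes at 0, hence is orthogonal to the constant [c v], and Pythagoras
    applies. The exact defect, not only contractivity, is needed in [bijective_circle]. *)
Lemma hnorm_model_shift f : K f -> hnorm (model_shift f) ^+ 2 =
  hnorm f ^+ 2 - (1 - normc v ^+ 2) * normc (hdot (shift f) theta) ^+ 2.
Proof.
move=> Kf; have Hf := HKf Kf; have Hsf := H2_shift Hf.
set c := hdot (shift f) theta.
have Hct : H2 (- c *: theta) by exact: H2Z.
have H2c : H2 ((c * v) *: seq1 : nat -> C) by exact: H2Z.
have Hx : H2 (shift f + - c *: theta) by exact: H2D.
have -> : model_shift f = (shift f + - c *: theta) + (c * v) *: seq1.
  by rewrite /model_shift -/c scalerBr opprB scalerA scaleNr addrCA addrA [RHS]addrC addrA.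
rewrite (hnorm_sqrD Hx H2c) (hnorm_sqrD Hsf Hct) !hnormZ// hnorm_theta hnorm_seq1.
rewrite (hdotZr _ Ht Hsf) (hdotZr _ H1 Hx) hdot_seq1r -/c.
have -> : (shift f + - c *: theta) 0%N = 0 :> C.
  by rewrite -[LHS]/(0 + - c * theta 0%N) theta0 mulr0 addr0.
rewrite mulr0 /= mulr0 addr0 hnorm_shift// normcN normcM !mulr1 exprMn.
have -> : Re ((- c)^*%C * c) = - normc c ^+ 2.
  by rewrite sqr_normcE; case: (c) => x y /=; ring.
by move: (normc c ^+ 2) (normc v ^+ 2) (hnorm f ^+ 2) => x y u; ring.
Qed.

Hypothesis v1 : normc v < 1.

Let vv : 0 < 1 - normc v ^+ 2. Proof. by rewrite subr_gt0; exact: normc_sqr_lt1. Qed.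

Lemma hnorm_model_shift_le f : K f -> hnorm (model_shift f) <= hnorm f.
Proof.
move=> Kf; rewrite -(@ler_pXn2r _ 2) ?nnegrE ?hnorm_ge0// hnorm_model_shift//.
by rewrite gerBl mulr_ge0 ?sqr_ge0// ltW.
Qed.

Lemma theta_sub_v_le2 : hnorm (theta - v *: seq1) <= 2.
Proof.
apply: le_trans (le_hnormB Ht (H2Z (a := v) H1)) _.
by rewrite hnormZ// hnorm_theta hnorm_seq1 mulr1 (_ : 2 = 1 + 1)// lerD2l ltW.
Qed.

Lemma model_shift_bijective_outside l : 1 < normc l -> bijective_below K model_shift l.
Proof.
apply: bijective_below_outside.
- exact: model_space_closed.
- exact: model_space_model_shift.
- exact: linear_model_shift.
- exact: hnorm_model_shift_le.
Qed.

Lemma model_shift_sub l f : model_shift f - l *: f =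
  (shift f - l *: f) - hdot (shift f) theta *: (theta - v *: seq1).
Proof. by rewrite /model_shift addrAC. Qed.

Lemma hdot_shift_sub l f : K f -> hdot (shift f) theta = hdot (shift f - l *: f) theta.
Proof.
move=> Kf; have Hf := HKf Kf.
by rewrite (hdotBl (H2_shift Hf) (H2Z (a := l) Hf) Ht) (hdotZl _ Hf Ht) (hdot_model_theta Kf) mulr0 subr0.
Qed.

Lemma model_space_divide F l : H2 F -> K (shift_adj F) -> normc l < 1 ->
  exists2 f, K f & shift f - l *: f = F - ev F l *: seq1.
Proof.
move=> HF KF l1; have [f Kf [fE _]] := divide_at model_space_closed model_space_shift_adj HF KF l1.
by exists f.
Qed.

Lemma bijective_disc l : normc l < 1 -> ev theta l != v -> bijective_below K model_shift l.
Proof.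
move=> l1 lv; have d0 : ev theta l - v != 0 by rewrite subr_eq0.
have cK := model_space_closed.
split.
  pose D := normc (ev theta l - v); have D0 : 0 < D by rewrite normc_gt0.
  pose kl := hnorm (kern l); have kl0 : 0 <= kl by exact: hnorm_ge0.
  (* [B] combines [(1 - |l|) |f| <= |z f - l f| <= |g| + 2 |c|] with [|c| <= (kl / D) |g|]. *)
  pose B := (1 + kl / D * 2) / (1 - normc l).
  have B0 : 0 < B.
    by rewrite divr_gt0 ?subr_gt0// ltr_wpDr// mulr_ge0// divr_ge0// ltW.
  exists B^-1; first by rewrite invr_gt0.
  move=> f Kf; rewrite ler_pdivrMl//; have Hf := HKf Kf.
  set g := model_shift f - l *: f; set c := hdot (shift f) theta.
  have Hg : H2 g.
    by apply: H2B; [exact/HKf/model_space_model_shift|exact: H2Z].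
  have gE : shift f - l *: f = g + c *: (theta - v *: seq1).
    by rewrite /g model_shift_sub -/c subrK.
  have Hc : H2 (c *: (theta - v *: seq1)) by exact: H2Z.
  (* The left side of [gE] vanishes at [l], which determines [c] from [g(l)]. *)
  have : 0 = ev g l + c * (ev theta l - v).
    rewrite -(ev_sub_seq1 v Ht l1) -(evZ c Htv l1) -(evD Hg Hc l1) -gE.
    by rewrite (ev_shift_subZ _ Hf l1) subrr mul0r.
  move=> /esym/eqP; rewrite addr_eq0 => /eqP egl.
  have cB : normc c <= kl / D * hnorm g.
    have := normc_ev_le Hg l1; rewrite egl normcN normcM -/D -/kl -ler_pdivlMr//.
    by move=> /le_trans; apply; rewrite [leRHS]mulrC mulrA lexx.
  have nf : hnorm f = hnorm (shift f) by rewrite hnorm_shift.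
  have : hnorm f - normc l * hnorm f <= hnorm g + normc c * 2.
    rewrite {1}nf -hnormZ//.
    apply: le_trans (le_hnorm_sub (H2_shift Hf) (H2Z (a := l) Hf)) _.
    rewrite gE; apply: le_trans (le_hnormD Hg Hc) _.
    by rewrite lerD2l hnormZ// ler_wpM2l ?normc_ge0//; exact: theta_sub_v_le2.
  rewrite -{1}(mul1r (hnorm f)) -mulrBl => h.
  rewrite /B mulrAC ler_pdivlMr ?subr_gt0// mulrC; apply: le_trans h _.
  rewrite mulrDl mul1r lerD2l mulrAC; apply: ler_wpM2r => //.
move=> g Kg; have Hg := HKf Kg.
pose c := - ev g l / (ev theta l - v).
pose F := g + c *: (theta - v *: seq1).
have Hc : H2 (c *: (theta - v *: seq1)) by exact: H2Z.
have HF : H2 F by exact: H2D.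
have KF : K (shift_adj F).
  have -> : shift_adj F = shift_adj g + c *: (shift_adj theta - v *: shift_adj seq1).
    by [].
  apply: closed_subspaceD => //; first exact: model_space_shift_adj.
  apply: closed_subspaceZ => //; apply: closed_subspaceB => //.
    exact: model_space_shift_adj_theta.
  by apply: closed_subspaceZ => //; apply: model_space_shift_adj; exact: model_space_seq1.
have F0 : ev F l = 0.
  rewrite (evD Hg Hc l1) (evZ c Htv l1) (ev_sub_seq1 v Ht l1) /c.
  by rewrite mulNr mulNr divfK// subrr.
have [f Kf] := model_space_divide HF KF l1; rewrite F0 scale0r subr0 => fE.
exists f => //; rewrite model_shift_sub (hdot_shift_sub l Kf) fE.
(* The [c] chosen to make [F] vanish at [l] is also the coefficient subtracted by [model_shift],
   because [g] and the constants are orthogonal to [theta]. *)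
have -> : hdot F theta = c; last by rewrite addrK.
have Hv : H2 (v *: seq1 : nat -> C) by exact: H2Z.
rewrite (hdotDl Hg Hc Ht) (hdot_model_theta Kg) add0r (hdotZl _ Htv Ht) (hdotBl Ht Hv Ht).
rewrite (hdotZl _ H1 Ht) (hdot_model_theta model_space_seq1) mulr0 subr0 hdotff// hnorm_theta.
by rewrite expr1n mulr1.
Qed.

Lemma not_bijective_disc l : normc l < 1 -> ev theta l = v -> ~ bijective_below K model_shift l.
Proof.
move=> l1 lv [[e e0 lb] _].
have [f Kf] := model_space_divide Ht model_space_shift_adj_theta l1; rewrite lv => fE.
have Hf := HKf Kf; have Hv : H2 (v *: seq1 : nat -> C) by exact: H2Z.
have := lb f Kf; rewrite model_shift_sub (hdot_shift_sub l Kf) fE.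
have -> : hdot (theta - v *: seq1) theta = 1.
  rewrite (hdotBl Ht Hv Ht) (hdotZl _ H1 Ht) (hdot_model_theta model_space_seq1).
  by rewrite mulr0 subr0 hdotff// hnorm_theta expr1n.
rewrite scale1r subrr hnorm0 pmulr_rle0// => h.
have f0 : f = 0 by apply: hnorm_eq0 => //; apply/eqP; rewrite eq_le h hnorm_ge0.
(* The eigenvector is not 0: otherwise [theta] would be the constant [v], hence 0 by its value at 0,
   against norm 1. *)
have tv : theta = v *: seq1.
  apply/eqP; rewrite -subr_eq0 -fE f0 scaler0 subr0; apply/eqP.
  by apply/funext => -[].
have v0 : v = 0.
  by have := theta0; rewrite tv -[LHS]/(v * 1) mulr1.
have := hnorm_theta; rewrite tv v0 scale0r hnorm0 => /eqP.
by rewrite eq_sym oner_eq0.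
Qed.

(** If [model_shift f - l f] is small relative to [f], then [model_shift] nearly preserves the norm
    of [f]. As [|v| < 1], the defect identity forces [c = <z f, theta>] to be small, so [z f - l f]
    is small as well. *)
Lemma bijective_circle l : normc l = 1 ->
  (exists2 e : R, 0 < e & forall f, K f -> e * hnorm f <= hnorm (shift f - l *: f)) ->
  bijective_below K model_shift l.
Proof.
move=> l1 [e e0 lb].
apply: bijective_below_circle => //.
- exact: model_space_closed.
- exact: model_space_model_shift.
- exact: linear_model_shift.
- exact: hnorm_model_shift_le.
pose V := 1 - normc v ^+ 2.
(* [d <= e / 2] yields [|c| >= e n / 4]; then [V (e n / 4)^2 <= 2 n |g| < 2 n (d n)], which
   [d <= e^2 V / 32] makes impossible. *)
pose d := Num.min (e / 2) (e ^+ 2 * V / 32).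
have V0 : 0 < V by exact: vv.
have d0 : 0 < d by rewrite lt_min divr_gt0//= divr_gt0// mulr_gt0// exprn_gt0.
exists d => // f Kf; rewrite leNgt; apply/negP => hlt.
have Hf := HKf Kf; have HV := HKf (model_space_model_shift Kf).
set n := hnorm f in hlt; set c := hdot (shift f) theta.
have n0 : 0 < n.
  rewrite lt_neqAle hnorm_ge0 andbT eq_sym; apply/eqP => n0.
  by move: hlt; rewrite n0 mulr0 ltNge hnorm_ge0.
set g := model_shift f - l *: f in hlt; have Hg : H2 g by apply: H2B => //; exact: H2Z.
have h1 : n - hnorm (model_shift f) <= hnorm g.
  have -> : n = hnorm (l *: f) by rewrite hnormZ// l1 mul1r.
  by rewrite /g (hnormBC HV (H2Z (a := l) Hf)); exact: le_hnorm_sub (H2Z (a := l) Hf) HV.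
have h2 : V * normc c ^+ 2 <= 2 * n * hnorm g.
  have := hnorm_model_shift Kf; rewrite -/c -/V -/n => h.
  have -> : V * normc c ^+ 2 = (n - hnorm (model_shift f)) * (n + hnorm (model_shift f)).
    by rewrite -subr_sqr h opprB addrC subrK.
  have := hnorm_model_shift_le Kf; rewrite -/n => hn.
  rewrite [leLHS]mulrC; apply: ler_pM => //; first by rewrite addr_ge0 ?hnorm_ge0.
    by rewrite subr_ge0.
  by rewrite mulr_natl [leRHS]mulr2n lerD2l.
have h3 : e * n <= hnorm g + 2 * normc c.
  apply: le_trans (lb f Kf) _.
  have -> : shift f - l *: f = g + c *: (theta - v *: seq1).
    by rewrite /g model_shift_sub -/c subrK.
  apply: le_trans (le_hnormD Hg (H2Z (a := c) Htv)) _.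
  by rewrite lerD2l hnormZ// mulrC ler_wpM2r ?normc_ge0//; exact: theta_sub_v_le2.
have de : d <= e / 2 by rewrite ge_min lexx.
have dV : d <= e ^+ 2 * V / 32 by rewrite ge_min lexx orbT.
have h4 : e * n / 4 <= normc c.
  have : d * n <= e / 2 * n by rewrite ler_wpM2r// ltW.
  have -> : e / 2 * n = e * n / 2 by ring.
  move: (normc c) (hnorm g) (d * n) (e * n) h3 hlt => x y z u; lra.
have h5 : (e * n / 4) ^+ 2 <= normc c ^+ 2.
  by rewrite ler_pXn2r ?nnegrE ?normc_ge0// divr_ge0// mulr_ge0// ltW.
have h6 : V * (e * n / 4) ^+ 2 <= V * normc c ^+ 2 by rewrite ler_wpM2l// ltW.
have h7 : 2 * n * hnorm g < 2 * n * (e ^+ 2 * V / 32 * n).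
  rewrite ltr_pM2l ?mulr_gt0//; apply: lt_le_trans hlt _.
  by rewrite ler_wpM2r// ltW.
have := le_lt_trans (le_trans h6 h2) h7.
rewrite (_ : V * _ ^+ 2 = 2 * n * (e ^+ 2 * V / 32 * n)) ?ltxx//.
by field.
Qed.

(** Reproducing kernel of the model space, [(1 - conj(theta(w)) theta(z)) / (1 - conj(w) z)]. *)
Definition model_kern w := kern w - (ev theta w)^*%C *: hmul theta (kern w).

Lemma model_space_kern w : normc w < 1 -> K (model_kern w) /\
  hnorm (model_kern w) ^+ 2 = (1 - normc (ev theta w) ^+ 2) / (1 - normc w ^+ 2) /\
  (forall f, K f -> hdot f (model_kern w) = ev f w).
Proof.
move=> w1; have Hk := H2_kern w1; have Htk := Htm Hk.
set c := ev theta w.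
have Hctk : H2 (c^*%C *: hmul theta (kern w)) by exact: H2Z.
have Km : K (model_kern w).
  split; first exact: H2B.
  move=> g Hg; have Htg := Htm Hg.
  rewrite hdotBl// (hdotZl _ Htk Htg) hdot_inner// (hdotC Hk Htg) (hdotC Hk Hg).
  by rewrite !hdot_kern (ev_hmul Ht Hg w1) rmorphM/= subrr.
have rep f : K f -> hdot f (model_kern w) = ev f w.
  move=> Kf; have Hf := HKf Kf.
  rewrite hdotBr// (hdotZr _ Htk Hf) hdot_kern.
  by case: Kf => _ ->//; rewrite mulr0 subr0.
split=> //; split=> //; apply: (@complexI R).
rewrite -hdotff; last exact: HKf.
rewrite (rep _ Km) (evB Hk Hctk w1) (evZ _ Htk w1) (ev_hmul Ht Hk w1) -/c.
rewrite -(hdot_kern (kern w)) hdotff// hnorm_kern// mulrA [c^*%C * c]mulrC mul_conjc.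
by rewrite -[X in X - _]mul1r -mulrBl -(rmorph1 (real_complex R)) -rmorphB -rmorphM.
Qed.

Lemma not_bijective_circle l : normc l = 1 ->
  (forall d : R, 0 < d -> exists w, [/\ normc w < 1, normc (w - l) < d &
     normc (ev theta w) <= 2^-1]) ->
  ~ bijective_below K model_shift l.
Proof.
move=> l1 hl [[e e0 lb] _].
(* [d <= e / 8] absorbs the term [3 d |k|] and leaves [e |k| <= 12]; the second bound makes
   [1 - |w|^2] so small that [|k|^2 >= (3/4) / (1 - |w|^2)] violates this. *)
pose d := Num.min (e / 8) (e ^+ 2 / 32 / 16).
have d0 : 0 < d by rewrite lt_min !divr_gt0// exprn_gt0.
have [w [w1 wl tw]] := hl d d0.
have [Kk [nk _]] := model_space_kern w1.
have Hk := H2_kern w1; have Htk := Htm Hk.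
set k := model_kern w in Kk nk; have Hkk := HKf Kk.
set c := ev theta w in tw nk.
(* [(z - w) / (1 - conj(w) z)] is a Blaschke factor, of norm 1. Hence [(z - w) k] stays bounded
   while the norm of [k] blows up as [w] approaches the circle. *)
have b1 : hnorm (shift (kern w) - w *: kern w) = 1.
  apply/eqP; rewrite -(@eqrXn2 _ 2) ?hnorm_ge0// -scaleNr; apply/eqP.
  rewrite (hnorm_sqrD (H2_shift Hk) (H2Z (a := - w) Hk)) hnorm_shift// hnormZ// normcN exprMn.
  rewrite (hdotZr _ Hk (H2_shift Hk)) hdot_kern (ev_shift Hk w1) -(hdot_kern (kern w)) hdotff//.
  rewrite (mulrA ((- w)^*%C)) Re_mulR hnorm_kern//.
  have -> : Re ((- w)^*%C * w) = - normc w ^+ 2.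
    by rewrite sqr_normcE; case: (w) => x y /=; ring.
  have := normc_sqr_lt1 w1; move: (normc w ^+ 2) => x x1.
  by field; rewrite subr_eq0 gt_eqF.
have Hb : H2 (shift (kern w) - w *: kern w) by apply: H2B; [exact: H2_shift|exact: H2Z].
have b2 : hnorm (shift k - w *: k) <= 2.
  have -> : shift k - w *: k = (shift (kern w) - w *: kern w) -
      c^*%C *: hmul theta (shift (kern w) - w *: kern w).
    rewrite /k /model_kern -/c shift_sub shiftZ hmulBr hmul_shiftr hmulZr !scalerBr.
    by rewrite !scalerA [w * _]mulrC !opprD !opprK addrACA.
  apply: le_trans (le_hnormB Hb (H2Z (a := c^*%C) (Htm Hb))) _.
  rewrite (hnormZ _ (Htm Hb)) hnorm_inner// b1 normc_conj mulr1.
  by apply: le_trans (_ : 1 + 2^-1 <= _); [rewrite lerD2l|lra].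
have b3 : hnorm (shift k - l *: k) <= 2 + d * hnorm k.
  have -> : shift k - l *: k = (shift k - w *: k) + (w - l) *: k.
    by rewrite scalerBl addrA subrK.
  apply: le_trans (le_hnormD _ (H2Z (a := w - l) Hkk)) _.
    by apply: H2B; [exact: H2_shift|exact: H2Z].
  by rewrite lerD// hnormZ// ler_wpM2r ?hnorm_ge0// ltW.
have Hs : H2 (shift k - l *: k) by apply: H2B; [exact: H2_shift|exact: H2Z].
have b4 : hnorm (model_shift k - l *: k) <= 3 * hnorm (shift k - l *: k).
  rewrite model_shift_sub; apply: le_trans (le_hnormB Hs (H2Z (a := hdot (shift k) theta) Htv)) _.
  rewrite hnormZ// (_ : 3 = 1 + 2); last by ring.
  rewrite mulrDl mul1r lerD2l mulrC ler_pM ?hnorm_ge0 ?normc_ge0 ?theta_sub_v_le2//.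
  rewrite (hdot_shift_sub l Kk); apply: le_trans (hdot_CauchySchwarz Hs Ht) _.
  by rewrite hnorm_theta mulr1.
have b5 : e * hnorm k <= 6 + 3 * d * hnorm k.
  apply: le_trans (lb k Kk) _; apply: le_trans b4 _.
  apply: le_trans (ler_wpM2l _ b3) _ => //.
  by rewrite mulrDr mulrA lerD2r; lra.
have de : d <= e / 8 by rewrite ge_min lexx.
have dV : d <= e ^+ 2 / 32 / 16 by rewrite ge_min lexx orbT.
have k0 : 0 <= hnorm k by exact: hnorm_ge0.
have b6 : e * hnorm k <= 12.
  have : 3 * d * hnorm k <= 3 * (e / 8) * hnorm k by rewrite ler_wpM2r// ler_wpM2l.
  have -> : 3 * (e / 8) * hnorm k = (e * hnorm k) * (3 / 8) by ring.
  move: (e * hnorm k) (3 * d * hnorm k) b5 => x y; lra.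
have b7 : e ^+ 2 * hnorm k ^+ 2 <= 12 * 12.
  rewrite -exprMn -expr2.
  by rewrite ler_pXn2r ?nnegrE// mulr_ge0// ltW.
have b8 : 1 - normc w ^+ 2 <= 2 * d.
  have : 1 - normc w <= d.
    rewrite -l1; apply: le_trans (le_normc_sub _ _) _; rewrite normcBC; exact: ltW.
  have := normc_ge0 w; move: (normc w) w1 => x x1 x0 h; nra.
have b9 : 3 / 4 <= 1 - normc c ^+ 2.
  have := normc_ge0 c; move: (normc c) tw => x x1 x0; nra.
have w2 : 0 < 1 - normc w ^+ 2 by rewrite subr_gt0; exact: normc_sqr_lt1.
move: b7; rewrite nk mulrA ler_pdivrMr// => b7.
have b10 : e ^+ 2 * (3 / 4) <= 12 * 12 * (2 * (e ^+ 2 / 32 / 16)).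
  apply: le_trans (_ : e ^+ 2 * (1 - normc c ^+ 2) <= _).
    by rewrite ler_wpM2l// sqr_ge0.
  apply: le_trans b7 _; rewrite ler_wpM2l//; apply: le_trans b8 _.
  by rewrite ler_wpM2l.
have := exprn_gt0 2 e0; move: (e ^+ 2) b10 => x h1 h2; lra.
Qed.

End ModelOperator.

(** * Maximum principle *)

Section MaximumPrinciple.
Context {R : realType}.
Local Notation C := (R[i]^o).
Local Notation Re := complex.Re.
Local Notation Im := complex.Im.
Local Notation mu := (@lebesgue_measure R).
Implicit Types (f g theta : nat -> C) (w z l c : C) (s r e : R).

Lemma bernoulli (x : R) n : 0 <= x <= 1 -> 1 - n%:R * (1 - x) <= x ^+ n.
Proof.
move=> /andP[x0 x1]; elim: n => [|n IH]; first by rewrite mul0r subr0.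
rewrite exprS -natr1; have : x * (1 - n%:R * (1 - x)) <= x * x ^+ n by rewrite ler_wpM2l.
have : 0 <= n%:R * (1 - x) * (1 - x) by rewrite !mulr_ge0 ?subr_ge0.
move: (x * x ^+ n) (n%:R : R) => y m; nra.
Qed.

Lemma hnorm_dil_z f z : H2 f -> normc z <= 1 -> H2 (dil f z) /\ hnorm (dil f z) <= hnorm f.
Proof.
move=> Hf z1; apply: hnorm_le; first exact: hnorm_ge0.
move=> n; apply: le_trans (series_le_hnorm n Hf).
apply: ler_sum => k _; rewrite /dil normcM exprMn ler_piMr ?sqr_ge0//.
by rewrite normcX -exprM exprn_ile1 ?normc_ge0.
Qed.

(** The first [N] coefficients carry the squared norm up to [e / 2], and for [n < N] Bernoulli gives
    [|z|^(2 n) >= 1 - m t] when [|z| >= 1 - t]. The bound is uniform in the argument of [z]. *)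
Lemma hnorm_dil_lower f (e : R) : H2 f -> 0 < e ->
  exists2 r1, 0 <= r1 < 1 & forall z, r1 <= normc z < 1 ->
    hnorm f ^+ 2 - e <= hnorm (dil f z) ^+ 2.
Proof.
move=> Hf e0; have e2 : 0 < e / 2 by rewrite divr_gt0.
have /cvgrPdist_lt/(_ _ e2)[N _ HN] := hnorm_sqr_cvg Hf.
have {}HN : hnorm f ^+ 2 - e / 2 <= series (fun n => normc (f n) ^+ 2) N.
  have := HN N (leqnn N); rewrite ger0_norm ?subr_ge0 ?series_le_hnorm// => /ltW h.
  by rewrite lerBlDr -lerBlDl.
pose B := hnorm f ^+ 2 + 1.
have B0 : 0 < B by rewrite ltr_wpDl ?sqr_ge0.
pose m : R := (N.*2.+1)%:R; have m0 : 0 < m by rewrite ltr0n.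
pose t := Num.min 1 (e / 2 / (m * B)).
have t0 : 0 < t by rewrite lt_min ltr01 divr_gt0// mulr_gt0.
exists (1 - t); first by rewrite subr_ge0 ge_min lexx gtrBl.
move=> z /andP[z0 z1]; have zn := normc_ge0 z.
have [Hd _] := hnorm_dil_z Hf (ltW z1).
apply: le_trans (series_le_hnorm N Hd).
have zN n : (n < N)%N -> 1 - m * t <= (normc z ^+ n) ^+ 2.
  move=> nN; rewrite -exprM; apply: le_trans (bernoulli _ _); last by rewrite zn ltW.
  rewrite lerD2l lerN2 ler_pM ?subr_ge0 ?(ltW z1)//; last by rewrite lerBlDr -lerBlDl.
  by rewrite ler_nat muln2 leqW// leq_double ltnW.
have : (1 - m * t) * series (fun n => normc (f n) ^+ 2) N <=
    series (fun n => normc (dil f z n) ^+ 2) N.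
  rewrite /series/= mulr_sumr !big_nat; apply: ler_sum => n /andP[_ nN].
  by rewrite /dil normcM exprMn mulrC ler_wpM2l ?sqr_ge0// normcX zN.
apply: le_trans; rewrite mulrBl mul1r.
have : m * t * series (fun n => normc (f n) ^+ 2) N <= e / 2.
  apply: le_trans (_ : m * t * B <= _).
    rewrite ler_wpM2l ?mulr_ge0 ?(ltW m0) ?(ltW t0)//.
    by apply: le_trans (series_le_hnorm N Hf) _; rewrite lerDl.
  apply: le_trans (_ : m * (e / 2 / (m * B)) * B <= _).
    by rewrite ler_wpM2r ?(ltW B0)// ler_wpM2l ?(ltW m0)// ge_min lexx orbT.
  by rewrite le_eqVlt; apply/orP; left; apply/eqP; field; rewrite !gt_eqF.
move: HN; move: (series _ N) (m * t * _) (hnorm f ^+ 2) => x y u; lra.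
Qed.

Lemma hnorm_kern_le (rho : R) z : 0 <= rho < 1 -> normc z <= rho ->
  hnorm (kern z) <= (1 - rho)^-1.
Proof.
move=> /andP[r0 r1] zr; have z1 := le_lt_trans zr r1.
have zn := normc_ge0 z.
rewrite -(@ler_pXn2r _ 2) ?nnegrE ?hnorm_ge0 ?invr_ge0 ?subr_ge0 ?(ltW r1)//.
rewrite hnorm_kern// exprVn lef_pV2 ?posrE ?exprn_gt0 ?subr_gt0 ?normc_sqr_lt1//.
nra.
Qed.

Lemma divide_at_H2 f w : H2 f -> normc w < 1 -> exists2 f1, H2 f1 &
  shift f1 - w *: f1 = f - ev f w *: seq1 /\ hnorm f1 <= hnorm f / (1 - normc w).
Proof.
move=> Hf; apply: (divide_at (@H2_closed_subspace R)) => //.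
  by move=> g; exact: H2_shift_adj.
exact: H2_shift_adj.
Qed.

(** Three successive divisions by [z - w] stand in for Taylor's formula. Each costs a factor
    [1 / (1 - rho)] in norm and the final evaluation at [z] costs one more, whence the exponents 2
    and 4. *)
Lemma ev_taylor f w (rho : R) : H2 f -> 0 <= rho < 1 -> normc w <= rho ->
  exists a b : C, forall z, normc z <= rho ->
    normc (ev f z - ev f w) <= hnorm f / (1 - rho) ^+ 2 * normc (z - w) /\
    normc (ev f z - (ev f w + (z - w) * a + (z - w) ^+ 2 * b)) <=
      hnorm f / (1 - rho) ^+ 4 * normc (z - w) ^+ 3.
Proof.
move=> Hf r01 wr; have /andP[r0 r1] := r01; have w1 := le_lt_trans wr r1.
have [f1 Hf1 [e1 n1]] := divide_at_H2 Hf w1.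
have [f2 Hf2 [e2 n2]] := divide_at_H2 Hf1 w1.
have [f3 Hf3 [e3 n3]] := divide_at_H2 Hf2 w1.
have d0 : 0 < 1 - rho by rewrite subr_gt0.
have dw : (1 - normc w)^-1 <= (1 - rho)^-1.
  by rewrite lef_pV2 ?posrE ?subr_gt0// lerD2l lerN2.
have st (x y : R) : 0 <= x -> y <= x / (1 - normc w) -> y <= x / (1 - rho).
  by move=> x0 /le_trans; apply; rewrite ler_wpM2l.
have {}n1 : hnorm f1 <= hnorm f / (1 - rho) by apply: st n1; exact: hnorm_ge0.
have {}n2 : hnorm f2 <= hnorm f / (1 - rho) ^+ 2.
  apply: le_trans (st _ _ (hnorm_ge0 f1) n2) _.
  by rewrite expr2 invfM mulrA ler_wpM2r ?invr_ge0 ?(ltW d0).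
have {}n3 : hnorm f3 <= hnorm f / (1 - rho) ^+ 3.
  apply: le_trans (st _ _ (hnorm_ge0 f2) n3) _.
  by rewrite exprSr invfM mulrA ler_wpM2r ?invr_ge0 ?(ltW d0).
exists (ev f1 w), (ev f2 w) => z zr; have z1 := le_lt_trans zr r1.
have kz := hnorm_kern_le r01 zr.
have E1 := ev_divide Hf Hf1 w1 z1 e1.
have E2 := ev_divide Hf1 Hf2 w1 z1 e2.
have E3 := ev_divide Hf2 Hf3 w1 z1 e3.
split.
  rewrite E1 addrC addKr normcM mulrC ler_wpM2r ?normc_ge0//.
  apply: le_trans (normc_ev_le Hf1 z1) _.
  by rewrite expr2 invfM mulrA ler_pM ?hnorm_ge0.
have -> : ev f z - (ev f w + (z - w) * ev f1 w + (z - w) ^+ 2 * ev f2 w) =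
    (z - w) ^+ 3 * ev f3 z.
  rewrite E1 E2 E3; move: (ev f w) (ev f1 w) (ev f2 w) (ev f3 z) (z - w) => x1 x2 x3 x4 y.
  by ring.
rewrite normcM normcX mulrC ler_wpM2r ?exprn_ge0 ?normc_ge0//.
apply: le_trans (normc_ev_le Hf3 z1) _.
by rewrite (exprSr _ 3) invfM mulrA ler_pM ?hnorm_ge0.
Qed.

Lemma normc_i : normc ('i%C : C) = 1.
Proof. by rewrite /= expr0n/= add0r expr1n sqrtr1. Qed.

Lemma normc_add4 (x1 x2 x3 x4 : C) :
  normc (x1 + x2 + x3 + x4) <= normc x1 + normc x2 + normc x3 + normc x4.
Proof. by do 3 (apply: le_trans (le_normcD _ _) _; rewrite lerD2r). Qed.

(** At the points [w + i^k s] the terms of order 1 and 2 cancel, since both [i^k] and [i^(2k)] sum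
    to 0 over [k < 4]; only cubic remainders survive. *)
Lemma ev_mean4 f w (s : C) (rho : R) : H2 f -> 0 <= rho < 1 -> normc w + normc s <= rho ->
  normc (ev f (w + s) + ev f (w + 'i%C * s) + ev f (w - s) + ev f (w - 'i%C * s) - 4 * ev f w)
  <= 4 * (hnorm f / (1 - rho) ^+ 4 * normc s ^+ 3).
Proof.
move=> Hf r01 ws; have wr : normc w <= rho by apply: le_trans ws; rewrite lerDl normc_ge0.
have [a [b ab]] := ev_taylor Hf r01 wr.
set B := hnorm f / (1 - rho) ^+ 4 * normc s ^+ 3.
pose E (u : C) := ev f (w + u) - (ev f w + u * a + u ^+ 2 * b).
have EB u : normc u = normc s -> normc (E u) <= B.
  move=> us; have ur : normc (w + u) <= rho by apply: le_trans (le_normcD _ _) _; rewrite us.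
  by have [_] := ab _ ur; rewrite /E [w + u - w]addrC addKr us.
have Ei : normc ('i%C * s) = normc s by rewrite normcM normc_i mul1r.
have -> : ev f (w + s) + ev f (w + 'i%C * s) + ev f (w - s) + ev f (w - 'i%C * s) - 4 * ev f w =
    E s + E ('i%C * s) + E (- s) + E (- ('i%C * s)).
  rewrite /E; move: (ev f (w + s)) (ev f (w + 'i%C * s)) (ev f (w - s)) (ev f (w - 'i%C * s)) (ev f w).
  move=> x1 x2 x3 x4 x.
  have i2 : 'i%C * 'i%C = -1 :> C by rewrite -expr2 sqr_i.
  rewrite !sqrrN !exprMn sqr_i; ring.
apply: le_trans (normc_add4 _ _ _ _) _.
rewrite (_ : 4 * B = B + B + B + B); last by ring.
apply: lerD (EB _ (etrans (normcN _) Ei)); apply: lerD (EB _ (normcN s)).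
exact: lerD (EB s erefl) (EB _ Ei).
Qed.

(** Second order expansion of [1 / b] about [a], written as a polynomial in [b] with its remainder.
    Means of [1 / theta] thus reduce to means of [theta] and [theta^2], which are in [H2]. *)
Lemma inv_expand (a b : C) : a != 0 -> b != 0 ->
  b^-1 = 3 / a - 3 * b / a ^+ 2 + b ^+ 2 / a ^+ 3 - (b - a) ^+ 3 / (a ^+ 3 * b).
Proof. by move=> a0 b0; field; rewrite a0 b0. Qed.

Lemma inv_pow4_le (e x y : R) : 0 < e -> e <= x -> e <= y -> (x ^+ 3 * y)^-1 <= e ^- 4.
Proof.
move=> e0 ex ey; have x0 := lt_le_trans e0 ex; have y0 := lt_le_trans e0 ey.
rewrite lef_pV2 ?posrE ?mulr_gt0 ?exprn_gt0// (exprSr e 3).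
by rewrite ler_pM ?exprn_ge0 ?(ltW e0)// ler_pXn2r ?nnegrE ?(ltW e0) ?(ltW x0).
Qed.

(** Up to cubic errors, [4 / theta(w)] is the sum of the four values of [1 / theta]; taking moduli
    gives a discrete form of subharmonicity of [1 / |theta|]. [X] comes from [ev_mean4] for [theta]
    and [theta^2], and [Y] from the cube of the Lipschitz bound in [ev_taylor]. *)
Lemma inv_mean4 theta w (s : C) (rho e : R) : inner_function theta -> 0 < e ->
  0 <= rho < 1 -> normc w + normc s <= rho ->
  (forall u, u \in [:: 0; s; 'i%C * s; - s; - ('i%C * s)] -> e <= normc (ev theta (w + u))) ->
  4 / normc (ev theta w) <= (normc (ev theta (w + s)))^-1 + (normc (ev theta (w + 'i%C * s)))^-1 +
    (normc (ev theta (w - s)))^-1 + (normc (ev theta (w - 'i%C * s)))^-1 +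
    4 * (4 / (1 - rho) ^+ 4 / e ^+ 3 + (1 - rho) ^- 6 / e ^+ 4) * normc s ^+ 3.
Proof.
move=> it e0 r01 ws be; have Ht : H2 theta by case: it.
have Htt := H2_inner_hmul it Ht; have wr : normc w <= rho.
  by apply: le_trans ws; rewrite lerDl normc_ge0.
have nt : hnorm theta = 1 by rewrite -{1}(hmul1r theta) hnorm_inner ?hnorm_seq1//; exact: H2_seq1.
have ntt : hnorm (hmul theta theta) = 1 by rewrite hnorm_inner.
have /andP[r0 r1] := r01; have w1 := le_lt_trans wr r1.
have d0 : 0 < 1 - rho by rewrite subr_gt0.
set a := ev theta w.
have ae : e <= normc a by have := be 0; rewrite addr0 inE eqxx; exact.
have a0 : a != 0 by rewrite -normc_gt0 (lt_le_trans e0).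
have e1 : e <= 1 by apply: le_trans ae _; exact: ev_inner_le1.
pose X := (1 - rho) ^- 4 * normc s ^+ 3; pose Y := (1 - rho) ^- 6 * normc s ^+ 3.
have X0 : 0 <= X by rewrite mulr_ge0 ?invr_ge0 ?exprn_ge0 ?normc_ge0 ?(ltW d0).
have Ei : normc ('i%C * s) = normc s by rewrite normcM normc_i mul1r.
have [c1 [c2 tay]] := ev_taylor Ht r01 wr.
have key u : normc u = normc s -> e <= normc (ev theta (w + u)) ->
    [/\ ev theta (w + u) != 0, ev (hmul theta theta) (w + u) = ev theta (w + u) ^+ 2 &
    normc ((ev theta (w + u) - a) ^+ 3 / (a ^+ 3 * ev theta (w + u))) <= Y / e ^+ 4].
  move=> us eu; have ur : normc (w + u) <= rho by apply: le_trans (le_normcD _ _) _; rewrite us.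
  have u1 := le_lt_trans ur r1; split.
  - by rewrite -normc_gt0 (lt_le_trans e0).
  - by rewrite (ev_hmul Ht Ht u1) expr2.
  have := (tay _ ur).1; rewrite nt div1r [w + u - w]addrC addKr us => h.
  rewrite normcM normcX normcV normcM normcX -/a.
  apply: ler_pM; rewrite ?exprn_ge0 ?normc_ge0 ?invr_ge0 ?mulr_ge0 ?exprn_ge0 ?normc_ge0//.
    apply: le_trans (_ : ((1 - rho) ^- 2 * normc s) ^+ 3 <= _).
      by rewrite ler_pXn2r ?nnegrE ?mulr_ge0 ?normc_ge0 ?invr_ge0 ?exprn_ge0 ?(ltW d0).
    by rewrite exprMn exprVn -exprM.
  exact: inv_pow4_le.
have m1 := ev_mean4 Ht r01 ws; have m2 := ev_mean4 Htt r01 ws.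
rewrite nt div1r -/X -/a in m1; rewrite ntt div1r -/X (ev_hmul Ht Ht w1) -/a -expr2 in m2.
have b1 := be s; have b2 := be ('i%C * s); have b3 := be (- s); have b4 := be (- ('i%C * s)).
rewrite !inE !eqxx ?orbT in b1 b2 b3 b4.
have [n1 q1 k1] := key s erefl (b1 erefl).
have [n2 q2 k2] := key _ Ei (b2 erefl).
have [n3 q3 k3] := key _ (normcN s) (b3 erefl).
have [n4 q4 k4] := key _ (etrans (normcN _) Ei) (b4 erefl).
rewrite q1 q2 q3 q4 in m2.
move: n1 n2 n3 n4 m1 m2 k1 k2 k3 k4.
move: (ev theta (w + s)) (ev theta (w + 'i%C * s)) (ev theta (w - s)) (ev theta (w - 'i%C * s)).
move=> x1 x2 x3 x4 n1 n2 n3 n4 m1 m2.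
set t1 := (x1 - a) ^+ 3 / _; set t2 := (x2 - a) ^+ 3 / _.
set t3 := (x3 - a) ^+ 3 / _; set t4 := (x4 - a) ^+ 3 / _ => k1 k2 k3 k4.
have S1E : 4 / a = (x1^-1 + x2^-1 + x3^-1 + x4^-1) +
    (3 * (x1 + x2 + x3 + x4 - 4 * a) / a ^+ 2 - (x1 ^+ 2 + x2 ^+ 2 + x3 ^+ 2 + x4 ^+ 2 - 4 * a ^+ 2) / a ^+ 3) +
    (t1 + t2 + t3 + t4).
  rewrite (inv_expand a0 n1) (inv_expand a0 n2) (inv_expand a0 n3) (inv_expand a0 n4).
  rewrite -/t1 -/t2 -/t3 -/t4; move: t1 t2 t3 t4 {k1 k2 k3 k4} => t1 t2 t3 t4.
  by field.
have n4a : 4 / normc a = normc (4 / a).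
  by rewrite normcM normcV -[4 in RHS](@rmorph_nat _ _ (real_complex R) 4) normcR ger0_norm.
rewrite n4a S1E; apply: le_trans (le_normcD _ _) _.
have t4B : normc (t1 + t2 + t3 + t4) <= 4 * (Y / e ^+ 4).
  apply: le_trans (normc_add4 _ _ _ _) _.
  rewrite (_ : 4 * (Y / e ^+ 4) = Y / e ^+ 4 + Y / e ^+ 4 + Y / e ^+ 4 + Y / e ^+ 4); last by ring.
  by do 3 (apply: lerD => //).
have aeX n : normc a ^- n <= e ^- n.
  have na := lt_le_trans e0 ae.
  rewrite lef_pV2 ?posrE ?exprn_gt0//; case: n => // n.
  by rewrite ler_pXn2r ?nnegrE ?normc_ge0 ?(ltW e0).
have p1 : normc (3 * (x1 + x2 + x3 + x4 - 4 * a) / a ^+ 2) <= 3 * (4 * X) * e ^- 2.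
  rewrite !normcM normcV normcX -[3](@rmorph_nat _ _ (real_complex R) 3) normcR ger0_norm//.
  by rewrite ler_pM ?mulr_ge0 ?normc_ge0 ?invr_ge0 ?exprn_ge0 ?normc_ge0// ler_wpM2l.
have p2 : normc ((x1 ^+ 2 + x2 ^+ 2 + x3 ^+ 2 + x4 ^+ 2 - 4 * a ^+ 2) / a ^+ 3) <= 4 * X * e ^- 3.
  rewrite normcM normcV normcX.
  by rewrite ler_pM ?mulr_ge0 ?normc_ge0 ?invr_ge0 ?exprn_ge0 ?normc_ge0.
have p12 : 3 * (4 * X) * e ^- 2 <= 3 * (4 * X) * e ^- 3.
  apply: ler_wpM2l; first by apply: mulr_ge0 => //; apply: mulr_ge0.
  rewrite lef_pV2 ?posrE ?exprn_gt0// (exprS _ 2).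
  by apply: ler_piMl => //; exact: sqr_ge0.
have sB : normc (x1^-1 + x2^-1 + x3^-1 + x4^-1) <=
    (normc x1)^-1 + (normc x2)^-1 + (normc x3)^-1 + (normc x4)^-1.
  by apply: le_trans (normc_add4 _ _ _ _) _; rewrite !normcV.
have -> : 4 * (4 / (1 - rho) ^+ 4 / e ^+ 3 + (1 - rho) ^- 6 / e ^+ 4) * normc s ^+ 3 =
   (3 * (4 * X) * e ^- 3 + 4 * X * e ^- 3) + 4 * (Y / e ^+ 4).
  by rewrite /X /Y; ring.
rewrite [leRHS]addrA; apply: lerD t4B; apply: le_trans (le_normcD _ _) _; apply: (lerD sB).
apply: le_trans (le_normcB _ _) _; apply: lerD p2; exact: le_trans p1 p12.
Qed.

Lemma normc_sqr_add4 z (s : R) :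
  normc (z + s%:C%C) ^+ 2 + normc (z + 'i%C * s%:C%C) ^+ 2 + normc (z - s%:C%C) ^+ 2 +
  normc (z - 'i%C * s%:C%C) ^+ 2 = 4 * normc z ^+ 2 + 4 * s ^+ 2.
Proof. by case: z => x y; rewrite !sqr_normcE /=; ring. Qed.

(* Adding [k |z|^2] to [P] makes the four-point inequality strict by [4 k s^2],
   which beats the error [C0 s^3]. *)
Lemma max_principle4 (Om I : set C) (P : C -> R) (eta B C0 s1 : R) :
  0 <= C0 -> 0 < s1 ->
  (forall z, Om z -> P z <= B /\ normc z <= 1) ->
  (forall z, Om z -> ~ I z -> P z <= eta) ->
  (forall z (s : R), I z -> 0 < s < s1 ->
    [/\ Om (z + s%:C%C), Om (z + 'i%C * s%:C%C), Om (z - s%:C%C), Om (z - 'i%C * s%:C%C) &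
      4 * P z <= P (z + s%:C%C) + P (z + 'i%C * s%:C%C) + P (z - s%:C%C) +
        P (z - 'i%C * s%:C%C) + C0 * s ^+ 3]) ->
  forall z, Om z -> P z <= eta.
Proof.
move=> C00 s10 bd bdI mean z0 Oz0; rewrite leNgt; apply/negP => Pz0.
pose k := (P z0 - eta) / 2; have k0 : 0 < k by rewrite divr_gt0// subr_gt0.
pose Q z := P z + k * normc z ^+ 2.
pose A : set R := [set x | exists2 z, Om z & x = Q z].
have An : A (Q z0) by exists z0.
have zz z : Om z -> normc z ^+ 2 <= 1.
  by move=> /bd[_ z1]; rewrite expr_le1 ?normc_ge0.
have hA : has_sup A.
  split; first by exists (Q z0).
  exists (B + k) => _ [z Oz ->]; apply: lerD; first exact: (bd z Oz).1.
  by rewrite ler_piMr ?(ltW k0)// zz.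
have Qle z : Om z -> Q z <= sup A.
  by move=> Oz; apply: ub_le_sup; [exact: hA.2|exists z].
pose s := Num.min (s1 / 2) (k / (C0 + 1)).
have C1 : 0 < C0 + 1 by rewrite ltr_wpDl.
have s0 : 0 < s by rewrite lt_min (divr_gt0 s10 (ltr0Sn _ 1)) (divr_gt0 k0 C1).
have ss1 : s < s1 by rewrite gt_min ltr_pdivrMr// ltr_pMr// ltr1n.
have sC : C0 * s ^+ 3 <= k * s ^+ 2.
  rewrite (exprSr s 2) mulrCA [leRHS]mulrC; apply: ler_wpM2l; first exact: sqr_ge0.
  apply: (@le_trans _ _ ((C0 + 1) * s)); first by rewrite ler_pM2r// lerDl.
  by rewrite mulrC -ler_pdivlMr// ge_min lexx orbT.
(* The supremum of [Q] need not be attained. [e <= k] forces a near-maximizer into [I], because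
   [Q <= eta + k] off [I]; there the gain [4 k s^2 - C0 s^3 >= 3 k s^2] exceeds [4 e <= 2 k s^2]. *)
pose e := Num.min k (k * s ^+ 2 / 2).
have e0 : 0 < e by rewrite lt_min k0 divr_gt0// mulr_gt0 ?exprn_gt0.
have [_ [z Oz ->] Qz] := sup_adherent e0 hA.
have Qz0 : eta + 2 * k <= sup A.
  apply: le_trans (Qle _ Oz0); rewrite /Q.
  have : 0 <= k * normc z0 ^+ 2 by rewrite mulr_ge0 ?(ltW k0) ?sqr_ge0.
  by move: (k * _) => y; rewrite /k => ?; lra.
have ek : e <= k by rewrite ge_min lexx.
have eks : e <= k * s ^+ 2 / 2 by rewrite ge_min lexx orbT.
have [Iz|nIz] := pselect (I z); last first.
  have := bdI z Oz nIz; have := zz z Oz.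
  have : k * normc z ^+ 2 <= k by rewrite ler_piMr ?(ltW k0)// zz.
  by move: Qz; rewrite /Q; move: (k * _) (P z) (sup A) Qz0 => a b d; lra.
have sI : 0 < s < s1 by rewrite s0.
have [h1 h2 h3 h4 m] := mean z s Iz sI.
have := Qle _ h1; have := Qle _ h2; have := Qle _ h3; have := Qle _ h4.
have E := normc_sqr_add4 z s; move: E Qz m; rewrite /Q.
move: (normc (z + s%:C%C) ^+ 2) (normc (z + 'i%C * _) ^+ 2) (normc (z - _) ^+ 2) (normc (z - 'i%C * _) ^+ 2).
move: (normc z ^+ 2) (P (z + s%:C%C)) (P (z + 'i%C * _)) (P (z - s%:C%C)) (P (z - 'i%C * _)) (P z).
move=> n p1 p2 p3 p4 p n1 n2 n3 n4 E.
have {}E : k * n1 + k * n2 + k * n3 + k * n4 = 4 * (k * n) + 4 * (k * s ^+ 2).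
  by rewrite -!mulrDr E; ring.
have ks0 : 0 < k * s ^+ 2 by rewrite mulr_gt0 ?exprn_gt0.
clearbody e; move: E sC eks ks0.
move: (k * n1) (k * n2) (k * n3) (k * n4) (k * n) (k * s ^+ 2) (C0 * s ^+ 3) (sup A).
move=> {}n1 {}n2 {}n3 {}n4 {}n u t L; lra.
Qed.

Lemma le_Rintegral_continuous (f g : R -> R) (x y : R) : continuous f -> continuous g ->
  (forall t, x <= t <= y -> f t <= g t) ->
  \int[mu]_(t in `[x, y]) f t <= \int[mu]_(t in `[x, y]) g t.
Proof.
move=> cf cg h; apply: le_Rintegral => //; try exact: integrable_continuous.
Qed.

Lemma RintegralD_continuous (f g : R -> R) (x y : R) : continuous f -> continuous g ->
  \int[mu]_(t in `[x, y]) (f t + g t) =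
  \int[mu]_(t in `[x, y]) f t + \int[mu]_(t in `[x, y]) g t.
Proof. by move=> cf cg; apply: RintegralD => //; exact: integrable_continuous. Qed.

Lemma RintegralZl_continuous (f : R -> R) (a x y : R) : continuous f ->
  \int[mu]_(t in `[x, y]) (a * f t) = a * \int[mu]_(t in `[x, y]) f t.
Proof. by move=> cf; apply: RintegralZl => //; exact: integrable_continuous. Qed.

Lemma Rintegral_itv_cst (r y : R) : 0 <= y -> \int[mu]_(t in `[0, y]) r = r * y.
Proof.
move=> y0; rewrite Rintegral_cst//= lebesgue_measure_itv/= lte_fin.
case: ltP => [_|y1]; first by rewrite -EFinB subr0.
by rewrite (_ : y = 0) ?mulr0//; apply/le_anti/andP.
Qed.

Lemma le_Rintegral_itv01 (f : R -> R) (y : R) : continuous f -> (forall t, 0 <= f t) ->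
  0 <= y <= 1 -> \int[mu]_(t in `[0, y]) f t <= \int[mu]_(t in `[0, 1]) f t.
Proof.
move=> cf f0 /andP[y0 y1]; rewrite /Rintegral; apply: fine_le.
- by apply: integrable_fin_num => //; exact: integrable_continuous.
- by apply: integrable_fin_num => //; exact: integrable_continuous.
apply: ge0_subset_integral => //.
- exact: (measurable_int _ (@integrable_continuous R f 0 1 cf)).
- by move=> t _; rewrite lee_fin.
- by apply: subset_itvl; rewrite bnd_simp.
Qed.

Lemma continuous_ev_cis f z : H2 f -> normc z < 1 ->
  continuous (fun t : R => ev f (z * cis t) : C).
Proof.
move=> Hf z1.
rewrite (_ : (fun t => _) = (fun t : R => csum (dil (dil f z) (cis t)))).
  by apply: continuous_csum_dil; exact: dil_summable.
by apply/funext => t; rewrite evE dil_dil.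
Qed.

Lemma cis_near1 (e : R) : 0 < e -> exists2 y, 0 < y <= 1 & forall t : R, 0 <= t <= y ->
  normc (cis t - 1 : C) < e.
Proof.
move=> e0; have /cvgC_normc/cvgrPdist_lt/(_ _ e0) := @continuous_cisX R 1%N 0.
rewrite expr1 => /nbhs_ballP[d d0 h].
have c0 : cis (0 : R) = 1 :> C by rewrite /cis mulr0 sin0 cos0.
exists (Num.min 1 (d / 2)); first by rewrite lt_min ltr01 divr_gt0//= ge_min lexx.
move=> t /andP[t0]; rewrite le_min => /andP[_ td].
have : ball (0 : R) d t.
  rewrite /ball/= sub0r normrN ger0_norm//; apply: le_lt_trans td _.
  by rewrite ltr_pdivrMr// ltr_pMr// ltr1n.
by move=> /h; rewrite sub0r normrN ger0_norm ?normc_ge0// expr1 c0.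
Qed.

End MaximumPrinciple.

(** * Kernels near a regular boundary point *)

Section KernelBound.
Context {R : realType}.
Local Notation C := (R[i]^o).
Local Notation Re := complex.Re.
Local Notation Im := complex.Im.
Local Notation mu := (@lebesgue_measure R).
Implicit Types (f g theta : nat -> C) (w z l c : C) (s r e : R).

Lemma normc_sub_circle z l : normc l = 1 ->
  2 - 2 * Re (z * l^*%C) = normc (z - l) ^+ 2 + 1 - normc z ^+ 2.
Proof.
move=> l1; have : normc l ^+ 2 = 1 by rewrite l1 expr1n.
by rewrite !sqr_normcE; case: z l {l1} => x y [a b] /= h; lra.
Qed.

Lemma Re_add4 z l (s : R) :
  Re ((z + s%:C%C) * l) + Re ((z + 'i%C * s%:C%C) * l) + Re ((z - s%:C%C) * l) +
  Re ((z - 'i%C * s%:C%C) * l) = 4 * Re (z * l).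
Proof. by case: z l => x y [a b] /=; ring. Qed.

Lemma parseval_dil f z : H2 f -> normc z < 1 ->
  \int[mu]_(t in `[0, 1]) (normc (ev f (z * cis t)) ^+ 2) = hnorm (dil f z) ^+ 2.
Proof.
move=> Hf z1; rewrite -(parseval (dil_summable Hf z1)).
by apply: eq_Rintegral => t _; rewrite evE dil_dil.
Qed.

Lemma parseval_inner_dil theta z : inner_function theta -> normc z < 1 ->
  \int[mu]_(t in `[0, 1]) (1 - normc (ev theta (z * cis t)) ^+ 2) =
  1 - hnorm (dil theta z) ^+ 2.
Proof.
move=> it z1; have Ht : H2 theta by case: it.
have cf := continuous_normc_sqr (continuous_ev_cis Ht z1).
have c1 : continuous (fun _ : R => 1 : R) by move=> t; exact: cvg_cst.
rewrite RintegralB//; try exact: integrable_continuous.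
by rewrite Rintegral01_cst parseval_dil.
Qed.

Variables (theta : nat -> C) (delta : R).
Hypotheses (it : inner_function theta) (d0 : 0 < delta) (d1 : delta <= 1).
Let Ht : H2 theta. Proof. by case: it. Qed.

(** Truncation at [delta] keeps [1 / |theta|] continuous and bounded along whole circles, even where
    [theta] vanishes; near the regular point it changes nothing. *)
Definition trunc_inv z : R := (Num.max delta (normc (ev theta z)))^-1.

Let max0 z : 0 < Num.max delta (normc (ev theta z)).
Proof. by rewrite lt_max d0. Qed.

Lemma trunc_inv_le z : trunc_inv z <= delta^-1.
Proof. by rewrite lef_pV2 ?posrE// le_max lexx. Qed.

Lemma trunc_invE z : delta <= normc (ev theta z) -> trunc_inv z = (normc (ev theta z))^-1.
Proof. by move=> h; rewrite /trunc_inv max_r. Qed.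

(** With [m = max(delta, |theta|)], [1/m - 1 = (1 - m) / m <= (1 - |theta|^2) / delta]. The mean of
    the right side over a full circle is known from [parseval_inner_dil]. *)
Lemma trunc_inv_sub1 z : normc z < 1 -> trunc_inv z <= 1 + (1 - normc (ev theta z) ^+ 2) / delta.
Proof.
move=> z1; have x1 := ev_inner_le1 it z1; have x0 := normc_ge0 (ev theta z).
move: (max0 z); rewrite /trunc_inv; set m := Num.max _ _ => m0.
have md : delta <= m by rewrite le_max lexx.
have mx : normc (ev theta z) <= m by rewrite le_max lexx orbT.
have -> : m^-1 = 1 + (1 - m) / m by field; rewrite gt_eqF.
rewrite lerD2l; apply: (@le_trans _ _ ((1 - m) / delta)).
  apply: ler_wpM2l; first by rewrite subr_ge0 ge_max d1.
  by rewrite lef_pV2.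
rewrite ler_wpM2r ?invr_ge0 ?(ltW d0)//.
by move: mx x0 x1; clearbody m; move: (normc _) => x *; nra.
Qed.

Lemma continuous_trunc_inv z : normc z < 1 ->
  continuous (fun t : R => trunc_inv (z * cis t)).
Proof.
move=> z1 t; apply: cvgV; first by rewrite gt_eqF.
have cz := cvgC_norm (continuous_ev_cis Ht z1 (x := t)).
apply: (@continuous_max _ _ (fun=> delta) (fun t => normc (ev theta (z * cis t))) t); last exact: cz.
exact: cvg_cst.
Qed.

Lemma trunc_inv_mean4 w (s rho t : R) : 0 <= rho < 1 -> 0 < s -> normc w + s <= rho ->
  (forall z, normc (z - w) <= s -> delta <= normc (ev theta (z * cis t))) ->
  4 * trunc_inv (w * cis t) <= trunc_inv ((w + s%:C%C) * cis t) +
    trunc_inv ((w + 'i%C * s%:C%C) * cis t) + trunc_inv ((w - s%:C%C) * cis t) +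
    trunc_inv ((w - 'i%C * s%:C%C) * cis t) +
    4 * (4 / (1 - rho) ^+ 4 / delta ^+ 3 + (1 - rho) ^- 6 / delta ^+ 4) * s ^+ 3.
Proof.
move=> r01 s0 ws be; pose sc : C := s%:C%C * cis t.
have ns : normc sc = s by rewrite normcM normcR normc_cis mulr1 ger0_norm// ltW.
have nw : normc (w * cis t) = normc w by rewrite normcM normc_cis mulr1.
have n1 : normc (s%:C%C : C) = s by rewrite normcR ger0_norm// ltW.
have n2 : normc ('i%C * s%:C%C : C) = s by rewrite normcM normc_i mul1r.
have h u : normc u <= s -> delta <= normc (ev theta ((w + u) * cis t)).
  by move=> us; apply: be; rewrite addrC addKr.
have b0 : delta <= normc (ev theta (w * cis t)).
  by rewrite -[w]addr0; apply: h; rewrite normc0 ltW.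
have he u (us : normc u = s) := h u (eq_ind_r (fun x => x <= s) (lexx s) us).
have b1 := he _ n1; have b2 := he _ n2.
have b3 := he _ (etrans (normcN _) n1); have b4 := he _ (etrans (normcN _) n2).
rewrite (trunc_invE b0) (trunc_invE b1) (trunc_invE b2) (trunc_invE b3) (trunc_invE b4).
have e1 : (w + s%:C%C) * cis t = w * cis t + sc by rewrite mulrDl.
have e2 : (w + 'i%C * s%:C%C) * cis t = w * cis t + 'i%C * sc by rewrite mulrDl -mulrA.
have e3 : (w - s%:C%C) * cis t = w * cis t - sc by rewrite mulrBl.
have e4 : (w - 'i%C * s%:C%C) * cis t = w * cis t - 'i%C * sc by rewrite mulrBl -mulrA.
rewrite e1 in b1 *; rewrite e2 in b2 *; rewrite e3 in b3 *; rewrite e4 in b4 *.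
rewrite -ns; apply: (inv_mean4 it d0 r01); first by rewrite nw ns.
move=> u; rewrite !inE => /or4P[|||/orP[]] /eqP ->.
- by rewrite addr0; exact: b0.
- exact: b1.
- exact: b2.
- exact: b3.
- exact: b4.
Qed.

Variables (l0 : C) (e s0 : R).
Hypotheses (l01 : normc l0 = 1) (e0 : 0 < e) (s00 : 0 < s0) (s01 : s0 <= 1).
Hypothesis big : forall z t, normc z < 1 -> normc (z - l0) < e -> 0 <= t <= s0 ->
  delta <= normc (ev theta (z * cis t)).

Let A z : R := \int[mu]_(t in `[0, s0]) trunc_inv (z * cis t).
(** A barrier: as the real part of an affine function it satisfies the four-point mean equality
    exactly, and by [normc_sub_circle] it dominates [|z - l0|^2] on the disc.
    [Kb (e / 2)^2 = 1 / delta], so at distance at least [e / 2] from [l0] the barrier outweighs the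
    crude bound [A <= s0 / delta]. [A] is not normalized, whence [s0] where 1 would be expected. *)
Let bar z : R := 2 - 2 * Re (z * l0^*%C).
Let Kb : R := 4 / (delta * e ^+ 2).
Let P z : R := A z - s0 * (1 + Kb * bar z).

Let Kb0 : 0 < Kb.
Proof. by rewrite divr_gt0// mulr_gt0// exprn_gt0. Qed.

Let bar_ge z : normc z <= 1 -> normc (z - l0) ^+ 2 <= bar z.
Proof.
move=> z1; rewrite /bar normc_sub_circle// -addrA lerDl subr_ge0.
by rewrite expr_le1 ?normc_ge0.
Qed.

Let bar_ge0 z : normc z <= 1 -> 0 <= bar z.
Proof. by move=> /bar_ge; apply: le_trans; exact: sqr_ge0. Qed.

Let A_le z : normc z < 1 -> A z <= s0 / delta.
Proof.
move=> z1; rewrite mulrC -(Rintegral_itv_cst _ (ltW s00)).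
apply: le_Rintegral_continuous; first exact: continuous_trunc_inv.
  by move=> t; exact: cvg_cst.
by move=> t _; exact: trunc_inv_le.
Qed.

(** The integrand [1 - |theta|^2] is nonnegative, so its integral over the arc is at most the one
    over the full circle, which Parseval computes. *)
Let A_le_dil z : normc z < 1 -> A z <= s0 + (1 - hnorm (dil theta z) ^+ 2) / delta.
Proof.
move=> z1; have cf := continuous_normc_sqr (continuous_ev_cis Ht z1).
have c1 (r : R) : continuous (fun _ : R => r) by move=> t; exact: cvg_cst.
pose F t := 1 - normc (ev theta (z * cis t)) ^+ 2.
have cF : continuous F by move=> t; apply: cvgB; [exact: c1|exact: cf].
have cFd : continuous (fun t => delta^-1 * F t).
  by move=> t; apply: cvgM; [exact: c1|exact: cF].
have zt t : normc (z * cis t) < 1 by rewrite normcM normc_cis mulr1.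
apply: le_trans (_ : \int[mu]_(t in `[0, s0]) (1 + delta^-1 * F t) <= _).
  apply: le_Rintegral_continuous; first exact: continuous_trunc_inv.
    by move=> t; apply: cvgD; [exact: c1|exact: cFd].
  by move=> t _; rewrite [delta^-1 * _]mulrC; exact: (trunc_inv_sub1 (zt t)).
rewrite (RintegralD_continuous 0 s0 (c1 _) cFd) (Rintegral_itv_cst _ (ltW s00)) mul1r lerD2l.
rewrite (RintegralZl_continuous delta^-1 0 s0 cF) [leLHS]mulrC ler_wpM2r ?invr_ge0 ?(ltW d0)// -(parseval_inner_dil it z1).
apply: le_Rintegral_itv01 => //; last by rewrite (ltW s00).
by move=> t; rewrite subr_ge0 expr_le1 ?normc_ge0// ev_inner_le1.
Qed.

Let A_mean4 z (s rho : R) : 0 <= rho < 1 -> 0 < s -> normc z + s <= rho ->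
  (forall u t, normc (u - z) <= s -> 0 <= t <= s0 -> delta <= normc (ev theta (u * cis t))) ->
  4 * A z <= A (z + s%:C%C) + A (z + 'i%C * s%:C%C) + A (z - s%:C%C) + A (z - 'i%C * s%:C%C) +
    s0 * (4 * (4 / (1 - rho) ^+ 4 / delta ^+ 3 + (1 - rho) ^- 6 / delta ^+ 4)) * s ^+ 3.
Proof.
move=> r01 sp zs be; have /andP[_ r1] := r01.
have zu u : normc u = s -> normc (z + u) < 1.
  by move=> us; apply: le_lt_trans (le_normcD _ _) _; rewrite us; exact: le_lt_trans zs r1.
have n1 : normc (s%:C%C : C) = s by rewrite normcR ger0_norm// ltW.
have n2 : normc ('i%C * s%:C%C : C) = s by rewrite normcM normc_i mul1r.
have z0 : normc z < 1 by apply: le_lt_trans r1; apply: le_trans zs; rewrite lerDl ltW.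
have g0 := continuous_trunc_inv z0.
have g1 := continuous_trunc_inv (zu _ n1); have g2 := continuous_trunc_inv (zu _ n2).
have g3 := continuous_trunc_inv (zu _ (etrans (normcN _) n1)).
have g4 := continuous_trunc_inv (zu _ (etrans (normcN _) n2)).
set D := 4 * (_ + _).
have c1 (r : R) : continuous (fun _ : R => r) by move=> t; exact: cvg_cst.
have g12 : continuous (fun t => trunc_inv ((z + s%:C%C) * cis t) + trunc_inv ((z + 'i%C * s%:C%C) * cis t)).
  by move=> t; apply: cvgD; [exact: g1|exact: g2].
have g123 : continuous (fun t => trunc_inv ((z + s%:C%C) * cis t) + trunc_inv ((z + 'i%C * s%:C%C) * cis t)
    + trunc_inv ((z - s%:C%C) * cis t)).
  by move=> t; apply: cvgD; [exact: g12|exact: g3].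
have g1234 : continuous (fun t => trunc_inv ((z + s%:C%C) * cis t) + trunc_inv ((z + 'i%C * s%:C%C) * cis t)
    + trunc_inv ((z - s%:C%C) * cis t) + trunc_inv ((z - 'i%C * s%:C%C) * cis t)).
  by move=> t; apply: cvgD; [exact: g123|exact: g4].
rewrite /A -(RintegralZl_continuous 4 0 s0 g0).
have -> : s0 * D * s ^+ 3 = \int[mu]_(t in `[0, s0]) (D * s ^+ 3).
  by rewrite (Rintegral_itv_cst _ (ltW s00)); move: (s ^+ 3) D => x y; ring.
rewrite -(RintegralD_continuous 0 s0 g1 g2) -(RintegralD_continuous 0 s0 g12 g3).
rewrite -(RintegralD_continuous 0 s0 g123 g4) -(RintegralD_continuous 0 s0 g1234 (c1 _)).
apply: le_Rintegral_continuous.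
- by move=> t; apply: cvgM; [exact: c1|exact: g0].
- by move=> t; apply: cvgD; [exact: g1234|exact: c1].
by move=> t t0; apply: (trunc_inv_mean4 r01 sp zs) => u uz; exact: be.
Qed.

(** Otherwise [P w > 0], and the maximum principle applies with [eta = P w / 2]. Off the inner
    region either [|z| >= r], where [A_le_dil] gives [P <= eta], or [|z - l0| >= e / 2], where the
    barrier gives [P <= 0]. *)
Lemma Rintegral_trunc_inv_le w : normc w < 1 -> normc (w - l0) < e ->
  A w <= s0 * (1 + Kb * bar w).
Proof.
move=> w1 wl; rewrite -subr_le0 -/(P w) leNgt; apply/negP => Pw.
pose eta := P w / 2; have eta0 : 0 < eta by rewrite divr_gt0.
suff : P w <= eta by rewrite /eta; move: Pw; move: (P w) => x; lra.
have ed : 0 < eta * delta by rewrite mulr_gt0.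
have [r1 /andP[r10 r11] hr] := hnorm_dil_lower Ht ed.
pose r := Num.max r1 (normc w).
have r0 : 0 <= r by rewrite le_max r10.
have r1' : r < 1 by rewrite gt_max r11.
(* The radius [r'] leaves room for the four points around [z]; being less than 1, it makes the
   Taylor constants uniform. *)
pose r' := (1 + r) / 2.
have rr' : r < r' by rewrite /r'; move: (r) r1' => x; lra.
have r'1 : r' < 1 by rewrite /r'; move: (r) r1' => x; lra.
have r'0 : 0 <= r' by rewrite (le_trans r0)// ltW.
pose D : R := 4 * (4 / (1 - r') ^+ 4 / delta ^+ 3 + (1 - r') ^- 6 / delta ^+ 4).
have D0 : 0 <= D.
  have p1 : 0 < 1 - r' by rewrite subr_gt0.
  have q (x : R) n : 0 < x -> 0 <= x ^- n by move=> x0; rewrite invr_ge0 exprn_ge0 ?(ltW x0).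
  rewrite /D; apply: mulr_ge0; first exact: ler0n.
  apply: addr_ge0; apply: mulr_ge0; try exact: q.
  by apply: mulr_ge0; [exact: ler0n|exact: q].
apply: (@max_principle4 _ [set z | normc z < r' /\ normc (z - l0) < e]
  [set z | normc z < r /\ normc (z - l0) < e / 2] P eta (s0 / delta) (s0 * D)
  (Num.min (r' - r) (e / 2)));
  last by split=> //; apply: le_lt_trans rr'; rewrite le_max lexx orbT.
- by rewrite mulr_ge0// ltW.
- by rewrite lt_min subr_gt0 rr' divr_gt0.
- move=> z /= [zr zl]; have z1 := lt_trans zr r'1; split; last exact: ltW.
  rewrite /P lerBlDr; apply: le_trans (A_le z1) _; rewrite lerDl.
  exact: (mulr_ge0 (ltW s00) (addr_ge0 ler01 (mulr_ge0 (ltW Kb0) (bar_ge0 (ltW z1))))).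
- move=> z /= [zr zl] nI; have z1 := lt_trans zr r'1.
  have [rz|rz] := leP r (normc z).
    rewrite /P lerBlDr; apply: le_trans (A_le_dil z1) _.
    have : 1 - hnorm (dil theta z) ^+ 2 <= eta * delta.
      rewrite lerBlDr -lerBlDl; have := hr z; rewrite hnorm_theta// expr1n; apply.
      by rewrite z1 andbT; apply: le_trans rz; rewrite le_max lexx.
    rewrite -ler_pdivrMr// => h.
    have : 0 <= s0 * (Kb * bar z).
      exact: (mulr_ge0 (ltW s00) (mulr_ge0 (ltW Kb0) (bar_ge0 (ltW z1)))).
    rewrite [s0 * (1 + _)]mulrDr [s0 * 1]mulr1.
    by move: h; move: (_ / delta) (s0 * (Kb * bar z)) => x y; move: eta {eta0 ed hr} => E; lra.
  have {nI rz}ez : e / 2 <= normc (z - l0) by rewrite leNgt; apply/negP => ez; exact: nI.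
  have h : delta^-1 <= Kb * bar z.
    apply: (@le_trans _ _ (Kb * (e / 2) ^+ 2)).
      rewrite le_eqVlt; apply/orP; left; apply/eqP; rewrite /Kb; field.
      by rewrite !gt_eqF.
    rewrite ler_wpM2l ?(ltW Kb0)//; apply: le_trans (bar_ge (ltW z1)).
    by rewrite ler_pXn2r ?nnegrE ?normc_ge0// divr_ge0 ?(ltW e0).
  have := A_le z1; have : s0 / delta <= s0 * (Kb * bar z) by rewrite ler_wpM2l ?(ltW s00).
  rewrite /P [s0 * (1 + _)]mulrDr [s0 * 1]mulr1; move: (A z) (s0 / delta) (s0 * (Kb * _)) => x y u.
  by move: eta eta0 {ed hr} => E; move: s00; lra.
move=> z s /= [zr zl] /andP[sp]; rewrite lt_min => /andP[sr se].
have n1 : normc (s%:C%C : C) = s by rewrite normcR ger0_norm// ltW.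
have n2 : normc ('i%C * s%:C%C : C) = s by rewrite normcM normc_i mul1r.
have zs : normc z + s <= r' by move: zr sr; move: (normc z) (r) (r') => *; lra.
have Om u : normc u = s -> normc (z + u) < r' /\ normc (z + u - l0) < e.
  move=> us; split.
    apply: le_lt_trans (le_normcD _ _) _; rewrite us.
    by move: zr sr; move: (normc z) (r) (r') => *; lra.
  rewrite addrAC; apply: le_lt_trans (le_normcD _ _) _; rewrite us.
  by move: zl se; move: (normc _) (e) => *; lra.
split; [exact: Om|exact: Om|apply: Om; exact: (etrans (normcN _) n1)
  |apply: Om; exact: (etrans (normcN _) n2)|].
have r'01 : 0 <= r' < 1 by rewrite r'0.
have m := @A_mean4 z s r' r'01 sp zs; rewrite -/D in m.
have {}m : 4 * A z <= A (z + s%:C%C) + A (z + 'i%C * s%:C%C) + A (z - s%:C%C) +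
    A (z - 'i%C * s%:C%C) + s0 * D * s ^+ 3.
  apply: m => u t us ts; apply: big => //.
    have := le_normcD z (u - z); rewrite addrC subrK => h.
    apply: le_lt_trans h _; apply: le_lt_trans r'1; apply: le_trans zs.
    by rewrite lerD2l.
  have := le_normcD (z - l0) (u - z); rewrite addrC subrKA => h.
  by apply: le_lt_trans h _; move: us zl se; move: (normc _) (normc _) (e) => *; lra.
have := Re_add4 z (l0^*%C) s; move: m; rewrite /P /bar.
move: (A z) (A _) (A _) (A _) (A _) (s0 * D * _) => a a1 a2 a3 a4 E.
set x := Re (z * _); set x1 := Re ((z + s%:C%C) * _); set x2 := Re ((z + 'i%C * _) * _).
set x3 := Re ((z - s%:C%C) * _); set x4 := Re ((z - 'i%C * _) * _) => m Ex.
have {}Ex : x4 = 4 * x - x1 - x2 - x3 by lra.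
rewrite Ex; clear Ex; clearbody x x1 x2 x3 x4 Kb; move: m.
by move: s0 => S; lra.
Qed.

End KernelBound.

(** * Functions of the model space near a regular boundary point *)

Section KernelNearCircle.
Context {R : realType}.
Local Notation C := (R[i]^o).
Local Notation Re := complex.Re.
Local Notation mu := (@lebesgue_measure R).
Implicit Types (f g theta : nat -> C) (w z l : C) (r e : R).

(* The bound for arcs of arbitrarily small length gives the pointwise one. *)
Lemma trunc_inv_le_bar theta delta l0 e s0 w : inner_function theta ->
  0 < delta <= 1 -> normc l0 = 1 -> 0 < e -> 0 < s0 <= 1 ->
  (forall z t, normc z < 1 -> normc (z - l0) < e -> 0 <= t <= s0 ->
    delta <= normc (ev theta (z * cis t))) ->
  normc w < 1 -> normc (w - l0) < e ->
  trunc_inv theta delta w <= 1 + 4 / (delta * e ^+ 2) * (2 - 2 * Re (w * l0^*%C)).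
Proof.
move=> it /andP[d0 d1] l01 e0 /andP[s00 s01] big w1 wl.
set X := 1 + _; rewrite leNgt; apply/negP => Xw.
pose Y := (X + trunc_inv theta delta w) / 2.
have c0 : w * cis 0 = w.
  by rewrite (_ : cis 0 = 1) ?mulr1// /cis mulr0 sin0 cos0.
have XY : X < Y by rewrite /Y; move: (X) (trunc_inv _ _ _) Xw => x y; lra.
have Yw : 0 < trunc_inv theta delta w - Y.
  by rewrite /Y; move: (X) (trunc_inv _ _ _) Xw => x y; lra.
have ct := continuous_trunc_inv it d0 w1.
have /cvgrPdist_lt/(_ _ Yw) := ct 0; rewrite c0 => /nbhs_ballP[b b0 hb].
pose y := Num.min s0 (b / 2).
have y0 : 0 < y by rewrite lt_min s00 divr_gt0.
have ys : y <= s0 by rewrite ge_min lexx.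
have yb : y < b by rewrite gt_min ltr_pdivrMr// ltr_pMr// ltr1n orbT.
have : Y * y <= X * y.
  rewrite [leRHS]mulrC; apply: le_trans (@Rintegral_trunc_inv_le _ theta delta it d0 d1 l0 e y
    l01 e0 y0 (le_trans ys s01) _ w w1 wl); last first.
    move=> z t z1 zl /andP[t0 ty]; apply: big => //.
    by rewrite t0 (le_trans ty).
  rewrite -(Rintegral_itv_cst _ (ltW y0)); apply: (le_Rintegral_continuous _ ct).
    by move=> t; exact: cvg_cst.
  move=> t /andP[t0 ty]; have : ball (0 : R) b t.
    rewrite /ball/= sub0r normrN ger0_norm//; exact: le_lt_trans ty yb.
  move=> /hb /(le_lt_trans (ler_norm _)); rewrite ltrD2l ltrN2; exact: ltW.
by rewrite ler_pM2r// leNgt XY.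
Qed.

(** At the radial projection [l0 = w / |w|] the barrier equals [2 (1 - |w|)], so
    [1 / |theta(w)| - 1] is at most [2 k (1 - |w|)]. Then [1 - |theta|^2 <= 2 (1 - |theta|) <= 4 k
    (1 - |w|)], whence [B = 4 k]. *)
Lemma inner_kernel_bound theta delta l e : inner_function theta -> normc l = 1 ->
  0 < delta -> 0 < e ->
  (forall z, normc z < 1 -> normc (z - l) < e -> delta <= normc (ev theta z)) ->
  exists B d : R, [/\ 0 < B, 0 < d & forall w, normc w < 1 -> normc (w - l) < d ->
    1 - normc (ev theta w) ^+ 2 <= B * (1 - normc w ^+ 2)].
Proof.
move=> it l1 d0 e0 big; pose e' := e / 2; have e'0 : 0 < e' by rewrite divr_gt0.
pose k := 4 / (delta * e' ^+ 2).
have k0 : 0 < k by rewrite divr_gt0// mulr_gt0// exprn_gt0.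
(* [e / 8] places [l0] within [e / 4] of [l], and 1/2 keeps [w] away from 0, where [w / |w|] has no
   meaning. *)
exists (4 * k), (Num.min (e / 8) (1 / 2)); split.
- by rewrite mulr_gt0.
- by rewrite lt_min !divr_gt0.
move=> w w1; rewrite lt_min => /andP[we w2].
have wl : 1 - normc w <= normc (w - l) by rewrite normcBC -l1 le_normc_sub.
have w0 : 0 < normc w by move: wl w2; move: (normc _) (normc _) => x y; lra.
pose l0 : C := (normc w)^-1%:C%C * w.
have l01 : normc l0 = 1.
  by rewrite normcM normcR ger0_norm ?invr_ge0 ?(ltW w0)// mulVf// gt_eqF.
have wE : w = (normc w)%:C%C * l0.
  by rewrite mulrA -rmorphM/= mulfV ?gt_eqF// mul1r.
have wl0 : normc (w - l0) = 1 - normc w.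
  have -> : w - l0 = - ((1 - normc w)%:C%C * l0).
    by rewrite rmorphB/= mulrBl -wE mul1r opprB.
  by rewrite normcN normcM l01 mulr1 normcR ger0_norm// subr_ge0 ltW.
have Rw : Re (w * l0^*%C) = normc w by rewrite {1}wE -mulrA mul_conjc l01 expr1n mulr1.
have ll0 : normc (l0 - l) < e / 4.
  have := le_normcD (l0 - w) (w - l); rewrite subrKA (normcBC l0) wl0.
  by move: wl we; move: (normc _) (normc _) (normc _) => x y z; lra.
have th1 := ev_inner_le1 it w1.
have dw : delta <= normc (ev theta w).
  by apply: big => //; move: we e0; move: (normc _) => x; lra.
have e4 : 0 < e / 4 by rewrite divr_gt0.
(* Rotating by [cis t] with [t <= y] moves a point of the disc by less than [e / 4]. Together with
   [e' = e / 2] and [|l0 - l| < e / 4] this keeps rotated points within [e] of [l]. *)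
have [y /andP[y0 y1] hy] := cis_near1 e4.
have := @trunc_inv_le_bar theta delta l0 e' y w it; rewrite d0 (le_trans dw th1) y0.
move=> /(_ isT l01 e'0 y1 _ w1).
rewrite (trunc_invE dw) wl0 -/k Rw => h.
have {}h : (normc (ev theta w))^-1 <= 1 + k * (2 - 2 * normc w).
  apply: h; last by rewrite /e'; move: wl we e0; move: (normc _) (normc _) => *; lra.
  move=> z t z1 zl ty; apply: big; first by rewrite normcM normc_cis mulr1.
  have -> : z * cis t - l = z * (cis t - 1) + (z - l0) + (l0 - l) by ring.
  apply: le_lt_trans (le_normcD _ _) _; apply: le_lt_trans (lerD (le_normcD _ _) (lexx _)) _.
  rewrite normcM; have zn := normc_ge0 z.
  have : normc z * normc (cis t - 1 : C) <= normc (cis t - 1 : C).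
    by rewrite ler_piMl ?normc_ge0// ltW.
  have := hy t ty; move: zl ll0; rewrite /e'.
  move: (normc z * _) (normc (z - l0)) (normc (l0 - l)) (normc _) => a b c x; lra.
have x0 := lt_le_trans d0 dw; have wn := normc_ge0 w.
move: (normc (ev theta w)) (normc w) x0 th1 h w1 wn {Rw w2 wl we w0 wE wl0 l01 ll0 dw l0 hy} => x u x0 x1 h u1 u0.
have {}h : 1 <= x * (1 + k * (2 - 2 * u)).
  by rewrite -ler_pdivrMl// mulr1.
have p0 : 0 <= k * (1 - u) by apply: mulr_ge0 (ltW k0) _; rewrite subr_ge0 ltW.
have p1 := mulr_ge0 p0 u0.
have p2 : 0 <= k * (1 - u) * (1 - x) by apply: mulr_ge0 => //; rewrite subr_ge0.
have p3 : 0 <= (1 - x) ^+ 2 by exact: sqr_ge0.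
by move: p1 p2 p3 h; clear; move: k => k; nra.
Qed.

Lemma model_space_ev_bound theta l delta e : inner_function theta -> theta 0%N = 0 ->
  normc l = 1 -> 0 < delta -> 0 < e ->
  (forall z, normc z < 1 -> normc (z - l) < e -> delta <= normc (ev theta z)) ->
  exists B d : R, [/\ 0 < B, 0 < d & forall f w, model_space theta f -> normc w < 1 ->
    normc (w - l) < d -> normc (ev f w) ^+ 2 <= B * hnorm f ^+ 2].
Proof.
move=> it t0 l1 d0 e0 /(inner_kernel_bound it l1 d0 e0)[B [d [B0 d'0 kb]]].
exists B, d; split=> // f w Kf w1 wl.
have [Kk [nk rk]] := model_space_kern it w1.
have Hf : H2 f by case: Kf.
have Hk : H2 (model_kern theta w) by case: Kk.
have w2 : 0 < 1 - normc w ^+ 2 by rewrite subr_gt0 normc_sqr_lt1.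
have nB : hnorm (model_kern theta w) ^+ 2 <= B by rewrite nk ler_pdivrMr// kb.
rewrite -(rk f Kf); apply: (@le_trans _ _ ((hnorm f * hnorm (model_kern theta w)) ^+ 2)).
  have cs := hdot_CauchySchwarz Hf Hk.
  by rewrite ler_pXn2r// nnegrE ?normc_ge0// mulr_ge0 ?hnorm_ge0.
by rewrite exprMn mulrC ler_wpM2r ?sqr_ge0.
Qed.

(** [psi] is [4 d] times the Poisson kernel of the point [q = 1 - d], a continuous substitute for
    the indicator of a short arc. On that arc [|1 - q cis t| <= 2 d], so
    [psi >= (1 - q^2) / d = 2 - d >= 1]. *)
Lemma poisson_bump (d : R) : 0 < d <= 1 -> exists psi : R -> R,
  [/\ continuous psi, forall t, 0 <= psi t, \int[mu]_(t in `[0, 1]) psi t = 4 * d &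
    forall t, normc (cis t - 1 : C) <= d -> 1 <= psi t].
Proof.
move=> /andP[d0 d1]; pose q := 1 - d; have q0 : 0 <= q by rewrite subr_ge0.
have q1 : q < 1 by rewrite gtrBl.
have nq : normc (q%:C%C : C) = q by rewrite normcR ger0_norm.
have nq1 : normc (q%:C%C : C) < 1 by rewrite nq.
have qq : 0 < 1 - q ^+ 2 by rewrite -nq subr_gt0 normc_sqr_lt1.
have sk : abs_summable (kern (q%:C%C : C)) by have [] := csum_kern nq1 (normc_cis (0 : R)).
pose psi t := 4 * d * (1 - q ^+ 2) * normc (csum (dil (kern q%:C%C) (cis t) : nat -> C)) ^+ 2.
have cf := continuous_normc_sqr (continuous_csum_dil sk).
have c0 : 0 <= 4 * d * (1 - q ^+ 2).
  by apply: mulr_ge0 (ltW qq); apply: mulr_ge0 (ltW d0); exact: ler0n.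
exists psi; split.
- by move=> t; apply: cvgM; [exact: cvg_cst|exact: cf].
- by move=> t; apply: mulr_ge0 => //; exact: sqr_ge0.
- rewrite (RintegralZl_continuous _ 0 1 cf) (parseval sk) (hnorm_kern nq1) nq.
  by rewrite -mulrA mulfV ?mulr1// gt_eqF.
move=> t td; have [_ /(congr1 (fun z : C => normc z ^+ 2))] := csum_kern nq1 (normc_cis t).
rewrite normcM normc1 exprMn expr1n /psi; set u := normc (csum _) ^+ 2 => E.
have : normc (1 - (q%:C%C)^*%C * cis t : C) <= 2 * d.
  rewrite (_ : 1 - (q%:C%C)^*%C * cis t = (1 - q)%:C%C - q%:C%C * (cis t - 1)); last first.
    by move: (q) => p; rewrite conjc_real rmorphB rmorph1; ring.
  apply: le_trans (le_normcB _ _) _; rewrite normcM nq normcR ger0_norm; last by rewrite subr_ge0 ltW.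
  have : q * normc (cis t - 1 : C) <= 1 * d by rewrite ler_pM ?normc_ge0 ?(ltW q1).
  by rewrite {2}/q; move: (q * _) => y; lra.
move: E; move: (normc (1 - _)) (normc_ge0 (1 - (q%:C%C)^*%C * cis t : C)) => x x0 E xd.
have u0 : 0 <= u by exact: sqr_ge0.
have x2 : x ^+ 2 <= 4 * d ^+ 2.
  have -> : 4 * d ^+ 2 = (2 * d) ^+ 2 by ring.
  by rewrite ler_pXn2r ?nnegrE// mulr_ge0 ?(ltW d0).
have : 1 <= u * (4 * d ^+ 2) by rewrite -[leLHS]E ler_wpM2l.
have -> : 4 * d * (1 - q ^+ 2) * u = u * (4 * d ^+ 2) * (2 - d) by rewrite /q; ring.
move: (u * _) => y y1; apply: (le_trans y1); rewrite ler_peMr//.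
  exact: (le_trans ler01 y1).
by move: d1; clear; lra.
Qed.

(** A pointwise bound is integrated over a circle of radius [r] close to 1. Near [l], [|f|^2] is at
    most [b psi] with [b = B hnorm f^2]; elsewhere [|z - l| >= d / 2] gives
    [|f|^2 <= (4 / d^2) |(z - l) f|^2]. The first part contributes at most a quarter of [hnorm f^2]
    and is absorbed by the three quarters that remain on the left. *)
Lemma model_space_shift_lower theta l delta e : inner_function theta -> theta 0%N = 0 ->
  normc l = 1 -> 0 < delta -> 0 < e ->
  (forall z, normc z < 1 -> normc (z - l) < e -> delta <= normc (ev theta z)) ->
  exists2 c : R, 0 < c & forall f, model_space theta f ->
    c * hnorm f <= hnorm (shift f - l *: f).
Proof.
move=> it t0 l1 d0 e0 /(model_space_ev_bound it t0 l1 d0 e0)[B [h [B0 h0 kb]]].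
(* [h / 2] keeps the arc within [h] of [l] even after the radius drops by at most [d / 2];
   [(16 * B)^-1] gives [4 B d <= 1 / 4]. *)
pose d := Num.min 1 (Num.min (h / 2) (16 * B)^-1).
have dp : 0 < d by rewrite !lt_min ltr01 divr_gt0//= invr_gt0 mulr_gt0.
have d1 : d <= 1 by rewrite ge_min lexx.
have dh : d <= h / 2 by rewrite !ge_min lexx !orbT.
have dB : 4 * B * d <= 1 / 4.
  have : d * (16 * B) <= 1 by rewrite -ler_pdivlMr ?mulr_gt0// div1r !ge_min lexx !orbT.
  by move: (d) (B) => x y; lra.
have d01 : 0 < d <= 1 by rewrite dp.
have [psi [cpsi psi0 ipsi psi1]] := poisson_bump d01.
exists (d / 4); first by rewrite divr_gt0.
move=> f Kf; have Hf : H2 f by case: Kf.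
set g := shift f - l *: f; have Hg : H2 g.
  by apply: H2B; [exact: H2_shift|exact: (H2Z (a := l) Hf)].
have [n0|n0] := eqVneq (hnorm f) 0; first by rewrite n0 mulr0 hnorm_ge0.
have {}n0 : 0 < hnorm f ^+ 2 by rewrite exprn_even_gt0.
have n40 : 0 < hnorm f ^+ 2 / 4 by rewrite divr_gt0.
have [r1 /andP[r10 r11] hr] := hnorm_dil_lower Hf n40.
pose r := Num.max r1 (1 - d / 2).
have r0 : 0 <= r by rewrite le_max r10.
have rd : 1 - r <= d / 2 by rewrite lerBlDr -lerBlDl le_max lexx orbT.
have r1' : r < 1 by rewrite gt_max r11 gtrBl divr_gt0.
(* Starting the circle at [r l] makes [t = 0] correspond to [l], so [psi] needs no translation. *)
pose z0 : C := r%:C%C * l.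
have nz0 : normc z0 = r by rewrite normcM l1 mulr1 normcR ger0_norm.
have z01 : normc z0 < 1 by rewrite nz0.
have cF := continuous_normc_sqr (continuous_ev_cis Hf z01).
have cG := continuous_normc_sqr (continuous_ev_cis Hg z01).
have lowF : hnorm f ^+ 2 - hnorm f ^+ 2 / 4 <= hnorm (dil f z0) ^+ 2.
  by apply: hr; rewrite nz0 r1' andbT le_max lexx.
have upG : hnorm (dil g z0) ^+ 2 <= hnorm g ^+ 2.
  have [_ le] := hnorm_dil_z Hg (ltW z01).
  by rewrite ler_pXn2r// nnegrE hnorm_ge0.
pose b := B * hnorm f ^+ 2; pose a := 4 / d ^+ 2.
have b0 : 0 <= b by rewrite mulr_ge0 ?(ltW B0) ?(ltW n0).
have a0 : 0 <= a by rewrite divr_ge0 ?exprn_ge0 ?(ltW dp).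
have pw t : normc (ev f (z0 * cis t)) ^+ 2 <= b * psi t + a * normc (ev g (z0 * cis t)) ^+ 2.
  have zt1 : normc (z0 * cis t) < 1 by rewrite normcM normc_cis mulr1.
  have ztl : normc (z0 * cis t - l) = normc (r%:C%C * cis t - 1 : C).
    have -> : z0 * cis t - l = l * (r%:C%C * cis t - 1) by rewrite /z0; ring.
    by rewrite normcM l1 mul1r.
  have nr : normc ((1 - r)%:C%C * cis t : C) = 1 - r.
    by rewrite normcM normc_cis mulr1 normcR ger0_norm// subr_ge0 ltW.
  have er : r%:C%C * cis t - 1 = (cis t - 1) - (1 - r)%:C%C * cis t :> C.
    by clear; move: (r) => p; rewrite rmorphB rmorph1; ring.
  have [td|td] := leP (normc (cis t - 1 : C)) d.
    rewrite -[leLHS]addr0; apply: lerD; last first.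
      by apply: mulr_ge0 => //; exact: sqr_ge0.
    apply: (@le_trans _ _ b); last by rewrite ler_peMr// psi1.
    apply: kb => //; rewrite ztl er; apply: le_lt_trans (le_normcB _ _) _.
    rewrite nr; move: td rd dh h0; move: (normc _) (d) => x y; lra.
  rewrite -[leLHS]add0r; apply: lerD; first exact: mulr_ge0.
  rewrite /g ev_shift_subZ// normcM exprMn mulrA.
  rewrite -[leLHS]mul1r; apply: ler_wpM2r; first exact: sqr_ge0.
  have h2 : d / 2 <= normc (z0 * cis t - l).
    rewrite ztl er; apply: le_trans (le_normc_sub _ _); rewrite nr.
    by move: td rd; move: (normc _) (d) => x y; lra.
  rewrite /a mulrAC ler_pdivlMr ?exprn_gt0// mul1r.
  have : (d / 2) ^+ 2 <= normc (z0 * cis t - l) ^+ 2.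
    by rewrite ler_pXn2r ?nnegrE ?normc_ge0// divr_ge0 ?(ltW dp).
  by move: (normc _ ^+ 2) (d) => x y; nra.
have cbp : continuous (fun t => b * psi t).
  by move=> t; apply: cvgM; [exact: cvg_cst|exact: cpsi].
have caG : continuous (fun t => a * normc (ev g (z0 * cis t)) ^+ 2).
  by move=> t; apply: cvgM; [exact: cvg_cst|exact: cG].
have cs : continuous (fun t => b * psi t + a * normc (ev g (z0 * cis t)) ^+ 2).
  by move=> t; apply: cvgD; [exact: cbp|exact: caG].
have := le_Rintegral_continuous cF cs (fun t (_ : 0 <= t <= 1) => pw t).
rewrite (RintegralD_continuous 0 1 cbp caG) (RintegralZl_continuous b 0 1 cpsi).
rewrite (RintegralZl_continuous a 0 1 cG) (parseval_dil Hf z01) (parseval_dil Hg z01) ipsi.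
move=> main; have nf := hnorm_ge0 f; have ng := hnorm_ge0 g.
have agg : a * hnorm (dil g z0) ^+ 2 <= a * hnorm g ^+ 2 by rewrite ler_wpM2l.
have bd : b * (4 * d) <= hnorm f ^+ 2 / 4.
  rewrite /b (_ : _ * (4 * d) = hnorm f ^+ 2 * (4 * B * d)); last by ring.
  by rewrite ler_wpM2l ?(ltW n0)// -[leRHS]div1r.
have key : hnorm f ^+ 2 / 2 <= a * hnorm g ^+ 2.
  move: main agg bd lowF; move: (hnorm f ^+ 2) (hnorm (dil f z0) ^+ 2) (a * hnorm (dil g z0) ^+ 2).
  by move: (a * hnorm g ^+ 2) (b * _) => x1 x2 x3 x4 x5; lra.
have {}key : (d / 4 * hnorm f) ^+ 2 <= hnorm g ^+ 2.
  have : d ^+ 2 / 4 * (hnorm f ^+ 2 / 2) <= d ^+ 2 / 4 * (a * hnorm g ^+ 2).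
    by rewrite ler_wpM2l// divr_ge0 ?sqr_ge0.
  have -> : d ^+ 2 / 4 * (a * hnorm g ^+ 2) = hnorm g ^+ 2 by rewrite /a; field; rewrite gt_eqF.
  apply: le_trans; rewrite exprMn; move: (hnorm f ^+ 2) n0 => x x0.
  have : 0 <= d ^+ 2 * x by rewrite mulr_ge0 ?sqr_ge0 ?(ltW x0).
  by rewrite exprMn; move: (d ^+ 2) => y; lra.
by move: key; rewrite ler_pXn2r// ?nnegrE// mulr_ge0// divr_ge0 ?(ltW dp).
Qed.

End KernelNearCircle.

(** * The compressed shift *)

Section Spectrum.
Context {R : realType}.
Local Notation C := (R[i]^o).
Local Notation Re := complex.Re.
Implicit Types (f g p q : nat -> C) (w z l : C) (M : set (nat -> C)).

(** [xget] returns some element of the set; two elements differ by a vector of [M] orthogonal to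
    itself. *)
Lemma orth_proj_eq M g p : closed_subspace M -> H2 g -> M p ->
  (forall q, M q -> hdot (g - p) q = 0) -> orth_proj M g = p.
Proof.
move=> cM Hg Mp po; rewrite /orth_proj.
have [M' o'] := @xgetPex _ 0 [set p | M p /\ forall q, M q -> hdot (g - p) q = 0]
  (ex_intro _ p (conj Mp po)).
set p' := xget _ _ in M' o' *.
have MH := closed_subspace_H2 cM; have Hp := MH _ Mp; have Hp' := MH _ M'.
have Md : M (p' - p) by exact: closed_subspaceB.
have Hd := MH _ Md.
have d0 : hdot (p' - p) (p' - p) = 0.
  have {1}-> : p' - p = (g - p) - (g - p') by rewrite opprB [RHS]addrC subrKA.
  by rewrite (hdotBl (H2B Hg Hp) (H2B Hg Hp') Hd) po// o'// subrr.
apply/eqP; rewrite -subr_eq0; apply/eqP/(hnorm_eq0 Hd).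
move: d0; rewrite (hdotff Hd) => /(congr1 (@complex.Re R))/= /eqP.
by rewrite sqrf_eq0 => /eqP.
Qed.

Lemma nbhsC_normc l (V : set C) : nbhs l V <->
  exists2 d : R, 0 < d & forall w, normc (w - l) < d -> V w.
Proof.
split=> [/nbhs_ballP[e /= e0 eV]|[d d0 dV]].
  have eE : e = (Re e)%:C%C by move: e0; case: (e) => x y; rewrite ltcE/= => /andP[/eqP -> _].
  exists (Re e); first by move: e0; rewrite eE ltcR.
  move=> w wl; apply: eV; rewrite /ball/= eE distrC.
  by change ((normc (w - l))%:C%C < (Re e)%:C%C); rewrite ltcR.
have /cvgC_normc/cvgrPdist_lt/(_ _ d0) : w @[w --> l] --> l by exact: cvg_id.
by apply: filterS => w; rewrite sub0r normrN ger0_norm ?normc_ge0//; exact: dV.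
Qed.

Lemma inner_spectrumP theta l : normc l <= 1 -> inner_spectrum theta l <->
  forall d e : R, 0 < d -> 0 < e ->
    exists w, [/\ normc w < 1, normc (w - l) < d & normc (ev theta w) < e].
Proof.
move=> l1; rewrite /inner_spectrum/= limf_einfE; split=> [[_ h] d e d0 e0|h].
  apply: contrapT => no.
  have : (e%:E <= 0 :> \bar R)%E.
    rewrite -h; pose V : set C := [set w | normc w < 1 /\ normc (w - l) < d].
    have FV : within disc (nbhs l) V.
      by rewrite /within/=; apply/nbhsC_normc; exists d => // w wd w1.
    apply: (@le_trans _ _ (ereal_inf ((fun z : C => (normc (ev theta z))%:E) @` V))).
      apply/ereal_infP => _ [w [w1 wd] <-]; rewrite lee_fin leNgt; apply/negP => we.
      by apply: no; exists w.
    by apply: ereal_sup_ubound; exists V.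
  by rewrite lee_fin leNgt e0.
split=> //; apply/eqP; rewrite eq_le; apply/andP; split.
  apply: ge_ereal_sup => _ [V FV <-]; apply/lee_addgt0Pr => e e0; rewrite add0e.
  have /nbhsC_normc[d d0 dV] : nbhs l [set w | disc w -> V w] by exact: FV.
  have [w [w1 wd we]] := h d e d0 e0.
  apply: (@le_trans _ _ (normc (ev theta w))%:E); last by rewrite lee_fin ltW.
  by apply: ereal_inf_lbound; exists w => //; exact: dV.
apply: (@le_trans _ _ (ereal_inf ((fun z : C => (normc (ev theta z))%:E) @` setT))).
  by apply/ereal_infP => _ [w _ <-]; rewrite lee_fin normc_ge0.
by apply: ereal_sup_ubound; exists setT => //; exact: filterT.
Qed.

Variables (M : set (nat -> C)) (h theta : nat -> C).
Hypotheses (cM : closed_subspace M) (hrep : hitt_representation M h theta).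

Local Notation K := (model_space theta).
Local Notation v := (hdot (hmul theta h) h).
Local Notation V := (model_shift theta v).

Let it : inner_function theta. Proof. by case: hrep. Qed.
Let theta0 : theta 0%N = 0. Proof. by case: hrep. Qed.
Let Mh : M h. Proof. by case: hrep => -[]. Qed.
Let nh : hnorm h = 1. Proof. by case: hrep => -[]. Qed.
Let ME : M = [set hmul h f | f in K]. Proof. by case: hrep. Qed.
Let Ht : H2 theta. Proof. by case: it. Qed.
Let MH f : M f -> H2 f. Proof. exact: closed_subspace_H2. Qed.
Let Hh : H2 h. Proof. exact: MH. Qed.
Let cK : closed_subspace K. Proof. exact: model_space_closed. Qed.
Let KH f : K f -> H2 f. Proof. by case. Qed.
Let KM f : K f -> M (hmul h f). Proof. by move=> Kf; rewrite ME; exists f. Qed.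
Let iso f : K f -> hnorm (hmul h f) = hnorm f. Proof. by case: hrep => _ _ _ _; exact. Qed.
Let Hth : H2 (hmul theta h). Proof. exact: H2_inner_hmul. Qed.
Let K1 : K seq1. Proof. exact: model_space_seq1. Qed.

Lemma hdot_extremal f g : K f -> K g -> hdot (hmul h f) (hmul h g) = hdot f g.
Proof.
move=> Kf Kg; have KiD : K ('i%C *: f + g) by apply: (closed_subspaceD cK _ Kg); exact: closed_subspaceZ.
apply: (hdot_polarization (MH (KM Kf)) (MH (KM Kg)) (KH Kf) (KH Kg) (iso Kf) (iso Kg)).
  by rewrite -hmulDr (iso (closed_subspaceD cK Kf Kg)).
by rewrite -hmulZr -hmulDr (iso KiD).
Qed.

(* As [theta] and [h g - g(0) h] are divisible by [z], both inner products reduce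
   to inner products in [K]. *)
Lemma hdot_theta_extremal g : K g -> hdot (hmul theta h) (hmul h g) = v * (g 0%N)^*%C.
Proof.
move=> Kg; have Kg1 := model_space_shift_adj it Kg.
have Kt1 := model_space_shift_adj_theta it.
have Hg1 := MH (KM Kg1); have Ht1 := MH (KM Kt1).
have -> : hmul h g = g 0%N *: h + shift (hmul h (shift_adj g)).
  by rewrite -hmul_shiftr shift_shift_adj hmulBr hmulZr hmul1r addrC subrK.
have thE : hmul theta h = shift (hmul h (shift_adj theta)).
  by rewrite -hmul_shiftr (shift_shift_adj_theta theta0) hmulC.
rewrite (hdotDr (H2Z (a := g 0%N) Hh) (H2_shift Hg1) Hth) (hdotZr _ Hh Hth) [RHS]mulrC.
rewrite {2}thE (hdot_shift Ht1 Hg1).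
rewrite (hdot_extremal Kt1 Kg1) (hdot_shift_adjl Ht (KH Kg1)) shift_shift_adj.
have H1 : H2 (seq1 : nat -> C) by exact: H2_seq1.
rewrite (hdotBr (KH Kg) (H2Z (a := g 0%N) H1) Ht) (hdotZr _ H1 Ht) hdot_seq1r theta0.
by rewrite (hdot_theta_model it Kg) mulr0 subr0 addr0.
Qed.

Lemma normc_v_lt1 : normc v < 1.
Proof.
have h0 : 0 < normc (h 0%N).
  case: hrep => -[_ _ h0 _] _ _ _ _; rewrite normc_gt0; exact: lt0r_neq0.
have Hv : H2 (- v *: h) by exact: H2Z.
have := le_coef_hnorm 0 (H2D Hth Hv).
have -> : (hmul theta h + - v *: h) 0%N = - v * h 0%N.
  rewrite -[LHS]/(hmul theta h 0%N + - v * h 0%N) /hmul big_ord_recr big_ord0/= theta0.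
  by rewrite mul0r !add0r.
rewrite normcM normcN => le0.
have {le0} : (normc v * normc (h 0%N)) ^+ 2 <= hnorm (hmul theta h + - v *: h) ^+ 2.
  by rewrite ler_pXn2r// nnegrE ?hnorm_ge0// mulr_ge0 ?normc_ge0.
rewrite (hnorm_sqrD Hth Hv) (hnorm_inner it Hh) (hnormZ _ Hh) nh (hdotZr _ Hh Hth) normcN.
have -> : Re ((- v)^*%C * v) = - normc v ^+ 2.
  by rewrite sqr_normcE; case: (v) => x y /=; ring.
move: (normc v) (normc_ge0 v) (normc (h 0%N)) h0 => x x0 y y0 le0.
rewrite ltNge; apply/negP => x1; have : 0 < (x * y) ^+ 2.
  by rewrite exprn_gt0// mulr_gt0// (lt_le_trans ltr01).
by move: le0; move: (x * y) => u; nra.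
Qed.

(** [z h f - h V f = c (theta h - v h)], and against [h g] both terms give [v conj(g(0))], the
    second because [<h, h g> = <1, g>]. *)
Lemma compressed_shift_extremal f : K f ->
  compressed_shift M (hmul h f) = hmul h (V f).
Proof.
move=> Kf; have KV := model_space_model_shift v it theta0 Kf.
have Hhf := MH (KM Kf).
apply: (orth_proj_eq cM (H2_shift Hhf) (KM KV)).
rewrite ME => _ [g Kg <-].
rewrite -hmul_shiftr -hmulBr /model_shift opprB addrCA subrr addr0.
set c := hdot (shift f) theta.
rewrite hmulZr hmulBr hmulZr hmul1r (hmulC h theta).
have Hhg := MH (KM Kg); have Hvh : H2 (v *: h) by exact: H2Z.
rewrite (hdotZl _ (H2B Hth Hvh) Hhg) (hdotBl Hth Hvh Hhg) (hdotZl _ Hh Hhg).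
have -> : hdot h (hmul h g) = (g 0%N)^*%C.
  by rewrite -{1}(hmul1r h) (hdot_extremal K1 Kg) (hdot_seq1l (KH Kg)).
by rewrite (hdot_theta_extremal Kg) subrr mulr0.
Qed.

Let T := compressed_shift M.

Let TB f l : K f -> T (hmul h f) - l *: hmul h f = hmul h (V f - l *: f).
Proof. by move=> Kf; rewrite /T (compressed_shift_extremal Kf) [RHS]hmulBr hmulZr. Qed.

Let MT f : M f -> M (T f).
Proof.
rewrite {1}ME => -[g Kg <-]; rewrite /T (compressed_shift_extremal Kg).
by apply: KM; exact: model_space_model_shift.
Qed.

Let linear_T : linear_on M T.
Proof.
move=> a f g; rewrite ME => -[f' Kf <-] [g' Kg <-].
have Kfg : K (a *: f' + g') by apply: closed_subspaceD => //; exact: closed_subspaceZ.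
rewrite -hmulZr -hmulDr /T (compressed_shift_extremal Kf) (compressed_shift_extremal Kg).
by rewrite (compressed_shift_extremal Kfg) (linear_model_shift v it a Kf Kg) [LHS]hmulDr hmulZr.
Qed.

Let KV f l : K f -> K (V f - l *: f).
Proof.
move=> Kf; apply: closed_subspaceB => //; last exact: closed_subspaceZ.
exact: model_space_model_shift.
Qed.

(** Multiplication by [h] is an isometry of [K] onto [M], hence injective, and intertwines the two
    operators; both conditions transfer. *)
Lemma bijective_compressed_shift l :
  bijective_below M T l <-> bijective_below K V l.
Proof.
split=> -[[e e0 lb] sur]; split.
- by exists e => // f Kf; rewrite -iso// -(iso (KV l Kf)) -TB//; exact: lb (KM Kf).
- move=> g Kg; have [f] := sur _ (KM Kg); rewrite {1}ME => -[f' Kf' <-].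
  rewrite (TB l Kf') => E; exists f' => //; apply/eqP; rewrite -subr_eq0; apply/eqP.
  have Kd : K (V f' - l *: f' - g) by apply: closed_subspaceB => //; exact: KV.
  by apply: (hnorm_eq0 (KH Kd)); rewrite -(iso Kd) hmulBr E subrr hnorm0.
- exists e => // f; rewrite {1}ME => -[f' Kf' <-].
  by rewrite (TB l Kf') (iso Kf') (iso (KV l Kf')); exact: lb.
- move=> g; rewrite {1}ME => -[g' Kg' <-]; have [f Kf fE] := sur g' Kg'.
  by exists (hmul h f); [exact: KM|rewrite (TB l Kf) fE].
Qed.

Lemma op_spectrum_compressed_shift l : op_spectrum M (compressed_shift M) l <->
  (disc l /\ ev theta l = v) \/ (inner_spectrum theta l /\ circle l).
Proof.
apply: iff_trans (op_spectrumP cM MT linear_T l) _.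
have v1 := normc_v_lt1; rewrite /disc /circle/=.
have [l1|l1|l1] := ltgtP (normc l) 1.
- split=> [nb|[[_ tv]|[_]]].
  + left; split=> //; apply/eqP; apply/negPn/negP => tv; apply: nb.
    by apply/bijective_compressed_shift; exact: bijective_disc.
  + by move=> /bijective_compressed_shift; exact: not_bijective_disc.
  + by move=> E; move: l1; rewrite E ltxx.
- split=> [nb|[[]|[_]]].
  + by case: nb; apply/bijective_compressed_shift; exact: model_shift_bijective_outside.
  + by [].
  + by move=> E; move: l1; rewrite E ltxx.
have spP := inner_spectrumP theta (eq_ind_r (fun x => x <= 1) (lexx 1) l1).
split=> [nb|[[]|[/spP sp _]]].
(* If the condition failed for some [d] and [e], then [|theta| >= e] on the disc within [d] of [l],
   which is the hypothesis of [model_space_shift_lower]. *)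
- right; split=> //; apply/spP => d e d0 e0; apply: contrapT => no; apply: nb.
  apply/bijective_compressed_shift; apply: bijective_circle => //.
  apply: (model_space_shift_lower it theta0 l1 e0 d0) => w w1 wd.
  by rewrite leNgt; apply/negP => we; apply: no; exists w.
- by [].
- move=> /bijective_compressed_shift; apply: not_bijective_circle => // d d0.
  have h2 : 0 < 2^-1 :> R by rewrite invr_gt0.
  by have [w [w1 wd we]] := sp d _ d0 h2; exists w; split=> //; exact: ltW.
Qed.

End Spectrum.

Theorem theorem3p9 (R : realType) (M : set (nat -> R[i]^o))
    (h theta : nat -> R[i]^o)
    (hM : nearly_invariant M) (hrep : hitt_representation M h theta) :
  let v := circle_int (fun t => bdry theta t * `|bdry h t| ^+ 2) in
  op_spectrum M (compressed_shift M) =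
    [set lambda : R[i]^o | disc lambda /\ ev theta lambda = v] `|`
    (inner_spectrum theta `&` circle).
Proof.
have cM := hM.1; have [[Mh _ _ _] it _ _ _] := hrep.
rewrite (circle_int_hdot it (closed_subspace_H2 cM Mh)) => v.
by apply/funext => l; apply/propext; exact: op_spectrum_compressed_shift.
Qed.
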